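(* Let $S\subset C(\mathbf{k})$ be finite and let $F,G\in K[x_1,\dots,x_n]$ be a coprime pair of nonconstant polynomials. For any $\epsilon>0$ there exist an integer $m$ and positive reals $c_1,c_2,c_3,c_4$, depending only on $\epsilon$ (for the given $n,F,G$; in particular independent of $S$ and of the tuple below), such that for every $(g_1,\dots,g_n)\in(\mathcal{O}_S^* )^n$ with $$\max_{1\le i\le n}h(g_i)\ge c_1(\tilde h(F)+\tilde h(G))+c_2\max\{0,2\mathfrak g-2+|S|\},$$ either $$h(g_1^{m_1}\cdots g_n^{m_n})\le c_3(\tilde h(F)+\tilde h(G))+c_4\max\{0,2\mathfrak g-2+|S|\}$$ for some integers $m_1,\dots,m_n$, not all zero, with $\sum|m_i|\le 2m$, or the following both hold: (a) $N_{S,\gcd}(F(g_1,\dots,g_n),G(g_1,\dots,g_n))\le\epsilon\max_i h(g_i)$; (b) if moreover not both $F$ and $G$ vanish at $(0,\dots,0)$, then $h_{\gcd}(F(g_1,\dots,g_n),G(g_1,\dots,g_n))\le\epsilon\max_i h(g_i)$.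
   Context: $\mathbf{k}$ is an algebraically closed field of characteristic zero, $C$ a smooth projective curve over $\mathbf{k}$ of genus $\mathfrak g$, $K=\mathbf{k}(C)$; $v_{\mathfrak p}$ is the order-of-vanishing valuation at $\mathfrak p\in C(\mathbf{k})$. $\mathcal{O}_S^*=\{f\in K^*: v_{\mathfrak p}(f)=0\ \forall\mathfrak p\notin S\}$. For $f\in K^*$: $v^0_{\mathfrak p}(f)=\max\{0,v_{\mathfrak p}(f)\}$, $h(f)=\sum_{\mathfrak p}\max\{0,-v_{\mathfrak p}(f)\}$. For $f,g\in K$: $N_{S,\gcd}(f,g)=\sum_{\mathfrak p\notin S}\min\{v^0_{\mathfrak p}(f),v^0_{\mathfrak p}(g)\}$ and $h_{\gcd}(f,g)=\sum_{\mathfrak p\in C}\min\{v^0_{\mathfrak p}(f),v^0_{\mathfrak p}(g)\}$. For nonzero $F=\sum a_{\mathbf i}\mathbf{x}^{\mathbf i}$, $v_{\mathfrak p}(F)=\min_{a_{\mathbf i}\neq0}v_{\mathfrak p}(a_{\mathbf i})$ and $\tilde h(F)=-\sum_{\mathfrak p}\min\{0,v_{\mathfrak p}(F)\}$. *)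

(* Defs.v *)
From HB Require Import structures.
From mathcomp Require Import all_boot all_order all_algebra.
From mathcomp Require Import reals.
From mathcomp Require Import mpoly.
From Stdlib Require Import ClassicalEpsilon.
From Stdlib Require List.

Set Implicit Arguments.
Unset Strict Implicit.
Unset Printing Implicit Defensive.

Import Order.TTheory GRing.Theory Num.Theory.
Local Open Scope ring_scope.

Section FunctionField.

Variables (k : closedFieldType) (K : fieldType) (iota : {rmorphism k -> K}).

Definition function_field : Prop :=
  exists t : K,
    (forall p : {poly k}, (map_poly iota p).[t] = 0 -> p = 0) /\
    exists (d : nat) (b : 'I_d -> K),
      forall x : K, exists a c : 'I_d -> {poly k},
        (forall i, (map_poly iota (c i)).[t] != 0) /\
        x = \sum_(i < d) (map_poly iota (a i)).[t] / (map_poly iota (c i)).[t] * b i.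

(* A place of K/k (= a point of C(k), k being algebraically closed):
   a normalized discrete valuation of K trivial on k; by convention the
   stored function takes the value 0 at 0 (the value v(0) = +oo is handled
   separately wherever it matters). *)
Definition is_place (v : K -> int) : Prop :=
  [/\ v 0 = 0,
      forall x y, x != 0 -> y != 0 -> v (x * y) = v x + v y,
      forall x y, x != 0 -> y != 0 -> x + y != 0 ->
        Num.min (v x) (v y) <= v (x + y),
      forall c : k, c != 0 -> v (iota c) = 0
    & exists x, v x = 1].

Record place := Place { pval :> K -> int; pvalP : is_place pval }.

(* Sum over all places of a finitely supported nat-valued function.
   (Returns an unspecified value if the support is infinite; this never
   happens for the functions used below.) *)
Definition fsumn (f : place -> nat) : nat :=
  epsilon (inhabits 0%N) (fun N => exists s : seq place,
    [/\ List.NoDup s, (forall p, f p <> 0%N -> List.In p s)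
      & N = \sum_(p <- s) f p]).

(* Divisors, Riemann–Roch spaces, genus (Riemann's definition,
   g = max_D (deg D - ell D + 1), as in Stichtenoth). *)
Definition in_LD (D : place -> int) (x : K) : Prop :=
  x = 0 \/ forall p : place, 0 <= pval p x + D p.

Definition k_indep (d : nat) (b : 'I_d -> K) : Prop :=
  forall c : 'I_d -> k, \sum_(i < d) iota (c i) * b i = 0 -> forall i, c i = 0.

Definition ell (D : place -> int) (d : nat) : Prop :=
  (exists b : 'I_d -> K, (forall i, in_LD D (b i)) /\ k_indep b) /\
  ~ (exists b : 'I_d.+1 -> K, (forall i, in_LD D (b i)) /\ k_indep b).

Definition divisor_deg (D : place -> int) (dg : int) : Prop :=
  exists s : seq place, [/\ List.NoDup s,
     (forall p, D p <> 0 -> List.In p s) & dg = \sum_(p <- s) D p].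

Definition is_genus (g : nat) : Prop :=
  (forall D dg d, divisor_deg D dg -> ell D d -> dg - d%:Z + 1 <= g%:Z) /\
  (exists D dg d, [/\ divisor_deg D dg, ell D d & dg - d%:Z + 1 = g%:Z]).

Definition v0 (p : place) (f : K) : nat := absz (Num.max 0 (pval p f)).

(* local contribution min(v^0_p f, v^0_p g), with v_p(0) = +oo
   (the case f = g = 0, where it is +oo, is excluded separately) *)
Definition loc_gcd (p : place) (f g : K) : nat :=
  if f == 0 then v0 p g else if g == 0 then v0 p f else minn (v0 p f) (v0 p g).

Definition ht (f : K) : nat := fsumn (fun p => absz (Num.max 0 (- pval p f))).

Definition S_unit (S : seq place) (f : K) : Prop :=
  f != 0 /\ forall p : place, ~ List.In p S -> pval p f = 0.

Definition not_in (S : seq place) (p : place) : bool :=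
  if excluded_middle_informative (List.In p S) then false else true.

(* N_{S,gcd}(f,g) <= B  (false when f = g = 0, where N_{S,gcd} = +oo) *)
Definition NSgcd_le (R : realType) (S : seq place) (f g : K) (B : R) : Prop :=
  (f != 0 \/ g != 0) /\
  (fsumn (fun p => if not_in S p then loc_gcd p f g else 0%N))%:R <= B.

Definition hgcd_le (R : realType) (f g : K) (B : R) : Prop :=
  (f != 0 \/ g != 0) /\ (fsumn (fun p => loc_gcd p f g))%:R <= B.

Variable n : nat.

Definition vpoly (p : place) (F : {mpoly K[n]}) : int :=
  let s := [seq pval p (F@_m) | m <- msupp F] in foldr Num.min (head 0 s) s.

Definition htilde (F : {mpoly K[n]}) : nat :=
  fsumn (fun p => absz (Num.max 0 (- vpoly p F))).

Definition mdvd (D F : {mpoly K[n]}) : Prop := exists Q, F = D * Q.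
Definition coprime_mpoly (F G : {mpoly K[n]}) : Prop :=
  forall D, mdvd D F -> mdvd D G -> (msize D <= 1)%N.

Definition nonconstant (F : {mpoly K[n]}) : bool := (1 < msize F)%N.

Definition hmax (g : 'I_n -> K) : nat := \max_(i < n) ht (g i).

End FunctionField.

(* Main.v *)
Require Import Defs.
From HB Require Import structures.
From mathcomp Require Import all_boot all_order all_algebra.
From mathcomp Require boolp.
From mathcomp Require Import reals.
From mathcomp Require Import mpoly.
From mathcomp Require Import zify ring lra.
From Stdlib Require Import Classical ClassicalEpsilon.
From Stdlib Require List.

Import Order.TTheory GRing.Theory Num.Theory.
Local Open Scope ring_scope.

(* Fix m and let (phi_j) be a basis of the polynomials of partial degrees < m found in the ideal
   (F, G); coprimality makes their number r close to the number N of all monomials, so that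
   n m (N - r) <= eps r. Multiplying the values phi_j(g) by a basis of a large Riemann-Roch space
   gives functions which vanish to order min(v_p F(g), v_p G(g)) at every p outside S, up to the
   heights of F and G. If these functions are linearly independent over k, their Wronskian with
   respect to a derivation of K is nonzero. At p in S its order is bounded below after a
   change of basis which makes the pivots the monomials of least order, and by the product formula
   these contributions add up to at least - eps max h(g_i) per function, up to O(2 genus - 2 + |S|)
   for the derivation. As the degree of a principal divisor is 0, the order outside S is small,
   which is (a). If the functions are dependent, the S-units g^i satisfy a linear relation with
   coefficients of bounded height, and the Wronskian of a minimal such relation bounds the height
   of a quotient of two monomials. For (b), the places of S are treated by replacing the
   constant monomial by F(g) in the family of all monomials. *)

Set Implicit Arguments.
Unset Strict Implicit.
Unset Printing Implicit Defensive.

(** * Valuations *)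

(** Two requirements shape the estimates. First, errors must be proportional to the heights of F and
    G and to max(0, 2 genus - 2 + |S|), although the auxiliary data depend on F and G without
    control. Heights are integers and F, G are fixed, so any constant attached to the data is
    absorbed once the height sum is at least 1; if it is 0, all coefficients are constants, the data
    are chosen constant, and the error vanishes. Likewise, in genus at least 1 with S nonempty, 2
    genus - 2 + |S| >= 1 absorbs the bad places of one fixed derivation; in genus 0 the derivation
    is adapted to S so as to lose exactly |S| - 2. Second, the Wronskian tolerates changes of basis
    over k, whereas reducing the phi_j to pivots uses coefficients in K. The reduced rows are
    therefore multiplied by a Riemann-Roch space of dimension w0; the products lie in the span of
    the phi_j times a larger space of dimension w, and w0 / w tends to 1. Each monomial outside the
    pivots costs at most m times the sum of the heights h(g_i), hence the factor m n. Places are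
    abstract valuations and the genus is Riemann's, so the product formula and the finiteness of
    zeros and poles are derived from Riemann's inequality. *)

Section PlaceEq.
Variables (k : closedFieldType) (K : fieldType) (iota : {rmorphism k -> K}).

(** Places are functions, so their equality is decided classically; this makes duplicate-free
    sequences of places available as finite sets. *)
HB.instance Definition _ := boolp.gen_eqMixin (place iota).

Lemma List_InP (p : place iota) s : List.In p s <-> p \in s.
Proof.
elim: s => //= q s IH; rewrite inE; split.
  by case=> [->|/IH->]; rewrite ?eqxx ?orbT.
by case/orP=> [/eqP->|/IH]; [left|right].
Qed.

Lemma List_NoDupP (s : seq (place iota)) : List.NoDup s <-> uniq s.
Proof.
elim: s => [|q s IH] /=; first by split=> // _; constructor.
split; first by move=> h; inversion h; subst; apply/andP; split; [apply/negP=> /List_InP|apply/IH].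
by case/andP=> /negP nq /IH us; constructor=> // /List_InP.
Qed.

End PlaceEq.

Section Valuations.
Variables (k : closedFieldType) (K : fieldType) (iota : {rmorphism k -> K}).
Implicit Types (p q : place iota) (x y z : K) (a b : int).

Lemma pval0 p : pval p 0 = 0. Proof. by case: (pvalP p). Qed.

Lemma pvalM p x y : x != 0 -> y != 0 -> pval p (x * y) = pval p x + pval p y.
Proof. by case: (pvalP p) => _ + _ _ _; apply. Qed.

Lemma pval_const p c : pval p (iota c) = 0.
Proof.
have [->|c0] := eqVneq c 0; first by rewrite rmorph0 pval0.
by case: (pvalP p) => _ _ _ + _; apply.
Qed.

Lemma pval1 p : pval p 1 = 0. Proof. by rewrite -(rmorph1 iota) pval_const. Qed.

Lemma uniformizer_ex p : exists x, pval p x = 1.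
Proof. by case: (pvalP p). Qed.

Lemma pvalN p x : pval p (- x) = pval p x.
Proof.
have [->|x0] := eqVneq x 0; first by rewrite oppr0.
by rewrite -mulN1r pvalM ?oppr_eq0 ?oner_eq0 // -(rmorph1 iota) -rmorphN pval_const add0r.
Qed.

Lemma pvalV p x : pval p x^-1 = - pval p x.
Proof.
have [->|x0] := eqVneq x 0; first by rewrite invr0 pval0 oppr0.
by apply/eqP; rewrite -addr_eq0 -pvalM ?invr_eq0 // mulVf // pval1.
Qed.

Lemma pvalX p x n : pval p (x ^+ n) = pval p x *+ n.
Proof.
have [->|x0] := eqVneq x 0; first by rewrite expr0n pval0 mul0rn; case: n => [|n]; rewrite ?pval1 ?pval0.
elim: n => [|n IH]; first by rewrite expr0 pval1.
by rewrite exprS pvalM ?expf_neq0 // IH mulrS.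
Qed.

Lemma pvalXz p x (n : int) : pval p (x ^ n) = pval p x * n.
Proof.
case: n => n; first by rewrite -exprnP pvalX -mulr_natr natz.
by rewrite NegzE -exprnN pvalV pvalX mulrN -mulr_natr natz.
Qed.

Lemma pval_prod p (I : Type) (r : seq I) (F : I -> K) :
  (forall i, F i != 0) -> pval p (\prod_(i <- r) F i) = \sum_(i <- r) pval p (F i).
Proof.
move=> F0; elim: r => [|i r IH]; first by rewrite !big_nil pval1.
by rewrite !big_cons pvalM ?IH // prodf_seq_neq0 (eq_all (a2 := predT)) ?all_predT //.
Qed.

(* Since [pval p 0] is the junk value 0, orders are compared through [vge], where v_p(0) = +oo. *)
Definition vge p a x := (x == 0) || (a <= pval p x).

Lemma vge_0 p a : vge p a 0. Proof. by rewrite /vge eqxx. Qed.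

Lemma vge_pval p x : vge p (pval p x) x. Proof. by rewrite /vge lexx orbT. Qed.

Lemma vgeE p a x : x != 0 -> vge p a x = (a <= pval p x).
Proof. by move=> x0; rewrite /vge (negbTE x0). Qed.

Lemma vgeW p a b x : b <= a -> vge p a x -> vge p b x.
Proof. by rewrite /vge => ba /orP[->//|h]; rewrite (le_trans ba h) orbT. Qed.

Lemma vgeD p a x y : vge p a x -> vge p a y -> vge p a (x + y).
Proof.
have [->|x0] := eqVneq x 0; first by rewrite add0r.
have [->|y0] := eqVneq y 0; first by rewrite addr0.
rewrite /vge (negbTE x0) (negbTE y0) /=; case: eqVneq => //= xy0 h1 h2.
case: (pvalP p) => _ _ /(_ x y x0 y0 xy0) + _ _; apply: le_trans.
by rewrite le_min h1 h2.
Qed.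

Lemma vgeN p a x : vge p a (- x) = vge p a x.
Proof. by rewrite /vge oppr_eq0 pvalN. Qed.

Lemma vgeB p a x y : vge p a x -> vge p a y -> vge p a (x - y).
Proof. by move=> hx hy; apply: vgeD hx _; rewrite vgeN. Qed.

Lemma vgeM p a b x y : vge p a x -> vge p b y -> vge p (a + b) (x * y).
Proof.
have [->|x0] := eqVneq x 0; first by rewrite mul0r !vge_0.
have [->|y0] := eqVneq y 0; first by rewrite mulr0 !vge_0.
by rewrite !vgeE ?mulf_neq0 // pvalM // => *; apply: lerD.
Qed.

Lemma vgeM0 p a x y : vge p 0 x -> vge p a y -> vge p a (x * y).
Proof. by move=> hx hy; rewrite -[a]add0r; apply: vgeM. Qed.

Lemma vgeMr0 p a x y : vge p a x -> vge p 0 y -> vge p a (x * y).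
Proof. by move=> hx hy; rewrite -[a]addr0; apply: vgeM. Qed.

Lemma vge_const p c : vge p 0 (iota c).
Proof. by rewrite /vge pval_const lexx orbT. Qed.

Lemma vge1 p : vge p 0 1. Proof. by rewrite -(rmorph1 iota) vge_const. Qed.

Lemma vgeX p x n : vge p 0 x -> vge p 0 (x ^+ n).
Proof.
move=> hx; elim: n => [|n IH]; first by rewrite expr0 vge1.
by rewrite exprS; apply: vgeM0.
Qed.

Lemma vge_sum p a (I : Type) (r : seq I) (P : pred I) (F : I -> K) :
  (forall i, P i -> vge p a (F i)) -> vge p a (\sum_(i <- r | P i) F i).
Proof. by move=> h; apply: (big_ind (vge p a)); [apply: vge_0|apply: vgeD|]. Qed.

Lemma vge_prod p (I : Type) (r : seq I) (P : pred I) (F : I -> K) (a : I -> int) :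
  (forall i, P i -> vge p (a i) (F i)) ->
  vge p (\sum_(i <- r | P i) a i) (\prod_(i <- r | P i) F i).
Proof.
move=> h; elim/big_rec2: _ => [|i x s Pi IH]; first exact: vge1.
by apply: vgeM => //; apply: h.
Qed.

Lemma vge_horner p (P : {poly K}) x :
  (forall i, vge p 0 P`_i) -> vge p 0 x -> vge p 0 P.[x].
Proof.
move=> hP hx; rewrite horner_coef; apply: vge_sum => i _.
by apply: vgeM0 => //; apply: vgeX.
Qed.

Lemma vge_hornerC p (P : {poly k}) x : vge p 0 x -> vge p 0 (map_poly iota P).[x].
Proof. by apply: vge_horner => i; rewrite coef_map vge_const. Qed.

(** A term of strictly least order cannot be cancelled; used below to refute relations with one
    dominant term. *)
Lemma pval_addl p x y : x != 0 -> vge p (pval p x + 1) y ->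
  x + y != 0 /\ pval p (x + y) = pval p x.
Proof.
move=> x0 hy.
have nz : x + y != 0.
  apply/eqP => /eqP; rewrite addr_eq0 => /eqP xy.
  by move: hy; rewrite -vgeN -xy vgeE // lezD1 ltxx.
split=> //; apply: le_anti; apply/andP; split; last first.
  rewrite -(vgeE _ _ nz); apply: vgeD; first exact: vge_pval.
  by apply: vgeW hy; rewrite lerDl.
have: vge p (Num.min (pval p (x + y)) (pval p x + 1)) (x + y - y).
  apply: vgeB; first by apply: vgeW (vge_pval _ _); rewrite ge_min lexx.
  by apply: vgeW hy; rewrite ge_min lexx orbT.
rewrite addrK vgeE // minEle; case: ifP => //.
by rewrite lezD1 ltxx.
Qed.

Lemma pval_eq p a x : x != 0 -> vge p a x -> ~~ vge p (a + 1) x -> pval p x = a.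
Proof.
move=> x0; rewrite !vgeE // => h1; rewrite lezD1 -leNgt => h2.
by apply: le_anti; rewrite h1 h2.
Qed.

Lemma pval_pos_nz p x a : a != 0 -> pval p x = a -> x != 0.
Proof. by move=> a0 h; apply: contra_neq a0 => x0; rewrite -h x0 pval0. Qed.

Lemma vge1_const p c : c != 0 -> ~~ vge p 1 (iota c).
Proof. by move=> c0; rewrite vgeE ?fmorph_eq0 // pval_const. Qed.

Lemma residue_uniq p x c d : vge p 1 (x - iota c) -> vge p 1 (x - iota d) -> c = d.
Proof.
move=> h1 h2; apply/eqP; rewrite -subr_eq0; apply/negPn/negP => /(vge1_const p).
rewrite rmorphB (_ : _ - _ = (x - iota d) - (x - iota c)); last by ring.
by rewrite vgeB.
Qed.

Lemma vge_div p a b x y : x != 0 -> pval p x = b -> vge p a y = vge p (a - b) (y / x).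
Proof.
move=> x0 <-; have [->|y0] := eqVneq y 0; first by rewrite mul0r !vge_0.
by rewrite !vgeE ?mulf_neq0 ?invr_eq0 // pvalM ?invr_eq0 // pvalV lerD2r.
Qed.

End Valuations.

(** * Evaluation of polynomials and reduction at a point *)

Section Eval.
Variables (k : closedFieldType) (K : fieldType) (iota : {rmorphism k -> K}).
Implicit Types (p q : place iota) (x y z : K).

Definition ev x : {poly k} -> K := horner_eval x \o map_poly iota.
HB.instance Definition _ x := GRing.RMorphism.on (ev x).

Lemma evE x P : ev x P = (map_poly iota P).[x]. Proof. by []. Qed.
Lemma evC x c : ev x c%:P = iota c. Proof. by rewrite evE map_polyC hornerC. Qed.
Lemma evX x : ev x 'X = x. Proof. by rewrite evE map_polyX hornerX. Qed.
Lemma ev0 x : ev x 0 = 0. Proof. exact: rmorph0. Qed.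
Lemma evD x P Q : ev x (P + Q) = ev x P + ev x Q. Proof. exact: rmorphD. Qed.
Lemma evM x P Q : ev x (P * Q) = ev x P * ev x Q. Proof. exact: rmorphM. Qed.
Lemma evXn x n : ev x 'X^n = x ^+ n. Proof. by rewrite rmorphXn /= evX. Qed.
Lemma evXsubC x c : ev x ('X - c%:P) = x - iota c. Proof. by rewrite rmorphB /= evC evX. Qed.

Lemma ev_poly x n (E : nat -> k) : ev x (\poly_(i < n) E i) = \sum_(i < n) iota (E i) * x ^+ i.
Proof.
rewrite poly_def rmorph_sum; apply: eq_bigr => i _.
by rewrite -mul_polyC rmorphM rmorphXn /= evC evX.
Qed.

Lemma vge_ev p x P : vge p 0 x -> vge p 0 (ev x P).
Proof. exact: vge_hornerC. Qed.

Lemma vge_ev_res p x c P : vge p 1 (x - iota c) -> vge p 1 (ev x P - iota P.[c]).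
Proof.
move=> h.
have x0 : vge p 0 x.
  by rewrite -[x](subrK (iota c)); apply: vgeD; rewrite ?vge_const //; apply: vgeW h.
have /factor_theorem[Q eQ] : root (P - P.[c]%:P) c.
  by rewrite /root !hornerE subrr.
rewrite -(evC x) -rmorphB eQ rmorphM /= evXsubC.
by apply: vgeM0 => //; apply: vge_ev.
Qed.

Lemma ev_factor x P : P != 0 ->
  exists2 r : seq k, ev x P = iota (lead_coef P) * \prod_(c <- r) (x - iota c)
    & P = lead_coef P *: \prod_(c <- r) ('X - c%:P).
Proof.
move=> P0; have [r eP] := closed_field_poly_normal P; exists r => //.
rewrite {1}eP -mul_polyC rmorphM /= evC rmorph_prod; congr (_ * _).
by apply: eq_bigr => c _; rewrite /= evXsubC.
Qed.

(** Since k is algebraically closed, [P] splits; if no [x - iota c] had positive order, [ev x P]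
    would be a product of units. *)
Lemma residue_root p x P : P != 0 -> vge p 0 x -> vge p 1 (ev x P) ->
  exists c, vge p 1 (x - iota c).
Proof.
move=> P0 x0; have [r -> _] := ev_factor x P0 => h.
apply: NNPP => nex.
have nc c : ~~ vge p 1 (x - iota c) by apply/negP => hc; apply: nex; exists c.
have nz c : x - iota c != 0 by apply: contraNneq (nc c) => ->; apply: vge_0.
have v0 c : pval p (x - iota c) = 0.
  by apply: pval_eq; rewrite ?add0r //; apply: vgeB => //; apply: vge_const.
move: h; rewrite vgeE ?mulf_neq0 ?fmorph_eq0 ?lead_coef_eq0 //; last first.
  by rewrite prodf_seq_neq0; apply/allP => c _ /=; exact: nz.
rewrite pvalM ?fmorph_eq0 ?lead_coef_eq0 //; last first.
  by rewrite prodf_seq_neq0; apply/allP => c _ /=; exact: nz.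
by rewrite pval_const pval_prod // big1.
Qed.

(** A relation over [k[y]] may become trivial when reduced at [y = c]; removing the common power of
    [X - c] from its coefficients prevents this. *)
Lemma common_root_reduce N (a : 'I_N -> {poly k}) (c : k) : (exists i, a i != 0) ->
  exists n (b : 'I_N -> {poly k}),
    (forall i, a i = b i * ('X - c%:P) ^+ n) /\ exists i, (b i).[c] != 0.
Proof.
have [m] := ubnP (\sum_i size (a i))%N; elim: m => // m IH in a *; rewrite ltnS => hm [i0 ai0].
case: (classic (exists i, (a i).[c] != 0)) => [ex|nex].
  by exists 0%N, a; split=> // i; rewrite expr0 mulr1.
have r i : root (a i) c.
  by rewrite /root; apply/negPn/negP => h; apply: nex; exists i.
pose b i := a i %/ ('X - c%:P).
have eb i : a i = b i * ('X - c%:P) by rewrite /b divpK // dvdp_XsubCl.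
have sb i : (size (b i) <= size (a i))%N by rewrite leq_divp.
have b0 : b i0 != 0 by apply: contraNneq ai0 => bi; rewrite eb bi mul0r.
have sb0 : (size (b i0) < size (a i0))%N.
  by rewrite eb size_Mmonic ?monicXsubC // size_XsubC addn2.
have lt : (\sum_i size (b i) < m)%N.
  apply: leq_trans hm; rewrite (bigD1 i0) //= [X in (_ < X)%N](bigD1 i0) //=.
  by rewrite -addSn leq_add // leq_sum.
have [|n [b' [eb' ex]]] := IH _ lt; first by exists i0.
by exists n.+1, b'; split=> // i; rewrite eb eb' exprSr mulrA.
Qed.

(* [spanned d y]: the field [K] has dimension at most [d] over [k(y)]. *)
Definition spanned d y := forall x : 'I_d.+1 -> K,
  exists a : 'I_d.+1 -> {poly k}, (exists i, a i != 0) /\ \sum_i ev y (a i) * x i = 0.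

Lemma spanned_reduce d y c (x : 'I_d.+1 -> K) : spanned d y -> y - iota c != 0 ->
  exists a : 'I_d.+1 -> {poly k},
    (exists i, (a i).[c] != 0) /\ \sum_i ev y (a i) * x i = 0.
Proof.
move=> sp yc; have [a [a0 ea]] := sp x.
have [n [b [eb b0]]] := common_root_reduce c a0.
exists b; split=> //; apply: (mulIf (expf_neq0 n yc)); rewrite mul0r -[RHS]ea mulr_suml.
by apply: eq_bigr => i _; rewrite eb rmorphM rmorphXn /= evXsubC mulrAC.
Qed.

Lemma spannedV d y : y != 0 -> spanned d y -> spanned d y^-1.
Proof.
move=> y0 sp x; have [a [[i0 a0] ea]] := sp x.
pose n := \max_i size (a i).
have sz i : (size (a i) <= n)%N by exact: leq_bigmax.
(* Reversed polynomials: a polynomial in [y] is [y^(n-1)] times its reversal evaluated at [1/y]. *)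
pose b i := \poly_(j < n) (a i)`_(n.-1 - j).
have eb i : ev y (a i) = y ^+ n.-1 * ev y^-1 (b i).
  rewrite evE (@horner_coef_wide _ n); last by rewrite (leq_trans (size_poly _ _)).
  rewrite ev_poly mulr_sumr (reindex_inj rev_ord_inj) /=; apply: eq_bigr => j _.
  have jn : (j <= n.-1)%N by have := ltn_ord j; lia.
  have -> : y ^+ n.-1 * (iota (a i)`_(n.-1 - j) * y^-1 ^+ j) = iota (a i)`_(n.-1 - j) * y ^+ (n.-1 - j).
    rewrite mulrCA -{2}(subnK jn) exprD -mulrA exprVn mulfV ?mulr1 //.
    by rewrite expf_neq0.
  by rewrite coef_map /= (_ : n - j.+1 = n.-1 - j)%N //; lia.
exists b; split.
  exists i0; apply: contraNneq a0 => b0; apply/eqP/polyP => j; rewrite coef0.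
  have [nj|jn] := leqP n j; first by rewrite nth_default // (leq_trans (sz i0)).
  have /polyP/(_ (n.-1 - j)%N) := b0; rewrite coef_poly coef0.
  by case: ifP => [_|]; [rewrite subKn //; lia|lia].
apply: (mulfI (expf_neq0 n.-1 y0)); rewrite mulr0 -[RHS]ea mulr_sumr.
by apply: eq_bigr => i _; rewrite eb mulrA.
Qed.

End Eval.

Definition genus_field (k : closedFieldType) (K : fieldType) (iota : {rmorphism k -> K})
    (g : nat) : Prop :=
  [/\ [pchar k] =i pred0, function_field iota & is_genus iota g].

(** * Finite dimension over k(t) and residue fields *)

Section FiniteDimension.
Variables (k : closedFieldType) (K : fieldType) (iota : {rmorphism k -> K}).
Implicit Types (p q : place iota) (x y z : K).

Lemma function_field_spanned : function_field iota ->
  exists t d, (forall P, ev iota t P = 0 -> P = 0) /\ spanned iota d t.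
Proof.
case=> t [ht [d [b hb]]]; exists t, d; split=> // x.
have hbx j : exists u : ('I_d -> {poly k}) * ('I_d -> {poly k}),
    (forall i, ev iota t (u.2 i) != 0) /\
    x j = \sum_(i < d) ev iota t (u.1 i) / ev iota t (u.2 i) * b i.
  by have [a [c [h1 h2]]] := hb (x j); exists (a, c).
have [u hu] := boolp.choice hbx.
pose a j i : {poly k} := (u j).1 i; pose c j i : {poly k} := (u j).2 i.
pose E : {poly k} := \prod_j \prod_i c j i.
have ec j i : ev iota t (c j i) != 0 by have [h _] := hu j; apply: h.
have E0 : ev iota t E != 0.
  by rewrite rmorph_prod; apply/prodf_neq0 => j _; rewrite rmorph_prod; apply/prodf_neq0 => i _; apply: ec.
have dvd (ji : 'I_d.+1 * 'I_d) : exists e, e * c ji.1 ji.2 = E.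
  case: ji => j i /=.
  exists ((\prod_(i' | i' != i) c j i') * \prod_(j' | j' != j) \prod_i c j' i).
  by rewrite /E [RHS](bigD1 j) //= [X in _ = X * _](bigD1 i) //= mulrAC [_ * c j i]mulrC.
have [e' he'] := boolp.choice dvd; pose e j i := e' (j, i).
have he j i : e j i * c j i = E := he' (j, i).
pose beta j i := a j i * e j i.
have ex j : ev iota t E * x j = \sum_i ev iota t (beta j i) * b i.
  have [_ ->] := hu j; rewrite mulr_sumr; apply: eq_bigr => i _.
  rewrite -(he j i) !evM; field.
  by have := ec j i.
(* The d + 1 coordinate vectors of length d are padded with a zero column; the vanishing determinant
   then gives a left kernel vector with entries in [k[t]]. *)
pose M := \matrix_(j < d.+1, i < d.+1)
  (if insub (i : nat) is Some i' then beta j i' else 0) : 'M[{poly k}]_d.+1.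
have det0 : \det M == 0.
  rewrite (expand_det_col _ ord_max) big1 // => j _.
  by rewrite mxE insubF ?mul0r //= ltnn.
have /det0P[v v0 vM] := det0.
exists (fun j => v 0 j); split.
  by have /rV0Pn[j hj] := v0; exists j.
apply: (mulfI E0); rewrite mulr0 mulr_sumr.
transitivity (\sum_j \sum_i ev iota t (v 0 j * beta j i) * b i).
  apply: eq_bigr => j _; rewrite mulrCA ex mulr_sumr; apply: eq_bigr => i _.
  by rewrite [in RHS]evM mulrA.
rewrite exchange_big big1 //= => i _; rewrite -mulr_suml -rmorph_sum.
have /matrixP/(_ 0 (widen_ord (leqnSn d) i)) := vM.
rewrite !mxE => h; rewrite (_ : \sum_j _ = 0) ?rmorph0 ?mul0r // -[RHS]h.
by apply: eq_bigr => j _; rewrite mxE /= valK.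
Qed.

(** The powers 1, x, ..., x^d satisfy a relation over [k[y]]; reduced at [y = c], it becomes a
    nonzero polynomial [Q] over k such that [Q(x)] has positive order. *)
Lemma residue_spanned d y c p x : spanned iota d y -> y != iota c ->
  vge p 1 (y - iota c) -> vge p 0 x -> exists c', vge p 1 (x - iota c').
Proof.
rewrite -subr_eq0 => sp yc hy hx.
have [a [[i0 ai0] ea]] := spanned_reduce (fun i : 'I_d.+1 => x ^+ i) sp yc.
pose Q := \poly_(i < d.+1) (if insub i is Some i' then (a i').[c] else 0).
have eQ : ev iota x Q = \sum_i iota (a i).[c] * x ^+ i.
  by rewrite ev_poly; apply: eq_bigr => i _; rewrite valK.
have Q0 : Q != 0.
  apply: contraNneq ai0 => /polyP/(_ i0); rewrite coef_poly coef0 ltn_ord valK.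
  by move->.
apply: (residue_root Q0 hx).
have -> : ev iota x Q = \sum_i (iota (a i).[c] * x ^+ i - ev iota y (a i) * x ^+ i).
  by rewrite sumrB ea subr0.
apply: vge_sum => i _; rewrite -mulrBl -vgeN -mulNr opprB; apply: vgeMr0; last exact: (vgeX _ hx).
exact: vge_ev_res.
Qed.

(** On k(t) the place lies at infinity, at a point of k, or is trivial. In the first two cases
    [t^-1] or [t] has a residue in k and the previous lemma applies; the third is excluded. *)
Lemma residue_ex p x : function_field iota -> vge p 0 x -> exists c, vge p 1 (x - iota c).
Proof.
move=> /function_field_spanned[t [d [ht sp]]] hx.
have tc c : t != iota c.
  apply/eqP => tc; have := ht ('X - c%:P); rewrite evXsubC tc subrr => /(_ erefl)/eqP.
  by rewrite polyXsubC_eq0.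
have t0 : t != 0 by rewrite -(rmorph0 iota).
have [h0|] := boolP (vge p 0 t); last first.
  rewrite vgeE // -ltNge => lt0.
  apply: (@residue_spanned d t^-1 0) hx; first exact: spannedV.
    by rewrite rmorph0 invr_eq0.
  by rewrite rmorph0 subr0 vgeE ?invr_eq0 // pvalV; lia.
case: (classic (exists c, vge p 1 (t - iota c))) => [[c hc]|nex].
  exact: residue_spanned sp (tc c) hc hx.
(* If [t] has no residue in k, nonzero elements of [k[t]] are units at [p], and the terms of a
   relation between 1, pi, ..., pi^d over [k[t]] would have distinct orders. *)
have unit P : P != 0 -> pval p (ev iota t P) = 0.
  move=> P0; apply: pval_eq; first by apply: contraNneq P0 => /ht->.
    exact: vge_ev.
  by apply/negP => /(residue_root P0 h0).
have [pi vpi] := uniformizer_ex p.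
have pi0 : pi != 0 by apply: pval_pos_nz vpi.
have [a [exa ea]] := sp (fun i => pi ^+ i).
case: (arg_minnP (P := fun i => a i != 0) (fun i => nat_of_ord i) (proj2_sig (constructive_indefinite_description _ exa))).
move=> i ai imin; exfalso; move: ea; rewrite (bigD1 i) //=.
have nz : ev iota t (a i) * pi ^+ i != 0.
  by rewrite mulf_neq0 ?expf_neq0 //; apply: contraNneq ai => /ht->.
have vi : pval p (ev iota t (a i) * pi ^+ i) = i%:Z.
  rewrite pvalM ?expf_neq0 ?unit ?pvalX ?vpi ?add0r ?natz //.
  by apply: contraNneq ai => /ht->.
have := @pval_addl _ _ _ p (ev iota t (a i) * pi ^+ i)
   (\sum_(j < d.+1 | j != i) ev iota t (a j) * pi ^+ j) nz.
case=> [|/eqP h _ h']; last by apply: h.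
apply: vge_sum => j ji; have [->|aj] := eqVneq (a j) 0; first by rewrite rmorph0 mul0r vge_0.
apply: vgeM0; first exact: vge_ev.
rewrite /vge pvalX vpi vi natz; apply/orP; right.
by have := imin _ aj; move/eqP: ji => ji; have : nat_of_ord j <> i by [move=> /val_inj|]; lia.
Qed.

End FiniteDimension.

(** * Riemann-Roch spaces *)

Section Divisors.
Variables (k : closedFieldType) (K : fieldType) (iota : {rmorphism k -> K}).
Hypothesis FF : function_field iota.
Implicit Types (p q : place iota) (x y z : K) (D : place iota -> int).

Lemma in_LDE D x : in_LD D x <-> forall p : place iota, vge p (- D p) x.
Proof.
split=> [[->|h] p|h]; first exact: vge_0.
  by rewrite /vge -subr_ge0 opprK h orbT.
have [->|x0] := eqVneq x 0; first by left.
by right=> p; have := h p; rewrite vgeE // -subr_ge0 opprK.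
Qed.

Definition dim_le D d :=
  forall b : 'I_d.+1 -> K, (forall i, in_LD D (b i)) -> ~ k_indep iota b.

Lemma k_indep_inj d d' (f : 'I_d -> 'I_d') (b : 'I_d' -> K) :
  injective f -> k_indep iota b -> k_indep iota (b \o f).
Proof.
move=> finj hb c hc i.
pose c' j := \sum_(i < d | f i == j) c i.
have /hb/(_ (f i)) : \sum_j iota (c' j) * b j = 0.
  rewrite -[RHS]hc (partition_big f predT) //=; apply: eq_bigr => j _.
  rewrite rmorph_sum mulr_suml; apply: eq_bigr => l /eqP <- //.
by rewrite /c' (big_pred1 i) // => l /=; rewrite inj_eq.
Qed.

Lemma dim_leW D d d' : (d <= d')%N -> dim_le D d -> dim_le D d'.
Proof.
move=> dd hd b hb ib.
have dd1 : (d.+1 <= d'.+1)%N by [].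
apply: (hd (b \o widen_ord dd1)) => [i|]; first exact: hb.
by apply: k_indep_inj ib => i j /(congr1 val) /= /val_inj.
Qed.

Lemma dim_leS D D' d : (forall p, D p <= D' p) -> dim_le D' d -> dim_le D d.
Proof.
move=> h hd b hb; apply: hd => i; apply/in_LDE => p; move/in_LDE: (hb i) => /(_ p).
by apply: vgeW; rewrite lerN2.
Qed.

(* Effective divisors are represented by lists of places, with multiplicity. *)
Definition mult (s : seq (place iota)) p : nat := count_mem p s.

Lemma mult_nil p : mult [::] p = 0%N. Proof. by []. Qed.

Lemma mult_cons q s p : mult (q :: s) p = ((p == q) + mult s p)%N.
Proof. by rewrite /mult /= eq_sym. Qed.

Lemma mult_cat s u p : mult (s ++ u) p = (mult s p + mult u p)%N.
Proof. by rewrite /mult count_cat. Qed.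

Definition addD D (s : seq (place iota)) p : int := D p + (mult s p)%:Z.

(** For one added point [q], the leading coefficient at [q] is a k-linear form on the larger space,
    and its kernel lies in the smaller one. *)
Lemma dim_le_add D d s : dim_le D d -> dim_le (addD D s) (d + size s).
Proof.
elim: s => [|q s IH] hd; first by rewrite addn0; apply: dim_leS hd => p; rewrite /addD mult_nil addr0.
move/IH: hd => {IH}; rewrite addnS /=; set D1 := addD D s; set d1 := (d + size s)%N => hd b hb ib.
have [pi vpi] := uniformizer_ex q.
have pi0 : pi != 0 by apply: pval_pos_nz vpi.
(* The largest pole order at [q] that the enlarged divisor allows. *)
pose n : int := D1 q + 1.
have hq i : vge q 0 (b i * pi ^ n).
  have -> : 0 = - n + n by rewrite addNr.
  apply: vgeM; last by rewrite /vge pvalXz vpi mul1r lexx orbT.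
  have /in_LDE/(_ q) := hb i; apply: vgeW.
  by rewrite /n /D1 /addD mult_cons eqxx; lia.
have [c hc] := boolp.choice (fun i => residue_ex FF (hq i)).
have inD1 x : in_LD (addD D (q :: s)) x -> vge q 1 (x * pi ^ n) -> in_LD D1 x.
  move=> /in_LDE hx h1; apply/in_LDE => p; have [->|pq] := eqVneq p q; last first.
    by have := hx p; rewrite /addD mult_cons (negbTE pq) add0n.
  move: h1; rewrite (@vge_div _ _ _ q 1 n _ _ (expfz_neq0 n pi0)); last by rewrite pvalXz vpi mul1r.
  by rewrite mulfK ?expfz_neq0 // /n; apply: vgeW; lia.
case: (classic (exists j, c j != 0)) => [[j cj]|nex]; last first.
  have c0 i : c i = 0 by apply/eqP/negPn/negP => h; apply: nex; exists i.
  apply: (@dim_leW D1 d1 d1.+1 _ hd b) => // i; apply: inD1 => //.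
  by have := hc i; rewrite c0 rmorph0 subr0.
(* Elimination of the leading coefficient at [q], with [b j] as pivot. *)
pose b' i := b (lift j i) - iota (c (lift j i) / c j) * b j.
apply: (hd b') => [i|].
  apply: inD1.
    apply/in_LDE => p; apply: vgeB; first by have /in_LDE := hb (lift j i).
    by apply: vgeM0; [apply: vge_const|have /in_LDE := hb j].
  have -> : b' i * pi ^ n = (b (lift j i) * pi ^ n - iota (c (lift j i)))
      - iota (c (lift j i) / c j) * (b j * pi ^ n - iota (c j)).
    rewrite /b' !(mulrBl, mulrBr) -rmorphM divfK // !mulrA; ring.
  by apply: vgeB => //; apply: vgeM0 => //; apply: vge_const.
move=> e he i.
pose e' l := if unlift j l is Some l' then e l' else - \sum_l (e l * c (lift j l) / c j).
have /ib/(_ (lift j i)) : \sum_l iota (e' l) * b l = 0.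
  rewrite (bigD1_ord j) //= /e' unlift_none -[RHS]he.
  rewrite [RHS](eq_bigr (fun i => iota (e i) * b (lift j i) - iota (e i * c (lift j i) / c j) * b j)); last first.
    by move=> l _; rewrite /b' mulrBr mulrA -rmorphM !mulrA.
  rewrite sumrB addrC rmorphN mulNr rmorph_sum mulr_suml; congr (_ - _).
  by apply: eq_bigr => l _; rewrite liftK.
by rewrite /e' liftK.
Qed.

End Divisors.

(** * Finite sets of places and degrees of divisors *)

Section FiniteSupport.
Variables (k : closedFieldType) (K : fieldType) (iota : {rmorphism k -> K}).
Implicit Types (p q : place iota) (x y z : K) (D : place iota -> int).

Definition fin_places (P : place iota -> Prop) : Prop :=
  exists s : seq (place iota), forall p, P p -> p \in s.

Lemma fin_places_uniq P : fin_places P -> exists2 s, uniq s & forall p, P p -> p \in s.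
Proof. by case=> s hs; exists (undup s); [apply: undup_uniq|move=> p /hs; rewrite mem_undup]. Qed.

Lemma fin_placesS (P Q : place iota -> Prop) :
  (forall p, P p -> Q p) -> fin_places Q -> fin_places P.
Proof. by move=> h [s hs]; exists s => p /h/hs. Qed.

Lemma fin_placesU (P Q : place iota -> Prop) :
  fin_places P -> fin_places Q -> fin_places (fun p => P p \/ Q p).
Proof.
by case=> s hs [u hu]; exists (s ++ u) => p; rewrite mem_cat => -[/hs->|/hu->]; rewrite ?orbT.
Qed.

Lemma fin_places_seq (T : eqType) (r : seq T) (P : T -> place iota -> Prop) :
  (forall i, i \in r -> fin_places (P i)) ->
  fin_places (fun p => exists2 i, i \in r & P i p).
Proof.
elim: r => [|i r IH] h; first by exists [::] => p [].
have h1 : fin_places (P i) by apply: h; rewrite mem_head.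
have h2 := IH (fun j jr => h j (mem_behead (s := i :: r) jr)).
apply: fin_placesS (fin_placesU h1 h2) => p [j]; rewrite inE => /orP[/eqP->|jr] hp; first by left.
by right; exists j.
Qed.

Lemma fin_places_bound (P : place iota -> Prop) N :
  (forall s, uniq s -> (forall p, p \in s -> P p) -> (size s <= N)%N) -> fin_places P.
Proof.
move=> hN; apply: NNPP => nf.
have: forall n, exists s : seq (place iota), [/\ uniq s, size s = n & forall p, p \in s -> P p].
  elim=> [|n [s [us ss hs]]]; first by exists [::].
  apply: NNPP => nex; apply: nf; exists s => p Pp; apply/negPn/negP => ps.
  apply: nex; exists (p :: s); split=> /=; rewrite ?ps ?ss //.
  by move=> q; rewrite inE => /orP[/eqP->|/hs].
by move=> /(_ N.+1)[s [us ss /(hN _ us)]]; rewrite ss ltnn.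
Qed.

Lemma sum_support (f : place iota -> int) (s u : seq (place iota)) : uniq s -> uniq u ->
  (forall p, f p <> 0 -> p \in s) -> (forall p, f p <> 0 -> p \in u) ->
  \sum_(p <- s) f p = \sum_(p <- u) f p.
Proof.
move=> us uu hs hu.
have red (r : seq (place iota)) : \sum_(p <- r) f p = \sum_(p <- [seq p <- r | f p != 0]) f p.
  rewrite big_filter [RHS]big_mkcond; apply: eq_bigr => p _.
  by case: eqP.
rewrite red [RHS]red; apply: perm_big; apply: uniq_perm; rewrite ?filter_uniq // => p.
by rewrite !mem_filter; case: eqP => //= /[dup] /hs-> /hu->.
Qed.

Lemma deg_addf D dg (f : place iota -> int) s : divisor_deg D dg -> uniq s ->
  (forall p, f p <> 0 -> p \in s) ->
  divisor_deg (fun p => D p + f p) (dg + \sum_(p <- s) f p).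
Proof.
case=> r [/List_NoDupP ur hr ->] us hs.
pose u := undup (r ++ s).
have uu : uniq u := undup_uniq _.
exists u; split; first exact/List_NoDupP.
  move=> p h; apply/List_InP; rewrite mem_undup mem_cat.
  have [/hr/List_InP->//|fp] : D p <> 0 \/ f p <> 0 by lia.
  by rewrite hs ?orbT.
rewrite big_split; congr (_ + _); apply: sum_support => // p h; rewrite ?mem_undup ?mem_cat.
- by apply/List_InP; apply: hr.
- by have /List_InP-> := hr _ h.
by rewrite hs ?orbT.
Qed.

Lemma deg_ext D D' dg : D =1 D' -> divisor_deg D dg -> divisor_deg D' dg.
Proof.
move=> e [s [us hs ->]]; exists s; split=> //; first by move=> p; rewrite -e; apply: hs.
by apply: eq_bigr => p _.
Qed.

Lemma deg_addD D dg s : divisor_deg D dg -> divisor_deg (addD D s) (dg + (size s)%:Z).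
Proof.
elim: s D dg => [|q s IH] D dg hd; first by rewrite addr0; apply: deg_ext hd => p; rewrite /addD mult_nil addr0.
have h1 : divisor_deg (fun p => D p + (p == q)%:Z) (dg + 1).
  have -> : 1 = \sum_(p <- [:: q]) (p == q)%:Z by rewrite big_seq1 eqxx.
  by apply: deg_addf => // p; rewrite inE; case: eqP.
have -> : dg + (size (q :: s))%:Z = dg + 1 + (size s)%:Z by rewrite /=; lia.
by apply: deg_ext (IH _ _ h1) => p; rewrite /addD mult_cons; lia.
Qed.

End FiniteSupport.

(** * Riemann's inequality and the finiteness of zeros and poles *)

Section Genus.
Variables (k : closedFieldType) (K : fieldType) (iota : {rmorphism k -> K}) (g : nat).
Hypothesis H : genus_field iota g.
Implicit Types (p q : place iota) (x y z : K) (D : place iota -> int).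

Let FF : function_field iota. Proof. by case: H. Qed.

Lemma ell_ex D d : dim_le D d -> exists2 d', (d' <= d)%N & ell D d'.
Proof.
elim: d => [|d IH] hd.
  exists 0%N => //; split; last by case=> b [h1 h2]; apply: hd h1 h2.
  by exists (fun=> 0); split=> [[]//|c _ []].
case: (classic (dim_le D d)) => [/IH[d' dd h]|nd]; first by exists d' => //; apply: leqW.
exists d.+1 => //; split; last by case=> b [h1 h2]; apply: hd h1 h2.
by apply: NNPP => nex; apply: nd => b h1 h2; apply: nex; exists b.
Qed.

Lemma riemann_ineq D d dg : dim_le D d -> divisor_deg D dg ->
  exists2 d', (d' <= d)%N /\ dg + 1 - g%:Z <= d'%:Z &
    exists b : 'I_d' -> K, (forall i, in_LD D (b i)) /\ k_indep iota b.
Proof.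
move=> hd hdg; have [d' dd he] := ell_ex hd.
have [_ _ [hg _]] := H.
exists d'; first by split=> //; have := hg _ _ _ hdg he; lia.
by case: he.
Qed.

(** A divisor attaining the maximum that defines the genus. Adding a point to it raises the degree
    and the dimension by exactly one, as Riemann's inequality meets the bound of [dim_le_add]. *)
Lemma extremal_divisor : exists D0 dg0 d0,
  [/\ divisor_deg D0 dg0, dim_le D0 d0 & dg0 - d0%:Z + 1 = g%:Z].
Proof.
have [_ _ [_ [D0 [dg0 [d0 [h1 [_ h2] h3]]]]]] := H; exists D0, dg0, d0; split=> //.
by move=> b b1 b2; apply: h2; exists b.
Qed.

Lemma k_indep_lt d d' (b : 'I_d' -> K) (dd : (d <= d')%N) :
  k_indep iota b -> k_indep iota (fun i : 'I_d => b (widen_ord dd i)).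
Proof. by apply: k_indep_inj => i j /(congr1 val) /= /val_inj. Qed.

(** Takes the place of weak approximation: such an [f] has order exactly [- D0 p - 1] at [p] and
    respects [D0] at all other places. *)
Lemma polar_function D0 dg0 d0 p : divisor_deg D0 dg0 -> dim_le D0 d0 ->
  dg0 - d0%:Z + 1 = g%:Z -> exists f, in_LD (addD D0 [:: p]) f /\ ~ in_LD D0 f.
Proof.
move=> h1 h2 h3; have [d' [_ hd'] [b [hb ib]]] := riemann_ineq (dim_le_add FF (s := [:: p]) h2) (deg_addD [:: p] h1).
have dd : (d0.+1 <= d')%N by move: hd' => /=; lia.
apply: NNPP => nex; apply: (h2 (fun i => b (widen_ord dd i))) => [i|]; last exact: k_indep_lt.
by apply: NNPP => nl; apply: nex; exists (b (widen_ord dd i)).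
Qed.

(** Otherwise d + 1 polar functions at places above [y = c] satisfy a relation over [k[y]]. At a
    place whose coefficient does not vanish at [c], a single term has the extra pole. *)
Lemma places_over d y c s : spanned iota d y -> y != iota c -> uniq s ->
  (forall p : place iota, p \in s -> vge p 1 (y - iota c)) -> (size s <= d)%N.
Proof.
rewrite -subr_eq0 => sp yc us hs; rewrite leqNgt; apply/negP => lt.
have [D0 [dg0 [d0 [h1 h2 h3]]]] := extremal_divisor.
have [f hf] := boolp.choice (fun p => polar_function p h1 h2 h3).
have p0 : place iota by case: s lt {us hs}.
pose P (i : 'I_d.+1) := nth p0 s i.
have Ps i : P i \in s by rewrite mem_nth // (leq_trans (ltn_ord i)).
have [a [[i ai] ea]] := spanned_reduce (fun i : 'I_d.+1 => f (P i)) sp yc.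
have [fi nfi] := hf (P i).
have nv : ~~ vge (P i) (- D0 (P i)) (f (P i)).
  apply/negP => h; apply: nfi; apply/in_LDE => p; have [->//|pi] := eqVneq p (P i).
  by have /in_LDE/(_ p) := fi; rewrite /addD mult_cons (negbTE pi) addr0.
have fnz : f (P i) != 0 by apply: contraNneq nv => ->; apply: vge_0.
have vi := hs _ (Ps i).
have y0 : vge (P i) 0 y.
  by rewrite -[y](subrK (iota c)); apply: vgeD; rewrite ?vge_const //; apply: vgeW vi.
have a1 : ~~ vge (P i) 1 (ev iota y (a i)).
  apply: contraNN ai => h; apply/eqP; apply: (fmorph_inj iota); rewrite rmorph0.
  apply/eqP/negPn/negP; rewrite fmorph_eq0 => /(vge1_const (P i)) /negP; apply.
  have -> : iota (a i).[c] = ev iota y (a i) - (ev iota y (a i) - iota (a i).[c]) by ring.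
  by apply: vgeB => //; apply: vge_ev_res.
have anz : ev iota y (a i) != 0 by apply: contraNneq a1 => ->; apply: vge_0.
have va : pval (P i) (ev iota y (a i)) = 0 by apply: pval_eq; rewrite ?add0r //; apply: vge_ev.
move: nv; rewrite -(vgeN _ _ (f _)) => /negP; apply.
have /eqP := ea; rewrite (bigD1 i) //= addr_eq0 => /eqP e.
have : vge (P i) (- D0 (P i)) (ev iota y (a i) * f (P i)).
  rewrite e vgeN; apply: vge_sum => j ji; apply: vgeM0; first exact: vge_ev.
  have [fj _] := hf (P j); have /in_LDE/(_ (P i)) := fj.
  rewrite /addD mult_cons (_ : P i == P j = false) ?addr0 // eq_sym.
  by apply/negbTE; apply: contra ji; rewrite /P nth_uniq // (leq_trans (ltn_ord _)).
by rewrite vgeN !vgeE ?mulf_neq0 // pvalM // va add0r.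
Qed.

Lemma fin_zeros_spanned d y c : spanned iota d y -> y != iota c ->
  fin_places (fun p : place iota => vge p 1 (y - iota c)).
Proof.
by move=> sp yc; apply: (fin_places_bound (N := d)) => s us hs; apply: places_over sp yc us hs.
Qed.

(** These places lie above the pole of [y] or above one of the finitely many roots of [P], and
    [places_over] bounds each fibre. *)
Lemma fin_support_ev d y P : y != 0 -> (forall c, y != iota c) -> spanned iota d y -> P != 0 ->
  fin_places (fun p : place iota => ~~ vge p 0 y \/ pval p (ev iota y P) != 0).
Proof.
move=> y0 yc sp P0; have [r eP _] := ev_factor iota y P0.
have f1 : fin_places (fun p : place iota => vge p 1 (y^-1 - iota 0)).
  by apply: fin_zeros_spanned (spannedV y0 sp) _; rewrite rmorph0 invr_eq0.
have f2 := @fin_places_seq _ _ iota _ r (fun c p => vge p 1 (y - iota c))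
   (fun c _ => fin_zeros_spanned sp (yc c)).
apply: fin_placesS (fin_placesU f1 f2) => p hp.
have pole : ~~ vge p 0 y -> vge p 1 (y^-1 - iota 0).
  by rewrite rmorph0 subr0 !vgeE ?invr_eq0 // pvalV; lia.
case: hp => [/pole|]; first by left.
have [h0|/pole] := boolP (vge p 0 y); last by left.
move=> hv; right; apply: NNPP => nex; move/eqP: hv; apply.
have nz c : y - iota c != 0 by rewrite subr_eq0.
rewrite eP pvalM ?fmorph_eq0 ?lead_coef_eq0 //; last first.
  by rewrite prodf_seq_neq0; apply/allP => c _ /=; exact: nz.
rewrite pval_const pval_prod // big1_seq // => c /andP[_ cr].
apply: pval_eq; rewrite ?add0r //; first by apply: vgeB => //; apply: vge_const.
by apply/negP => h; apply: nex; exists c.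
Qed.

Lemma fin_poles x : fin_places (fun p : place iota => ~~ vge p 0 x).
Proof.
have [t [d [ht sp]]] := function_field_spanned FF.
have tc c : t != iota c.
  apply/eqP => tc; have := ht ('X - c%:P); rewrite evXsubC tc subrr => /(_ erefl)/eqP.
  by rewrite polyXsubC_eq0.
have t0 : t != 0 by rewrite -(rmorph0 iota).
have [a [exa ea]] := sp (fun i => x ^+ i).
(* The top coefficient in an equation of [x] over [k[t]]: where it is a unit and [t] is regular, a
   pole of [x] would make the top term dominant. *)
case: (arg_maxnP (P := fun i => a i != 0) (fun i => nat_of_ord i) (proj2_sig (constructive_indefinite_description _ exa))).
move=> i ai imax; apply: fin_placesS (fin_support_ev t0 tc sp ai) => p nx.
have [ht0|] := boolP (vge p 0 t); last by left.
right; apply/eqP => va; move: ea; rewrite (bigD1 i) //=.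
have x0 : x != 0 by apply: contraNneq nx => ->; apply: vge_0.
have nz : ev iota t (a i) * x ^+ i != 0.
  by rewrite mulf_neq0 ?expf_neq0 //; apply: contraNneq ai => /ht->.
have vx : pval p x < 0 by move: nx; rewrite vgeE // -ltNge.
have vi : pval p (ev iota t (a i) * x ^+ i) = pval p x * i%:Z.
  rewrite pvalM ?expf_neq0 //; last by apply: contraNneq ai => /ht->.
  by rewrite va add0r pvalX -mulr_natr natz.
have := @pval_addl _ _ _ p (ev iota t (a i) * x ^+ i)
   (\sum_(j < d.+1 | j != i) ev iota t (a j) * x ^+ j) nz.
case=> [|/eqP h _ h']; last by apply: h.
apply: vge_sum => j ji; have [->|aj] := eqVneq (a j) 0; first by rewrite rmorph0 mul0r vge_0.
apply: vgeM0; first exact: vge_ev.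
rewrite vgeE ?expf_neq0 // pvalX vi -mulr_natr natz.
have := imax _ aj; move/eqP: ji => ji; have : nat_of_ord j <> i by [move=> /val_inj|].
by move: vx; nia.
Qed.

Lemma fin_support x : fin_places (fun p : place iota => pval p x <> 0).
Proof.
have [->|x0] := eqVneq x 0; first by exists [::] => p; rewrite pval0.
apply: fin_placesS (fin_placesU (fin_poles x) (fin_poles x^-1)) => p.
by rewrite !vgeE ?invr_eq0 // pvalV; lia.
Qed.

End Genus.

Section Ev2.
Variables (k : closedFieldType) (K : fieldType) (iota : {rmorphism k -> K}).

Definition ev2 (z x : K) : {poly {poly k}} -> K := horner_eval x \o map_poly (ev iota z).
HB.instance Definition _ z x := GRing.RMorphism.on (ev2 z x).

Lemma ev2E z x P : ev2 z x P = (map_poly (ev iota z) P).[x]. Proof. by []. Qed.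
Lemma ev20 z x : ev2 z x 0 = 0. Proof. exact: rmorph0. Qed.
Lemma ev2D z x P Q : ev2 z x (P + Q) = ev2 z x P + ev2 z x Q. Proof. exact: rmorphD. Qed.
Lemma ev2M z x P Q : ev2 z x (P * Q) = ev2 z x P * ev2 z x Q. Proof. exact: rmorphM. Qed.
Lemma ev2C z x c : ev2 z x c%:P = ev iota z c. Proof. by rewrite ev2E map_polyC hornerC. Qed.
Lemma ev2X z x : ev2 z x 'X = x. Proof. by rewrite ev2E map_polyX hornerX. Qed.
Lemma ev2_poly z x n (E : nat -> {poly k}) :
  ev2 z x (\poly_(i < n) E i) = \sum_(i < n) ev iota z (E i) * x ^+ i.
Proof.
rewrite poly_def rmorph_sum; apply: eq_bigr => i _.
by rewrite -mul_polyC rmorphM rmorphXn /= ev2C ev2X.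
Qed.

End Ev2.

(** * The product formula and algebraic relations *)

Section ProductFormula.
Variables (k : closedFieldType) (K : fieldType) (iota : {rmorphism k -> K}) (g : nat).
Hypothesis H : genus_field iota g.
Implicit Types (p q : place iota) (x y z : K) (D : place iota -> int).

Let FF : function_field iota. Proof. by case: H. Qed.

Lemma dim_le_div D d y : y != 0 -> dim_le D d ->
  dim_le (fun p => D p + pval p y) d.
Proof.
move=> y0 hd b hb ib; apply: (hd (fun i => b i * y)) => [i|c hc i].
  apply/in_LDE => p; have /in_LDE/(_ p) := hb i; move/vgeM/(_ (vge_pval p y)).
  by apply: vgeW; lia.
apply: ib; apply: (mulIf y0); rewrite mul0r -[RHS]hc mulr_suml.
by apply: eq_bigr => j _; rewrite mulrA.
Qed.

(* The divisor D0 + div(y) has the same Riemann-Roch dimension as D0, so that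
   the lower bound for that dimension forces the degree of div(y) to be nonpositive. *)
Lemma product_formula y s : y != 0 -> uniq s -> (forall p, pval p y <> 0 -> p \in s) ->
  \sum_(p <- s) pval p y = 0.
Proof.
have half x : x != 0 -> uniq s -> (forall p, pval p x <> 0 -> p \in s) ->
    \sum_(p <- s) pval p x <= 0.
  move=> x0 us hs; have [D0 [dg0 [d0 [h1 h2 h3]]]] := extremal_divisor H.
  have [d' [dd hd'] _] := riemann_ineq H (dim_le_div x0 h2) (deg_addf h1 us hs).
  by move: hd' dd; lia.
move=> y0 us hs; apply: le_anti; rewrite half //=.
have := half y^-1; rewrite invr_eq0 => /(_ y0 us).
rewrite (eq_bigr (fun p => - pval p y)) => [|p _]; last by rewrite pvalV.
by rewrite sumrN oppr_le0; apply=> p; rewrite pvalV => h; apply: hs; lia.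
Qed.

(** After subtraction of its residue at [p0], [x] would have no pole and a zero at [p0], against the
    product formula. *)
Lemma regular_const p0 x : (forall p : place iota, vge p 0 x) -> exists c, x = iota c.
Proof.
move=> hx; have [c hc] := residue_ex FF (hx p0); exists c; apply/eqP.
rewrite -subr_eq0; apply/negPn/negP => nz.
have [s us hs] := fin_places_uniq (fin_support H (x - iota c)).
have := product_formula nz us hs.
have ge q : 0 <= pval q (x - iota c).
  by rewrite -vgeE //; apply: vgeB => //; apply: vge_const.
move: hc; rewrite vgeE // => h1.
have ps : p0 \in s by apply: hs; lia.
rewrite (bigD1_seq p0) //= => e.
have /(_ s) ge0 := @sumr_ge0 int _ _ (fun q => q != p0) (fun q => pval q (x - iota c)) (fun q _ => ge q).
by move: (lerD h1 ge0); rewrite e addr0.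
Qed.

Lemma effective_divisor (f : place iota -> nat) : fin_places (fun p => f p <> 0%N) ->
  exists s : seq (place iota), forall p, mult s p = f p.
Proof.
move=> /fin_places_uniq[u uu hu].
have cnt p : mult (flatten [seq nseq (f p) p | p <- u]) p = ((p \in u) * f p)%N.
  elim: u uu {hu} => //= q u IH /andP[qu uu].
  rewrite mult_cat IH // /mult count_nseq in_cons /= eq_sym.
  by have [->|pq] := eqVneq p q; rewrite ?eqxx ?(negbTE qu) /= ?addn0 ?mul0n.
exists (flatten [seq nseq (f p) p | p <- u]) => p; rewrite cnt.
have [_|pu] := boolP (p \in u); first by rewrite mul1n.
by apply/esym/eqP/negPn/negP => /eqP/hu; rewrite (negbTE pu).
Qed.

Lemma pole_divisor (I : finType) (x : I -> K) :
  exists s : seq (place iota), forall i (p : place iota), vge p (- (mult s p)%:Z) (x i).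
Proof.
have h1 y : exists s : seq (place iota), forall p : place iota, vge p (- (mult s p)%:Z) y.
  have [|s hs] := effective_divisor (f := fun p => absz (pval p y)).
    by apply: fin_placesS (fin_support H y) => p; lia.
  by exists s => p; rewrite hs; apply: vgeW (vge_pval p y); lia.
have [s hs] := boolp.choice (fun i => h1 (x i)).
exists (flatten [seq s i | i <- enum I]) => i p; apply: vgeW (hs i p).
rewrite lerN2 lez_nat /mult count_flatten -map_comp sumnE big_map big_enum /=.
by rewrite (bigD1 i) //= leq_addr.
Qed.

(** The constant is uniform in [s]: the extremal divisor, once enlarged by its own absolute value,
    becomes nonnegative, and adding [s] then costs at most [size s]. *)
Lemma dim_le_eff : exists u, forall s : seq (place iota), dim_le (fun p => (mult s p)%:Z) (u + size s).
Proof.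
have [D0 [dg0 [d0 [h1 h2 h3]]]] := extremal_divisor H.
have [|r hr] := effective_divisor (f := fun p => absz (D0 p)).
  by case: h1 => u [_ hu _]; exists u => p hp; apply/List_InP/hu; lia.
exists (d0 + size r)%N => s.
apply: (@dim_leS _ _ iota _ (addD (addD D0 r) s)); last exact (dim_le_add FF (s := s) (dim_le_add FF (s := r) h2)).
by move=> p; rewrite /addD hr; lia.
Qed.

(* Counting the monomials x^i z^j with i, j <= A against the dimension of the
   Riemann-Roch space containing them. *)
Lemma algebraic_dependence z x : exists2 P : {poly {poly k}}, P != 0 & ev2 iota z x P = 0.
Proof.
have [sx hsx] := pole_divisor (fun _ : unit => x).
have [sz hsz] := pole_divisor (fun _ : unit => z).
have [u hu] := dim_le_eff.
(* The number of monomials is quadratic in A and the dimension bound u + A c is linear; for A = u +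
   c one has (A + 1)^2 > u + A c. Below, an index [l] encodes the pair of exponents by division by A
   + 1. *)
pose c := (size sx + size sz)%N; pose A := (u + c)%N.
pose s := flatten (nseq A (sx ++ sz)).
have cs p : mult s p = (A * (mult sx p + mult sz p))%N.
  by rewrite /s; elim: (A) => //= B IH; rewrite !mult_cat IH; lia.
have ss : size s = (A * c)%N by rewrite /s /c; elim: (A) => //= B IH; rewrite !size_cat IH; lia.
have pw y r i (p : place iota) : (forall p : place iota, vge p (- (mult r p)%:Z) y) ->
    (i <= A)%N -> vge p (- (A * mult r p)%:Z) (y ^+ i).
  move=> hy iA; have [->|y0] := eqVneq y 0.
    by rewrite expr0n; case: i {iA} => [|i]; [apply: vgeW (vge1 p); lia|apply: vge_0].
  rewrite vgeE ?expf_neq0 // pvalX -mulr_natr natz.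
  by have := hy p; rewrite vgeE //; nia.
pose N := (u + A * c).+1.
pose b (l : 'I_N) := x ^+ (l %/ A.+1) * z ^+ (l %% A.+1).
have lN (l : 'I_N) : (l %/ A.+1 <= A)%N.
  by rewrite -ltnS ltn_divLR //; have := ltn_ord l; rewrite /N /A; nia.
have hb l : in_LD (fun p => (mult s p)%:Z) (b l).
  apply/in_LDE => p; rewrite cs.
  have := vgeM (pw x sx _ p (hsx tt) (lN l)) (pw z sz _ p (hsz tt) (_ : l %% A.+1 <= A)%N).
  by rewrite -ltnS ltn_pmod // => /(_ isT); apply: vgeW; lia.
have := hu s; rewrite ss => /(_ b hb) nind.
have [a [l0 al0] ea] : exists2 a : 'I_N -> k, exists l, a l <> 0 & \sum_l iota (a l) * b l = 0.
  apply: NNPP => nex; apply: nind => a ea l; apply: NNPP => al; apply: nex.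
  by exists a => //; exists l.
pose P := \poly_(i < A.+1) \poly_(j < A.+1) (if insub (i * A.+1 + j)%N is Some l then a l else 0).
exists P.
  apply/eqP => /polyP/(_ (l0 %/ A.+1)%N); rewrite coef_poly ltnS lN coef0.
  move/polyP/(_ (l0 %% A.+1)%N); rewrite coef_poly ltn_pmod // coef0 -divn_eq valK.
  exact: al0.
rewrite ev2_poly -[RHS]ea.
pose F m := (if insub m is Some l then iota (a l) * b l else 0) : K.
transitivity (\sum_(i < A.+1) \sum_(j < A.+1) F (i * A.+1 + j)%N).
  apply: eq_bigr => i _; rewrite ev_poly mulr_suml; apply: eq_bigr => j _.
  rewrite /F; case: insubP => [l _ el|]; last by rewrite rmorph0 !mul0r.
  rewrite /b el divnMDl // modnMDl divn_small // modn_small // addn0.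
  by rewrite mulrAC mulrA.
rewrite pair_big /= (reindex (fun l : 'I_(A.+1 * A.+1) => (inord (l %/ A.+1), inord (l %% A.+1)) : 'I_A.+1 * 'I_A.+1)) /=; last first.
  have lt (i j : 'I_A.+1) : (i * A.+1 + j < A.+1 * A.+1)%N.
    by have := ltn_ord i; have := ltn_ord j; nia.
  exists (fun ij => Ordinal (lt ij.1 ij.2)) => [l _|[i j] _] /=.
    apply: val_inj; rewrite /= !inordK -?divn_eq ?ltn_pmod //.
    by rewrite ltn_divLR.
  by rewrite divnMDl // modnMDl divn_small // modn_small // addn0 !inord_val.
have NA : (N <= A.+1 * A.+1)%N by rewrite /N /A; nia.
transitivity (\sum_(l < A.+1 * A.+1) F l).
  by apply: eq_bigr => l _; rewrite !inordK ?ltn_pmod ?ltn_divLR // -divn_eq.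
rewrite -(big_mkord predT F) (big_cat_nat (n := N)) //= [X in _ + X]big_nat_cond [X in _ + X]big1 => [|l].
  by rewrite addr0 big_mkord; apply: eq_bigr => l _; rewrite /F valK.
by rewrite andbT /F => /andP[nl _]; rewrite insubF // ltnNge nl.
Qed.

Lemma ev_nonconst z P : (forall c, z != iota c) -> P != 0 -> ev iota z P != 0.
Proof.
move=> nz P0; have [r -> _] := ev_factor iota z P0.
rewrite mulf_neq0 ?fmorph_eq0 ?lead_coef_eq0 // prodf_seq_neq0; apply/allP => c _ /=.
by rewrite subr_eq0.
Qed.

(** Descent on the degree in [x]: if the derivative of a relation also vanishes at [x], it is a
    shorter relation unless it is zero. In characteristic zero the latter leaves a constant in [x],
    impossible as [z] is not constant. *)
Lemma separable_relation z x : (forall c, z != iota c) ->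
  exists2 P : {poly {poly k}}, ev2 iota z x P = 0 & ev2 iota z x P^`() != 0.
Proof.
move=> nz; have [Q Q0 eQ] := algebraic_dependence z x.
have [m] := ubnP (size Q); elim: m => // m IH in Q Q0 eQ *; rewrite ltnS => sQ.
have [e|] := eqVneq (ev2 iota z x Q^`()) 0; last by exists Q.
have [d0|] := eqVneq (Q^`()) 0; last first.
  by move/IH; apply=> //; apply: leq_trans sQ; apply: lt_size_deriv.
have sz : (size Q <= 1)%N.
  rewrite leqNgt; apply/negP => s1.
  have : Q^`()`_(size Q).-2 = 0 by rewrite d0 coef0.
  rewrite coef_deriv -[(size Q).-2.+1]/((size Q).-2.+1).
  have -> : (size Q).-2.+1 = (size Q).-1 by case: (size Q) s1 => [|[]].
  have [ch _ _] := H.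
  move/eqP; rewrite -mulr_natl mulf_eq0 lead_coef_eq0 (negbTE Q0) orbF -polyC_natr polyC_eq0.
  have /pcharf0P-> := ch; lia.
move: eQ Q0; rewrite (size1_polyC sz) ev2C polyC_eq0 => + h.
by move/eqP; rewrite (negbTE (ev_nonconst nz h)).
Qed.

End ProductFormula.

(** * Derivations *)

Section Derivations.
Variables (k : closedFieldType) (K : fieldType) (iota : {rmorphism k -> K}).
Implicit Types (p q : place iota) (x y z : K).

Definition is_derivation (D : K -> K) : Prop :=
  [/\ forall x y, D (x + y) = D x + D y, forall x y, D (x * y) = D x * y + x * D y
    & forall c, D (iota c) = 0].

Section One.
Variable D : K -> K.
Hypothesis HD : is_derivation D.

Lemma derD x y : D (x + y) = D x + D y. Proof. by case: HD. Qed.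
Lemma derM x y : D (x * y) = D x * y + x * D y. Proof. by case: HD. Qed.
Lemma derC c : D (iota c) = 0. Proof. by case: HD. Qed.
Lemma der0 : D 0 = 0. Proof. by rewrite -{1}(rmorph0 iota) derC. Qed.
Lemma der1 : D 1 = 0. Proof. by rewrite -(rmorph1 iota) derC. Qed.
Lemma derN x : D (- x) = - D x.
Proof. by apply/eqP; rewrite -addr_eq0 -derD addNr der0. Qed.
Lemma derB x y : D (x - y) = D x - D y. Proof. by rewrite derD derN. Qed.
Lemma derCM c x : D (iota c * x) = iota c * D x.
Proof. by rewrite derM derC mul0r add0r. Qed.
Lemma der_sum (I : Type) (r : seq I) (P : pred I) (F : I -> K) :
  D (\sum_(i <- r | P i) F i) = \sum_(i <- r | P i) D (F i).
Proof. exact: (big_morph D derD der0). Qed.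

Lemma derV x : D x^-1 = - D x / x ^+ 2.
Proof.
have [->|x0] := eqVneq x 0; first by rewrite invr0 der0 oppr0 mul0r.
have := der1; rewrite -(mulfV x0) derM => /eqP; rewrite addrC addr_eq0 => /eqP e.
by apply: (mulfI x0); rewrite e; field.
Qed.

Lemma der_ev z P : D (ev iota z P) = ev iota z P^`() * D z.
Proof.
elim/poly_ind: P => [|P c IH]; first by rewrite rmorph0 der0 deriv0 rmorph0 mul0r.
rewrite evD evM evX evC derD derM derC IH addr0.
by rewrite derivD derivM derivX derivC addr0 mulr1 evD evM evX; ring.
Qed.

Lemma der_ev2 z x P :
  D (ev2 iota z x P) = ev2 iota z x (map_poly (@deriv k) P) * D z + ev2 iota z x P^`() * D x.
Proof.
elim/poly_ind: P => [|P c IH]; first by rewrite map_poly0 deriv0 !ev20 der0 !mul0r addr0.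
have -> : map_poly (@deriv k) (P * 'X + c%:P) = map_poly (@deriv k) P * 'X + (c^`())%:P.
  apply/polyP => i; rewrite coef_map /= !coefD !coefMX !coefC derivD.
  by case: i => [|i] /=; rewrite ?deriv0 ?coef_map.
rewrite !ev2D !ev2M ev2X !ev2C derD derM der_ev IH.
by rewrite derivD derivM derivX derivC addr0 mulr1 ev2D ev2M ev2X; ring.
Qed.

(** Writing x = pi^b h with [h] integral, the extra unit of loss comes from differentiating pi^b. *)
Lemma vge_der p e b x : (forall x, vge p 0 x -> vge p (- e) (D x)) ->
  vge p b x -> vge p (b - (1 + e)) (D x).
Proof.
move=> he hx; have [pi vpi] := uniformizer_ex p.
have pi0 : pi != 0 by apply: pval_pos_nz vpi.
pose h := x / pi ^ b; have xE : x = pi ^ b * h by rewrite /h mulrC divfK ?expfz_neq0.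
have vz n : vge p n (pi ^ n) by rewrite /vge pvalXz vpi mul1r lexx orbT.
have h0 : vge p 0 h.
  by rewrite /h -[0](subrr b) -vge_div ?expfz_neq0 // pvalXz vpi mul1r.
have vpi' : vge p (- e) (D pi) by apply: he; rewrite /vge vpi orbT.
have pos (m : nat) : vge p (m%:Z - (1 + e)) (D (pi ^+ m)).
  elim: m => [|m IH]; first by rewrite expr0 der1 vge_0.
  rewrite exprS derM; apply: vgeD.
    by apply: vgeW (vgeM vpi' (vz m)); lia.
  by apply: vgeW (vgeM (vz 1) IH); lia.
have dz (n : int) : vge p (n - (1 + e)) (D (pi ^ n)).
  case: n => m; first exact: pos.
  rewrite NegzE -exprnN derV -exprM; apply: vgeW (vgeM _ (vz (- (m.+1 * 2)%:Z))); last first.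
    by rewrite vgeN; apply: pos.
  by lia.
rewrite xE derM; apply: vgeD; first exact: vgeMr0.
by apply: vgeW (vgeM (vz b) (he _ h0)); lia.
Qed.

End One.

(* At a place with uniformizer pi, [y] is the derivative of [x] with respect to pi as soon as
   the pi-adic expansion of [y] is the formal derivative of that of [x]. *)
Definition expands p pi x y := forall N : nat, exists al : {poly k},
  vge p N%:Z (x - ev iota pi al) /\ vge p N%:Z (y - ev iota pi al^`()).

Section Local.
Variables (g : nat) (H : genus_field iota g) (p : place iota) (pi : K).
Hypothesis vpi : pval p pi = 1.

Let pi0 : pi != 0. Proof. exact: pval_pos_nz vpi. Qed.
Let FF : function_field iota. Proof. by case: H. Qed.
Let vgepi : vge p 0 pi. Proof. by rewrite /vge vpi orbT. Qed.

Let vgepiX n : vge p n%:Z (pi ^+ n).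
Proof. by rewrite /vge pvalX vpi natz lexx orbT. Qed.

Lemma uniformizer_nonconst c : pi != iota c.
Proof. by apply/eqP => e; move: vpi; rewrite e pval_const. Qed.

Lemma expansion x N : vge p 0 x -> exists al, vge p N%:Z (x - ev iota pi al).
Proof.
move=> x0; elim: N => [|N [al h]]; first by exists 0; rewrite ev0 subr0.
have h1 : vge p 0 ((x - ev iota pi al) / pi ^+ N).
  by rewrite -[0](subrr N%:Z) -vge_div ?expf_neq0 // pvalX vpi natz.
have [c hc] := residue_ex FF h1.
exists (al + c%:P * 'X^N).
have -> : x - ev iota pi (al + c%:P * 'X^N) =
    ((x - ev iota pi al) / pi ^+ N - iota c) * pi ^+ N.
  by rewrite mulrBl divfK ?expf_neq0 // evD evM evC rmorphXn /= evX opprD addrA.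
by rewrite -addn1 addnC PoszD; apply: vgeM.
Qed.

(** The order of a polynomial in the uniformizer is the multiplicity of 0 as its root, because the
    cofactor has nonzero residue. *)
Lemma vge_ev_dvd n al : vge p n%:Z (ev iota pi al) -> exists r, al = r * 'X^n.
Proof.
have [->|al0] := eqVneq al 0; first by exists 0; rewrite mul0r.
have [m [r]] := multiplicity_XsubC al 0; rewrite al0 /= subr0 => r0 ->.
have rpi : ~~ vge p 1 (ev iota pi r).
  apply: contraNN r0 => h; rewrite /root; apply/eqP.
  apply: (@residue_uniq _ _ iota p (ev iota pi r) r.[0] 0); last by rewrite (rmorph0 iota) subr0.
  by apply: vge_ev_res; rewrite (rmorph0 iota) subr0 /vge vpi orbT.
have re0 : ev iota pi r != 0 by apply: contraNneq rpi => ->; apply: vge_0.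
have vr : pval p (ev iota pi r) = 0 by apply: pval_eq; rewrite ?add0r //; apply: vge_ev.
rewrite evM rmorphXn /= evX vgeE ?mulf_neq0 ?expf_neq0 // pvalM ?expf_neq0 // vr pvalX vpi natz add0r => nm.
by exists (r * 'X^(m - n)); rewrite -mulrA -exprD subnK.
Qed.

Lemma expands_ge0 x y : expands p pi x y -> vge p 0 x /\ vge p 0 y.
Proof.
move=> /(_ 0%N)[al [h1 h2]]; split.
  by rewrite -[x](subrK (ev iota pi al)); apply: vgeD => //; apply: vge_ev.
by rewrite -[y](subrK (ev iota pi al^`())); apply: vgeD => //; apply: vge_ev.
Qed.

Lemma expands_uniq x y y' : expands p pi x y -> expands p pi x y' -> y = y'.
Proof.
move=> h h'; apply/eqP; rewrite -subr_eq0; apply/negPn/negP => nz.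
have big (N : nat) : vge p N%:Z (y - y').
  (* Precision N + 1, as differentiating the difference of the two expansions loses one order. *)
  have [al [h1 h2]] := h N.+1; have [be [h3 h4]] := h' N.+1.
  have [r eq] : exists r : {poly k}, al - be = r * 'X^(N.+1).
    apply: vge_ev_dvd; rewrite rmorphB /=.
    rewrite (_ : _ - _ = (x - ev iota pi be) - (x - ev iota pi al)); last by ring.
    exact: vgeB.
  have -> : y - y' = (y - ev iota pi al^`()) - (y' - ev iota pi be^`())
      + ev iota pi (al - be)^`() by rewrite derivB rmorphB /=; ring.
  apply: vgeD; first by apply: vgeW (vgeB h2 h4); lia.
  rewrite eq derivM derivXn -pred_Sn evD !evM rmorphMn /= !evXn exprS.
  apply: vgeD.
    by rewrite mulrA; apply: vgeM0 => //; apply: vgeM0 => //; apply: vge_ev.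
  by apply: vgeM0; [apply: vge_ev|rewrite -mulr_natl -(rmorph_nat iota); apply: vgeM0 => //; apply: vge_const].
have := big `|pval p (y - y')|.+1; rewrite vgeE //; lia.
Qed.

Lemma expandsD x y x' y' : expands p pi x y -> expands p pi x' y' -> expands p pi (x + x') (y + y').
Proof.
move=> h h' N; have [al [h1 h2]] := h N; have [be [h3 h4]] := h' N.
have e (a b c d : K) : a + b - (c + d) = (a - c) + (b - d) by ring.
by exists (al + be); rewrite derivD !evD !e; split; apply: vgeD.
Qed.

Lemma expandsM x y x' y' : expands p pi x y -> expands p pi x' y' ->
  expands p pi (x * x') (y * x' + x * y').
Proof.
move=> h h' N; have [al [h1 h2]] := h N; have [be [h3 h4]] := h' N.
have [x0 y0] := expands_ge0 h; have [x0' y0'] := expands_ge0 h'.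
have e1 a b u v : vge p 0 u -> vge p N%:Z (u - ev iota pi a) -> vge p N%:Z (v - ev iota pi b) ->
    vge p N%:Z (u * v - ev iota pi a * ev iota pi b).
  move=> u0 hu hv.
  rewrite (_ : _ - _ = u * (v - ev iota pi b) + (u - ev iota pi a) * ev iota pi b); last by ring.
  by apply: vgeD; [apply: vgeM0|apply: vgeMr0 => //; apply: vge_ev].
exists (al * be); rewrite evM; split; first exact: e1.
rewrite derivM evD !evM opprD addrACA; apply: vgeD; exact: e1.
Qed.

Lemma expandsC c : expands p pi (iota c) 0.
Proof. by move=> N; exists c%:P; rewrite derivC rmorph0 evC !subrr vge_0. Qed.

Lemma expands_pi : expands p pi pi 1.
Proof. by move=> N; exists 'X; rewrite derivX rmorph1 evX !subrr vge_0. Qed.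

(* The derivative exists in [K] because [x] satisfies an algebraic equation P(pi, x) = 0. *)
Lemma expands_ex x : vge p 0 x -> exists y, expands p pi x y.
Proof.
move=> x0; have [P eP dP] := separable_relation H x uniformizer_nonconst.
(* Implicit differentiation of P(pi, x) = 0, where [map_poly] differentiates the coefficients, gives
   the candidate - dT / dX. *)
pose dT := ev2 iota pi x (map_poly (@deriv k) P); pose dX := ev2 iota pi x P^`().
exists (- dT / dX) => N.
have evp0 Q u : vge p 0 u -> vge p 0 (ev2 iota pi u Q).
  by move=> u0; apply: vge_horner => // i; rewrite coef_map; apply: vge_ev.
have dX0 : 0 <= pval p dX by rewrite -vgeE //; apply: evp0.
pose s := absz (pval p dX); have sE : pval p dX = s%:Z by rewrite /s; lia.
(* Of this precision, [s] is lost by dividing by [dX] and one order by differentiating. *)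
have [al hal] := expansion (N + s).+1 x0.
exists al; split; first by apply: vgeW hal; lia.
have close Q : vge p (N + s).+1%:Z (ev2 iota pi x Q - ev iota pi Q.[al]).
  elim/poly_ind: Q => [|Q c IH]; first by rewrite horner0 ev20 ev0 subrr vge_0.
  rewrite hornerMXaddC ev2D ev2M ev2X ev2C evD evM.
  rewrite (_ : _ - _ = (ev2 iota pi x Q - ev iota pi Q.[al]) * x
       + ev iota pi Q.[al] * (x - ev iota pi al)); last by ring.
  by apply: vgeD; [apply: vgeMr0|apply: vgeM0 => //; apply: vge_ev].
have [r eq] : exists r : {poly k}, P.[al] = r * 'X^((N + s).+1).
  by apply: vge_ev_dvd; have := close P; rewrite eP sub0r vgeN.
have chain Q : (Q.[al])^`() = (map_poly (@deriv k) Q).[al] + (Q^`()).[al] * al^`().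
  elim/poly_ind: Q => [|Q c IH]; first by rewrite map_poly0 deriv0 !horner0 deriv0 mul0r addr0.
  have -> : map_poly (@deriv k) (Q * 'X + c%:P) = map_poly (@deriv k) Q * 'X + (c^`())%:P.
    apply/polyP => i; rewrite coef_map /= !coefD !coefMX !coefC derivD.
    by case: i => [|i] /=; rewrite ?deriv0 ?coef_map.
  rewrite !hornerMXaddC !derivD !derivM derivX derivC IH !hornerE; ring.
have h1 : vge p (N + s)%:Z (dT + dX * ev iota pi al^`()).
  have -> : dT + dX * ev iota pi al^`() =
     (dT - ev iota pi (map_poly (@deriv k) P).[al]) + (dX - ev iota pi P^`().[al]) * ev iota pi al^`()
     + ev iota pi (P.[al])^`() by rewrite chain evD evM; ring.
  apply: vgeD.
    apply: vgeD; first by apply: vgeW (close _); lia.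
    by apply: vgeMr0; [apply: vgeW (close _); lia|apply: vge_ev].
  rewrite eq derivM derivXn -pred_Sn evD !evM rmorphMn /= !evXn exprS.
  apply: vgeD.
    by rewrite mulrA; apply: vgeM0 => //; apply: vgeM0 => //; apply: vge_ev.
  by apply: vgeM0; [apply: vge_ev|rewrite -mulr_natl -(rmorph_nat iota); apply: vgeM0 => //; apply: vge_const].
rewrite -vgeN (_ : - _ = (dT + dX * ev iota pi al^`()) / dX); last by field.
by rewrite (_ : N%:Z = (N + s)%:Z - s%:Z); [rewrite -vge_div|lia].
Qed.

(** Extends [expands] to functions with a pole at [p]: [y] is tested as the derivative of [x]
    through the product rule for pi^j x. For j = 0 the factor [*+ j] kills the term with [j.-1]. *)
Let expK x y j := expands p pi (pi ^+ j * x) (pi ^+ j * y + pi ^+ j.-1 *+ j * x).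

Let expKS x y j : expK x y j -> expK x y j.+1.
Proof.
move=> h; have := expandsM expands_pi h; rewrite /expK mul1r mulrA -exprS.
congr expands; rewrite mulrDr !mulrA -exprS addrCA; congr (_ + _).
case: j {h} => [|j]; first by rewrite mulr0n mulr0 mul0r addr0 expr0 mulr1n.
by rewrite -pred_Sn [in RHS]mulrS mulrDl mulrnAr -exprS.
Qed.

Let expKW x y j n : expK x y j -> expK x y (n + j).
Proof. by move=> h; elim: n => // n /expKS. Qed.

Let expK_uniq x y y' j j' : expK x y j -> expK x y' j' -> y = y'.
Proof.
move=> /(@expKW _ _ _ j') h /(@expKW _ _ _ j); rewrite addnC => h'.
have /addIr := expands_uniq h h'; apply: mulfI; exact: expf_neq0.
Qed.

(** This is d/dpi, read off from expansions at the single place [p]. Its values are picked by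
    choice; uniqueness of the expanded derivative makes it additive and Leibniz. *)
Lemma local_derivation : exists2 D, is_derivation D
  & D pi = 1 /\ forall x, vge p 0 x -> vge p 0 (D x).
Proof.
have ex x : exists y, exists j, expK x y j.
  have [j hj] : exists j, vge p 0 (pi ^+ j * x).
    exists (absz (pval p x)).
    have [->|x0] := eqVneq x 0; first by rewrite mulr0 vge_0.
    by rewrite vgeE ?mulf_neq0 ?expf_neq0 // pvalM ?expf_neq0 // pvalX vpi natz; lia.
  have [y hy] := expands_ex hj; exists ((y - pi ^+ j.-1 *+ j * x) / pi ^+ j), j.
  by rewrite /expK [_ * (_ / _)]mulrC divfK ?expf_neq0 // subrK.
have [D hD] := boolp.choice ex; exists D; last split.
- split=> [x y|x y|c].
  + have [j h] := hD (x + y); have [j1 h1] := hD x; have [j2 h2] := hD y.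
    apply: expK_uniq h (_ : expK _ _ (j1 + j2)).
    have := expandsD (expKW j2 h1) (expKW j1 h2); rewrite [(j2 + j1)%N]addnC.
    by rewrite /expK; congr expands; ring.
  + have [j h] := hD (x * y); have [j1 h1] := hD x; have [j2 h2] := hD y.
    apply: expK_uniq h (_ : expK _ _ (j1.+1 + j2.+1)).
    have := expandsM (expKS h1) (expKS h2).
    rewrite /expK; congr expands; first by rewrite exprD; ring.
    rewrite (_ : (j1.+1 + j2.+1).-1 = j1 + j2.+1)%N // -[_ *+ j1.+1]mulr_natr -[_ *+ j2.+1]mulr_natr.
    rewrite -[_ *+ (j1.+1 + j2.+1)]mulr_natr natrD !exprD /= !exprS.
    by move: (pi ^+ j1) (pi ^+ j2) (j1.+1%:R) (j2.+1%:R) => A B c d; ring.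
  by have [j h] := hD (iota c); apply: expK_uniq h (_ : expK _ _ 0); rewrite /expK !expr0 !mul1r mulr0n mul0r addr0; apply: expandsC.
- have [j h] := hD pi; apply: expK_uniq h (_ : expK _ _ 0).
  by rewrite /expK !expr0 !mul1r mulr0n mul0r addr0; apply: expands_pi.
move=> x /expands_ex[y hy].
have [j h] := hD x; have -> : D x = y; last by have [] := expands_ge0 hy.
by apply: expK_uniq h (_ : expK _ _ 0); rewrite /expK !expr0 !mul1r mulr0n mul0r addr0.
Qed.

End Local.
End Derivations.

Lemma sum1_sizez (T : Type) (s : seq T) : \sum_(p <- s) (1 : int) = (size s)%:Z.
Proof. by elim: s => [|p s IH]; rewrite ?big_nil ?big_cons ?IH /=; lia. Qed.

(** * Derivations of K and their losses at the places *)

Section GlobalDerivation.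
Variables (k : closedFieldType) (K : fieldType) (iota : {rmorphism k -> K}) (g : nat).
Hypothesis H : genus_field iota g.
Implicit Types (p q : place iota) (x y z : K).

Let FF : function_field iota. Proof. by case: H. Qed.

(** A separable relation P(z, x) = 0 expresses the derivative of [x] through that of [z], by a
    factor that is the same for all derivations. *)
Lemma der_prop D1 D2 z x : is_derivation iota D1 -> is_derivation iota D2 ->
  (forall c, z != iota c) -> D1 x * D2 z = D2 x * D1 z.
Proof.
move=> h1 h2 nz; have [P eP dP] := separable_relation H x nz.
have e D : is_derivation iota D -> D x = - (ev2 iota z x (map_poly (@deriv k) P) * D z) / ev2 iota z x P^`().
  move=> hD; have /eqP := der_ev2 hD z x P; rewrite eP (der0 hD) eq_sym addrC addr_eq0 => /eqP e.
  by rewrite -e mulrC mulKf.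
by rewrite !e //; ring.
Qed.

(** If [x] were not constant, [z] would satisfy a separable relation over [k[x]], and
    differentiating it would force [D z = 0]. *)
Lemma der_ker D z x : is_derivation iota D -> D z != 0 -> D x = 0 -> exists c, x = iota c.
Proof.
move=> hD nz dx; apply: NNPP => nex.
have xc c : x != iota c by apply/eqP => e; apply: nex; exists c.
have [P eP dP] := separable_relation H z xc.
have := der_ev2 hD x z P; rewrite eP (der0 hD) dx mulr0 add0r => /esym/eqP.
by rewrite mulf_eq0 (negbTE dP) (negbTE nz).
Qed.

(** Any derivation is [D pi] times d/dpi, and d/dpi preserves integrality at [p]. *)
Lemma der_uniformizer D p pi x : is_derivation iota D -> pval p pi = 1 ->
  vge p 0 x -> vge p (pval p (D pi)) (D x).
Proof.
move=> hD vpi x0; have [Dp hDp [dpi hp]] := local_derivation H vpi.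
have := der_prop x hD hDp (uniformizer_nonconst vpi); rewrite dpi mulr1 => ->.
by apply: vgeM0; [apply: hp|apply: vge_pval].
Qed.

Lemma deg_uniq (D : place iota -> int) a b : divisor_deg D a -> divisor_deg D b -> a = b.
Proof.
case=> s [/List_NoDupP us hs ->] [u [/List_NoDupP uu hu ->]].
by apply: sum_support => // p h; apply/List_InP; [apply: hs|apply: hu].
Qed.

Lemma dim_le_ex (D : place iota -> int) dg : divisor_deg D dg -> exists u, dim_le D u.
Proof.
case=> s [_ hs _]; have [u hu] := dim_le_eff H.
have [|r hr] := effective_divisor (f := fun p => absz (D p)).
  by exists s => p hp; apply/List_InP/hs; lia.
exists (u + size r)%N; apply: dim_leS (hu r) => p; rewrite hr; lia.
Qed.

Lemma deg_eff (s : seq (place iota)) : divisor_deg (fun p => (mult s p)%:Z) (size s)%:Z.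
Proof.
have := @deg_addD _ _ iota (fun=> 0) 0 s; rewrite add0r => h.
apply: deg_ext (h _) => [p|]; first by rewrite /addD add0r.
by exists [::]; split=> //; [constructor|rewrite big_nil].
Qed.

(** Riemann-Roch in large degree: [D - D0] has degree at least the genus, so its space contains some
    z <> 0. Then [D + div z] is [D0] plus an effective divisor, and its dimension is bounded by
    adding points to [D0]. *)
Lemma dim_le_large (D0 : place iota -> int) dg0 d0 (D : place iota -> int) dg : divisor_deg D0 dg0 -> dim_le D0 d0 ->
  dg0 - d0%:Z + 1 = g%:Z -> divisor_deg D dg -> dg0 + g%:Z <= dg ->
  exists2 d, dim_le D d & d%:Z = dg + 1 - g%:Z.
Proof.
move=> h1 h2 h3 hD le.
have hN : divisor_deg (fun p => - D0 p) (- dg0).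
  case: h1 => s [us hs ->]; exists s; split=> //; last by rewrite sumrN.
  by move=> p h; apply: hs; lia.
have hdiff : divisor_deg (fun p => D p - D0 p) (dg - dg0).
  case: hN => s [/List_NoDupP us hs ->]; apply: deg_addf => // p hp.
  by apply/List_InP; apply: hs; lia.
have [u hu] := dim_le_ex hdiff.
have [d' [_ hd'] [b [hb ib]]] := riemann_ineq H hu hdiff.
have [z z0 hz] : exists2 z, z != 0 & in_LD (fun p => D p - D0 p) z.
  have d1 : (0 < d')%N by lia.
  exists (b (Ordinal d1)) => //; apply/eqP => e.
  have := ib (fun i => if i == Ordinal d1 then 1 else 0) _ (Ordinal d1).
  rewrite eqxx => h; have /eqP : (1 : k) = 0 by apply: h; rewrite big1 // => i _; case: eqP => [->|_]; rewrite ?e ?rmorph0 ?mulr0 ?mul0r.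
  by rewrite oner_eq0.
have [|s hs] := effective_divisor (f := fun p => absz (D p + pval p z - D0 p)%R).
  have [u1 hu1] := fin_support H z; case: hdiff => u2 [_ hu2 _]; exists (u1 ++ u2) => p hp.
  rewrite mem_cat; have [/hu1->//|/hu2/List_InP->] : (pval p z <> 0) \/ (D p - D0 p <> 0 :> int) by lia.
  by rewrite orbT.
have e p : D p + pval p z = addD D0 s p.
  rewrite /addD hs; have /in_LDE/(_ p) := hz; rewrite vgeE //; lia.
have hDz : divisor_deg (fun p => D p + pval p z) dg.
  have [r ur hr] := fin_places_uniq (fin_support H z).
  by rewrite -[dg]addr0 -(product_formula H z0 ur hr); apply: deg_addf.
have ds : dg = dg0 + (size s)%:Z.
  by apply: deg_uniq hDz _; apply: deg_ext (deg_addD s h1) => p; rewrite e.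
exists (d0 + size s)%N; last by rewrite PoszD; lia.
have h : dim_le (fun p => D p + pval p z) (d0 + size s).
  by apply: dim_leS (dim_le_add FF (s := s) h2) => p; rewrite e.
have zV : z^-1 != 0 by rewrite invr_eq0.
by apply: dim_leS (dim_le_div zV h) => p; rewrite pvalV addrK.
Qed.

Lemma basis_span (D : place iota -> int) d (b : 'I_d -> K) f : dim_le D d ->
  (forall i, in_LD D (b i)) -> k_indep iota b -> in_LD D f ->
  exists c : 'I_d -> k, f = \sum_i iota (c i) * b i.
Proof.
move=> hd hb ib hf.
pose b' (i : 'I_d.+1) := if unlift ord_max i is Some j then b j else f.
have hb' i : in_LD D (b' i) by rewrite /b'; case: unlift.
have [c [ec [l cl]]] : exists c : 'I_d.+1 -> k, \sum_i iota (c i) * b' i = 0 /\ exists l, c l <> 0.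
  apply: NNPP => nex; apply: (hd b' hb') => c ec l; apply: NNPP => cl; apply: nex.
  by exists c; split=> //; exists l.
move: ec; rewrite (bigD1_ord ord_max) //= {1}/b' unlift_none.
rewrite (eq_bigr (fun i => iota (c (lift ord_max i)) * b i)) => [ec|i _]; last by rewrite /b' liftK.
have cm : c ord_max != 0.
  apply/eqP => cm; move: ec; rewrite cm rmorph0 mul0r add0r => /ib h; apply: cl.
  by have [j ->|->//] := unliftP ord_max l; apply: h.
exists (fun i => - (c (lift ord_max i) / c ord_max)).
have cm' : iota (c ord_max) != 0 by rewrite fmorph_eq0.
apply: (mulfI cm'); move/eqP: ec; rewrite addr_eq0 => /eqP->.
rewrite mulr_sumr -sumrN; apply: eq_bigr => i _.
by rewrite mulrA -rmorphM -mulNr -rmorphN; congr (iota _ * _); field.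
Qed.

(* A Riemann-Roch space L(E) of large degree contains a uniformizer at almost every
   place, and D maps it into a finite-dimensional space, hence preserves integrality there. *)
Lemma der_regular D : is_derivation iota D ->
  fin_places (fun p : place iota => ~ forall x, vge p 0 x -> vge p 0 (D x)).
Proof.
move=> hD; case: (classic (exists p : place iota, True)) => [[p0 _]|np]; last first.
  by exists [::] => p; case: np; exists p.
have [D0 [dg0 [d0 [h1 h2 h3]]]] := extremal_divisor H.
(* The degree is large enough for the dimension formula to hold even after subtracting [2 p], so
   that some function vanishes at [p] to order exactly [1 - E p]. *)
pose E := addD D0 (nseq (g + 2) p0).
have hE : divisor_deg E (dg0 + (g + 2)%N%:Z) by have := deg_addD (nseq (g + 2) p0) h1; rewrite size_nseq.
have hsub p (n : int) : divisor_deg (fun q => E q - (if q == p then n else 0)) (dg0 + (g + 2)%N%:Z - n).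
  have -> : - n = \sum_(q <- [:: p]) - (if q == p then n else 0) by rewrite big_seq1 eqxx.
  by apply: deg_addf => // q; rewrite inE; case: eqP.
have hunif p : exists2 f, in_LD (fun q => E q - (if q == p then 1 else 0)) f
    & ~ in_LD (fun q => E q - (if q == p then 2 else 0)) f.
  have [u hu] := dim_le_ex (hsub p 1).
  have [d' [_ hd'] [b [hb ib]]] := riemann_ineq H hu (hsub p 1).
  have [|d hd ed] := dim_le_large h1 h2 h3 (hsub p 2); first by lia.
  have dd : (d.+1 <= d')%N by lia.
  apply: NNPP => nex; apply: (hd (fun i => b (widen_ord dd i))) => [i|]; last exact: k_indep_lt.
  by apply: NNPP => nl; apply: nex; exists (b (widen_ord dd i)).
have [d hd _] : exists2 d, dim_le E d & d%:Z = dg0 + (g + 2)%N%:Z + 1 - g%:Z.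
  by apply: dim_le_large h1 h2 h3 hE _; lia.
have [d' dd [[b [hb ib]] nb]] := ell_ex hd.
have hd' : dim_le E d' by move=> b' hb' ib'; apply: nb; exists b'.
have f1 : fin_places (fun p : place iota => E p <> 0).
  by case: hE => s [_ hs _]; exists s => p /hs/List_InP.
have f2 := @fin_places_seq _ _ iota _ (enum 'I_d') (fun i p => ~~ vge p 0 (D (b i))) (fun i _ => fin_poles H (D (b i))).
apply: fin_placesS (fin_placesU f1 f2) => p bad; apply: NNPP => /not_or_and[/NNPP Ep nf].
apply: bad => x x0; have [f fL fN] := hunif p.
have /(basis_span hd' hb ib)[c ef] : in_LD E f.
  by apply/in_LDE => q; have /in_LDE/(_ q) := fL; apply: vgeW; case: eqP => _; lia.
have vf : pval p f = 1.
  apply: pval_eq.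
  - by apply/eqP => f0; apply: fN; left.
  - by have /in_LDE/(_ p) := fL; rewrite Ep eqxx.
  apply/negP => v2; apply: fN; apply/in_LDE => q; have [->|qp] := eqVneq q p; first by rewrite Ep.
  by have /in_LDE/(_ q) := fL; rewrite (negbTE qp).
apply: vgeW (der_uniformizer hD vf x0).
have df : vge p 0 (D f).
  rewrite ef (der_sum hD); apply: vge_sum => i _; rewrite (derCM hD).
  apply: vgeM0; first exact: vge_const.
  by apply/negPn/negP => h; apply: nf; exists i => //; rewrite mem_enum.
have [df0|] := eqVneq (D f) 0; first by rewrite df0 pval0.
by move=> nz; rewrite -vgeE.
Qed.

(* The derivation is d/dt for a function t whose only pole is p0, a simple one. *)
Lemma genus0_derivation p0 : g = 0%N -> exists2 D, is_derivation iota D &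
  [/\ exists z, D z != 0, forall p x, p != p0 -> vge p 0 x -> vge p 0 (D x)
    & forall b x, vge p0 b x -> vge p0 (b + 1) (D x)].
Proof.
move=> g0.
have h1 := deg_eff [:: p0]; have [u hu] := dim_le_ex h1.
have [d' [_ hd'] [b [hb ib]]] := riemann_ineq H hu h1.
have dd : (2 <= d')%N by move: hd'; rewrite g0 /=; lia.
have [t tL tc] : exists2 t, in_LD (fun p => (mult [:: p0] p)%:Z) t & forall c, t != iota c.
  apply: NNPP => nex.
  have all_const (i : 'I_2) : exists c, b (widen_ord dd i) = iota c.
    apply: NNPP => nc; apply: nex; exists (b (widen_ord dd i)) => // c; apply/eqP => e.
    by apply: nc; exists c.
  have [c hc] := boolp.choice all_const.
  have ib2 := k_indep_lt (dd := dd) ib.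
  have sum2 (F : 'I_2 -> K) : \sum_i F i = F 0 + F 1.
    by rewrite !big_ord_recl big_ord0 addr0; congr (_ + F _); apply: val_inj.
  have c1 : c 1 = 0.
    apply: (ib2 (fun i => if i == 0 then c 1 else - c 0) _ 0).
    by rewrite sum2 /= !hc rmorphN; ring.
  have /eqP : (1 : k) = 0; last by rewrite oner_eq0.
  apply: (ib2 (fun i => if i == 1 then 1 else 0) _ 1).
  by rewrite sum2 /= !hc c1 !rmorph0 mul0r mulr0 addr0.
have v0 p : p != p0 -> vge p 0 t.
  by move=> pp; have /in_LDE/(_ p) := tL; rewrite mult_cons (negbTE pp).
have pole : pval p0 t = -1.
  apply: pval_eq; first by rewrite -(rmorph0 iota).
    by have /in_LDE/(_ p0) := tL; rewrite mult_cons eqxx.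
  apply/negP => h; have [c tcE] : exists c, t = iota c.
    by apply: (regular_const H p0) => p; have [->//|] := eqVneq p p0; apply: v0.
  by have := tc c; rewrite tcE eqxx.
have nzc c : t - iota c != 0 by rewrite subr_eq0.
have pole' c : pval p0 (t - iota c) = -1.
  have := @pval_addl _ _ _ p0 t (- iota c); rewrite -{1}(rmorph0 iota) => /(_ (tc 0)) [|_ ->//].
  by rewrite pole vgeN vge_const.
have ge0 c p : p != p0 -> 0 <= pval p (t - iota c).
  by move=> pp; rewrite -vgeE //; apply: vgeB; [apply: v0|apply: vge_const].
have sum1 c s : uniq s -> (forall p, pval p (t - iota c) <> 0 -> p \in s) ->
    \sum_(p <- s | p != p0) pval p (t - iota c) = 1.
  move=> us hs; have := product_formula H (nzc c) us hs.
  rewrite (bigD1_seq p0) ?hs ?pole' //= addrC => /eqP.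
  by rewrite subr_eq0 => /eqP.
(* The only pole of [t - c] is simple, so its zeros have total order one. *)
have simple c p : p != p0 -> vge p 1 (t - iota c) -> pval p (t - iota c) = 1.
  move=> pp; rewrite vgeE // => h; apply/eqP; rewrite eq_le h andbT.
  have [s us hs] := fin_places_uniq (fin_support H (t - iota c)).
  rewrite -(sum1 c s us hs) big_mkcond (bigD1_seq p) /= ?pp //; last by apply: hs; lia.
  by rewrite lerDl; apply: sumr_ge0 => q _; case: ifP => // /ge0.
have [p1 pp1 hp1] : exists2 p1, p1 != p0 & vge p1 1 (t - iota 0).
  apply: NNPP => nex; have [s us hs] := fin_places_uniq (fin_support H (t - iota 0)).
  have := sum1 0 s us hs; rewrite big1 // => p pp; apply: le_anti; rewrite ge0 // andbT.
  by rewrite leNgt; apply/negP => h; apply: nex; exists p => //; rewrite vgeE.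
(* The zero [p1] of [t] makes [t] a uniformizer there, and the local derivation at [p1] is d/dt. *)
have [D hD [dt _]] := local_derivation H (simple _ _ pp1 hp1).
have {}dt : D t = 1 by move: dt; rewrite (derB hD) (derC hD) subr0.
exists D => //; split.
- by exists t; rewrite dt oner_eq0.
- move=> p x pp x0; have [c hc] := residue_ex FF (v0 p pp).
  have := der_uniformizer hD (simple _ _ pp hc) x0.
  by rewrite (derB hD) (derC hD) dt subr0 pval1.
move=> b0 x hx; have vtV : pval p0 t^-1 = 1 by rewrite pvalV pole.
(* The derivative of the uniformizer 1/t is - 1/t^2, of order 2; after the unit loss of [vge_der]
   one order is gained. *)
have he y : vge p0 0 y -> vge p0 (- (-2)) (D y).
  move=> /(der_uniformizer hD vtV); apply: vgeW.
  by rewrite (derV hD) dt mulNr mul1r pvalN pvalV pvalX pole.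
by apply: vgeW (vge_der hD he hx); lia.
Qed.

(** The total loss must be controlled by max(0, 2 genus - 2 + |S|) with a factor independent of S.
    In genus at least 1 one derivation serves all S, and [T] is S together with its bad places; in
    genus 0 it depends on S. *)
Lemma derivation_ex : exists C0 : nat, forall S : seq (place iota), uniq S -> S != [::] ->
  exists (T : seq (place iota)) (D : K -> K) (e : place iota -> int),
    [/\ uniq T, {subset S <= T}, is_derivation iota D & exists z, D z != 0] /\
    [/\ forall p x, p \notin T -> vge p 0 x -> vge p 0 (D x),
        forall p b x, p \in T -> vge p b x -> vge p (b - e p) (D x)
      & \sum_(p <- T) e p <= C0%:Z * Num.max 0 (2 * g%:Z - 2 + (size S)%:Z)].
Proof.
case: (classic (exists p : place iota, True)) => [[p0 _]|np]; last first.
  by exists 0%N => [[|p S]] // _ _; case: np; exists p.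
have [g0|g1] := posnP g.
  exists 1%N => S us; case: S us => // q S us _.
  have [D hD [hz h1 h2]] := genus0_derivation q g0.
  (* The pole of [t] is put at a point of S, where one order is gained instead of lost; the total is
     |S| - 2. *)
  exists (q :: S), D, (fun p => if p == q then -1 else 1); split; first by split.
  split.
  - by move=> p x; rewrite inE negb_or => /andP[pq _]; apply: h1.
  - move=> p b x _; have [->|pq] := eqVneq p q; first by rewrite opprK; apply: h2.
    move=> h; have he y : vge p 0 y -> vge p (- 0) (D y) by rewrite oppr0; apply: h1.
    by have := vge_der hD he h; rewrite addr0.
  move: us => /= /andP[qS _]; rewrite big_cons eqxx big_seq (eq_bigr (fun=> 1)).
    by rewrite -big_seq sum1_sizez g0 mul1r le_max; apply/orP; right; rewrite /=; lia.
  by move=> p pS; case: eqP => // pq; rewrite -pq pS in qS.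
have [pi vpi] := uniformizer_ex p0.
have [D hD [dpi _]] := local_derivation H vpi.
have [B uB hB] := fin_places_uniq (der_regular hD).
have bd p : exists e : nat, forall x, vge p 0 x -> vge p (- e%:Z) (D x).
  have [rho vrho] := uniformizer_ex p; exists (absz (pval p (D rho))) => x x0.
  by apply: vgeW (der_uniformizer hD vrho x0); lia.
have [e he] := boolp.choice bd.
pose c1 := (\sum_(p <- B) (1 + e p))%N.
exists c1.+1 => S us S0.
pose T := S ++ [seq p <- B | p \notin S].
(* One unit for differentiating a power of the uniformizer, plus the failure of integrality at bad
   places. *)
pose eps p : int := if p \in B then 1 + (e p)%:Z else 1.
have good p : p \notin B -> forall x, vge p 0 x -> vge p (- 0) (D x).
  by move=> pB; rewrite oppr0; apply: NNPP => /hB; rewrite (negbTE pB).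
exists T, D, eps; split.
  split=> //; last by exists pi; rewrite dpi oner_eq0.
    rewrite cat_uniq us filter_uniq // andbT; apply/hasPn => p; rewrite mem_filter.
    by case/andP.
  by move=> p pS; rewrite mem_cat pS.
split.
- move=> p x; rewrite mem_cat negb_or mem_filter => /andP[pS]; rewrite pS /= => pB.
  by have := good p pB x; rewrite oppr0.
- move=> p b x _ hx; rewrite /eps; case: (boolP (p \in B)) => pB.
    by have := vge_der hD (he p) hx.
  by have := vge_der hD (good p pB) hx; rewrite addr0.
have le1 : \sum_(p <- T) eps p <= (size S)%:Z + c1%:Z.
  rewrite -sum1_sizez big_cat /= big_filter.
  have S1 : \sum_(p <- S) eps p <= \sum_(p <- S) 1 + \sum_(p <- B | p \in S) (e p)%:Z.
    have -> : \sum_(p <- B | p \in S) (e p)%:Z = \sum_(p <- S | p \in B) (e p)%:Z.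
      rewrite -[LHS]big_filter -[RHS]big_filter; apply: perm_big; apply: uniq_perm; rewrite ?filter_uniq // => p.
      by rewrite !mem_filter andbC.
    rewrite [X in _ + X]big_mkcond -big_split; apply: ler_sum => p _ /=.
    by rewrite /eps; case: ifP => _; lia.
  have c1E : c1%:Z = \sum_(p <- B) (1 + (e p)%:Z).
    by rewrite /c1 -natz natr_sum; apply: eq_bigr => p _; rewrite natrD !natz.
  have S2 : \sum_(p <- B | p \notin S) eps p = \sum_(p <- B | p \notin S) (1 + (e p)%:Z).
    by rewrite big_seq_cond [RHS]big_seq_cond; apply: eq_bigr => p /andP[pB _]; rewrite /eps pB.
  have S3 : \sum_(p <- B | p \in S) (e p)%:Z <= \sum_(p <- B | p \in S) (1 + (e p)%:Z).
    by apply: ler_sum => p _; lia.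
  rewrite c1E S2 [X in _ <= _ + X](bigID (fun p => p \in S)) /=.
  by rewrite addrA lerD2r; apply: le_trans S1 _; rewrite lerD2l.
(* As the genus is positive and S nonempty, 2 genus - 2 + |S| is at least |S| and at least 1, which
   absorbs [c1]. *)
have s1 : (1 <= size S)%N by case: (S) S0.
apply: le_trans le1 _; rewrite max_r; last by lia.
by nia.
Qed.

End GlobalDerivation.

(** * Wronskians *)

Section Wronskian.
Variables (k : closedFieldType) (K : fieldType) (iota : {rmorphism k -> K}).
Variable D : K -> K.
Hypothesis HD : is_derivation iota D.
Hypothesis kerD : forall x, D x = 0 -> exists c, x = iota c.

Definition wronskian r (f : 'I_r -> K) : 'M[K]_r := \matrix_(i, j) iter i D (f j).

Lemma iter_der_sum n (I : finType) (c : I -> k) (f : I -> K) :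
  iter n D (\sum_i iota (c i) * f i) = \sum_i iota (c i) * iter n D (f i).
Proof.
elim: n => // n IH; rewrite iterS IH (der_sum HD).
by apply: eq_bigr => i _; rewrite (derCM HD).
Qed.

(** By induction the Wronskian of the first r functions is invertible. A kernel vector of the full
    one can then be scaled to last entry 1, and its entries turn out to be constants, which
    contradicts independence. *)
Lemma wronskian_neq0 r (f : 'I_r -> K) : k_indep iota f -> \det (wronskian f) != 0.
Proof.
elim: r f => [|r IH] f hf; first by rewrite det_mx00 oner_eq0.
pose f' (i : 'I_r) := f (widen_ord (leqnSn r) i).
have df' : \det (wronskian f')^T != 0 by rewrite det_tr; apply/IH/k_indep_lt.
have ker0 (u : 'I_r -> K) : (forall i : 'I_r, \sum_j u j * iter i D (f' j) = 0) -> forall j, u j = 0.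
  move=> hu j; apply/eqP/negPn/negP => uj; move/negP: df'; apply; apply/det0P.
  exists (\row_j u j); first by apply/rV0Pn; exists j; rewrite mxE.
  apply/rowP => i; rewrite !mxE -[RHS](hu i); apply: eq_bigr => l _.
  by rewrite !mxE.
apply/negP => d0; have /det0P[v v0 hv] : \det (wronskian f)^T == 0 by rewrite det_tr.
have rel (i : 'I_r.+1) : \sum_j v 0 j * iter i D (f j) = 0.
  have /rowP/(_ i) := hv; rewrite !mxE => h; rewrite -[RHS]h; apply: eq_bigr => j _.
  by rewrite !mxE.
have vm : v 0 ord_max != 0.
  apply: contraNneq v0 => vm; apply/eqP/rowP => j; rewrite mxE.
  have h := ker0 (fun j => v 0 (widen_ord (leqnSn r) j)) _.
  have [->//|jm] := eqVneq j ord_max.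
  have jr : (j < r)%N by rewrite ltn_neqAle -ltnS ltn_ord andbT.
  have -> : j = widen_ord (leqnSn r) (Ordinal jr) by apply: val_inj.
  apply: h => i; have := rel (widen_ord (leqnSn r) i).
  by rewrite big_ord_recr /= vm mul0r addr0.
pose c j := v 0 j / v 0 ord_max.
have crel (i : 'I_r.+1) : \sum_j c j * iter i D (f j) = 0.
  apply: (mulfI vm); rewrite mulr0 -[RHS](rel i) mulr_sumr; apply: eq_bigr => j _.
  by rewrite /c; field.
have cm : c ord_max = 1 by rewrite /c divff.
(* Differentiating row i and subtracting row i + 1 leaves a relation between the first r functions
   with coefficients [D (c j)]. *)
have dc (j : 'I_r) : D (c (widen_ord (leqnSn r) j)) = 0.
  apply: (ker0 (fun j => D (c (widen_ord (leqnSn r) j)))) => i.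
  have := congr1 D (crel (widen_ord (leqnSn r) i)); rewrite (der0 HD) (der_sum HD).
  under eq_bigr do rewrite (derM HD).
  rewrite big_split /= (crel (lift ord0 i)) addr0 big_ord_recr /= cm (der1 HD) mul0r addr0.
  by [].
have cst j : exists a, c j = iota a.
  apply: kerD; have [->|jm] := eqVneq j ord_max; first by rewrite cm (der1 HD).
  have jr : (j < r)%N by rewrite ltn_neqAle -ltnS ltn_ord andbT.
  by have := dc (Ordinal jr); congr (D (c _) = 0); apply: val_inj.
have [a ha] := boolp.choice cst.
have /hf/(_ ord_max) am : \sum_j iota (a j) * f j = 0.
  by rewrite -[RHS](crel ord0); apply: eq_bigr => j _; rewrite ha.
by have := cm; rewrite ha am rmorph0 => /esym/eqP; rewrite oner_eq0.
Qed.

Lemma wronskian_lin r (f : 'I_r -> K) (A : 'M[k]_r) :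
  \det (wronskian (fun i => \sum_j iota (A i j) * f j)) = iota (\det A) * \det (wronskian f).
Proof.
rewrite -det_map_mx -[\det (map_mx _ _)]det_tr mulrC -det_mulmx; congr (\det _).
apply/matrixP => i j; rewrite !mxE iter_der_sum; apply: eq_bigr => l _.
by rewrite !mxE mulrC.
Qed.

Lemma iter_derM g n : exists c : nat -> K, forall x,
  iter n D (g * x) = \sum_(l < n) c l * iter l D x + g * iter n D x.
Proof.
elim: n => [|n [c hc]]; first by exists (fun=> 0) => x; rewrite big_ord0 add0r.
exists (fun l => (if (l < n)%N then D (c l) else D g) + (if l is l'.+1 then c l' else 0)) => x.
rewrite iterS hc (derD HD) (der_sum HD) (derM HD).
under eq_bigr do rewrite (derM HD).
under [in RHS]eq_bigr do rewrite mulrDl.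
rewrite !big_split /= [X in _ = X + _ + _]big_ord_recr [X in _ = _ + X + _]big_ord_recl /= ltnn mul0r add0r.
rewrite [X in _ = X + _ + _ + _](eq_bigr (fun l : 'I_n => D (c l) * iter l D x)) => [|l _]; last by rewrite ltn_ord.
by rewrite -!addrA; congr (_ + _); rewrite addrCA !addrA.
Qed.

Lemma wronskian_scale r (f : 'I_r -> K) g :
  \det (wronskian (fun i => g * f i)) = g ^+ r * \det (wronskian f).
Proof.
have [c hc] := boolp.choice (iter_derM g).
(* By the Leibniz rule scaling multiplies the Wronskian matrix by a triangular one with [g] on the
   diagonal. *)
pose L : 'M[K]_r := \matrix_(i, l) (if (l < i)%N then c i l else if l == i then g else 0).
have -> : wronskian (fun i => g * f i) = L *m wronskian f.
  apply/matrixP => i j; rewrite !mxE hc.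
  rewrite [RHS](bigID (fun l : 'I_r => (l < i)%N)) /=; congr (_ + _).
    rewrite (big_ord_widen_cond r predT (fun l => c i l * iter l D (f j))); last exact: ltnW.
    by apply: eq_big => l //= li; rewrite !mxE li.
  rewrite (bigD1 i) /= ?ltnn // big1 ?addr0; first by rewrite !mxE ltnn eqxx.
  by move=> l /andP[nl li]; rewrite !mxE (negbTE nl) (negbTE li) mul0r.
rewrite det_mulmx det_trig; last first.
  apply/is_trig_mxP => i j ij; rewrite mxE ltnNge (ltnW ij) /=.
  by case: eqP => // e; rewrite e ltnn in ij.
by rewrite (eq_bigr (fun=> g)) ?prodr_const ?card_ord // => i _; rewrite mxE ltnn eqxx.
Qed.

Lemma vge_det p r (M : 'M[K]_r) (a b : 'I_r -> int) :
  (forall i j, vge (iota := iota) p (a i + b j) (M i j)) -> vge p (\sum_i a i + \sum_j b j) (\det M).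
Proof.
move=> h; apply: vge_sum => s _.
rewrite -(rmorph_sign iota); apply: vgeM0; first exact: vge_const.
have -> : \sum_i a i + \sum_j b j = \sum_i (a i + b (perm.fun_of_perm s i)).
  by rewrite big_split /= [X in _ + X = _](reindex_inj (@perm.perm_inj _ s)).
exact: vge_prod.
Qed.

(** The common power pi^mu is factored out before differentiating, so that [D] is applied to
    integral functions only and nothing is lost. *)
Lemma vge_wronskian_regular p r (f : 'I_r -> K) mu :
  (forall x, vge (iota := iota) p 0 x -> vge p 0 (D x)) -> (forall j, vge p mu (f j)) ->
  vge p (mu * r%:Z) (\det (wronskian f)).
Proof.
move=> hp hf; have [pi vpi] := uniformizer_ex p.
have pi0 : pi != 0 by apply: pval_pos_nz vpi.
have fE : wronskian f = wronskian (fun j => pi ^ mu * (f j / pi ^ mu)).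
  by apply/matrixP => i j; rewrite !mxE mulrC divfK ?expfz_neq0.
rewrite fE wronskian_scale -[mu * r%:Z]addr0; apply: vgeM.
  by rewrite /vge pvalX pvalXz vpi mul1r -mulr_natr natz lexx orbT.
suff: vge p (\sum_(i < r) 0 + \sum_(i < r) 0) (\det (wronskian (fun j => f j / pi ^ mu))).
  by rewrite !big1 // addr0.
apply: vge_det => i j; rewrite mxE addr0.
have : vge p 0 (f j / pi ^ mu).
  by rewrite -[0](subrr mu) -vge_div ?expfz_neq0 // pvalXz vpi mul1r.
by elim: (nat_of_ord i) => // n IH /IH; apply: hp.
Qed.

(** Row i has been differentiated i times and loses [e * i]; the losses add up to [e] times the
    binomial coefficient. *)
Lemma vge_wronskian p r (f : 'I_r -> K) (beta : 'I_r -> int) (e : int) :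
  (forall b x, vge (iota := iota) p b x -> vge p (b - e) (D x)) ->
  (forall j, vge p (beta j) (f j)) ->
  vge p (\sum_j beta j - e * 'C(r, 2)%:Z) (\det (wronskian f)).
Proof.
move=> hp hf.
have -> : \sum_j beta j - e * 'C(r, 2)%:Z = \sum_(i < r) (- (e * (i : nat)%:Z)) + \sum_j beta j.
  rewrite addrC sumrN -mulr_sumr; congr (- (_ * _) + _).
  by rewrite -bin2_sum big_mkord -natz natr_sum; apply: eq_bigr => i _; rewrite natz.
apply: vge_det => i j; rewrite mxE addrC.
elim: (nat_of_ord i) => [|n IH]; first by rewrite mulr0 subr0.
by apply: vgeW (hp _ _ IH); lia.
Qed.

End Wronskian.

Section Families.
Variables (k : closedFieldType) (K : fieldType) (iota : {rmorphism k -> K}).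

Definition kfree (I : finType) (f : I -> K) : Prop :=
  forall c : I -> k, \sum_i iota (c i) * f i = 0 -> forall i, c i = 0.

Definition kspan (I : finType) (f : I -> K) x : Prop :=
  exists c : I -> k, x = \sum_i iota (c i) * f i.

Lemma kfree_ord (I : finType) (f : I -> K) : kfree f ->
  k_indep iota (fun i : 'I_#|I| => f (enum_val i)).
Proof.
move=> hf c hc i; rewrite -[i]enum_valK; apply: (hf (fun x => c (enum_rank x))).
rewrite -[RHS]hc (reindex (@enum_val I predT)) /=; last exact: onW_bij (enum_val_bij I).
by apply: eq_bigr => j _; rewrite enum_valK.
Qed.

Lemma kspan_ord (I : finType) (f : I -> K) x : kspan f x ->
  exists c : 'I_#|I| -> k, x = \sum_i iota (c i) * f (enum_val i).
Proof.
case=> c ->; exists (fun i => c (enum_val i)).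
by rewrite (reindex (@enum_val I predT)) //=; apply: onW_bij (enum_val_bij I).
Qed.

Lemma sum_ord (V : nmodType) (I : finType) (F : I -> V) : \sum_i F i = \sum_(i < #|I|) F (enum_val i).
Proof. by rewrite (reindex (@enum_val I predT)) //=; apply: onW_bij (enum_val_bij I). Qed.

End Families.

(** * Local bounds for the Wronskian and their sum *)

Section WronskianInequality.
Variables (k : closedFieldType) (K : fieldType) (iota : {rmorphism k -> K}) (g : nat).
Hypothesis H : genus_field iota g.
Variables (D : K -> K) (T : seq (place iota)) (e : place iota -> int).
Hypothesis HD : is_derivation iota D.
Hypothesis Dnz : exists z, D z != 0.
Hypothesis uT : uniq T.
Hypothesis regT : forall (p : place iota) x, p \notin T -> vge p 0 x -> vge p 0 (D x).
Hypothesis lossT : forall (p : place iota) b x, p \in T -> vge p b x -> vge p (b - e p) (D x).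
Implicit Types (p : place iota).

(* [B] bounds from below the order at [p] of the Wronskian of [f], up to derivation losses:
   [h] is part of a basis of the k-span of [f] adapted to [p], the remaining basis
   elements being estimated by the uniform bound [mu]. *)
Definition adapted (I : finType) (f : I -> K) p (B : int) : Prop :=
  exists (J : finType) (h : J -> K) (beta : J -> int) (mu : int),
    [/\ kfree iota h, forall j, kspan iota f (h j), forall j, vge p (beta j) (h j),
        forall i, vge p mu (f i) & B = \sum_j beta j + (#|I|%:Z - #|J|%:Z) * mu]
    /\ (p \notin T -> #|J| = 0%N).

Definition wronskian_det (I : finType) (f : I -> K) : K :=
  \det (wronskian D (fun i : 'I_#|I| => f (enum_val i))).

(** The coordinate rows of the [h j], independent over k, are completed to an invertible matrix over
    k. Its determinant is a constant, of order 0, so the change of basis leaves the order of the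
    Wronskian unchanged. *)
Lemma adapted_wronskian (I : finType) (f : I -> K) p B : adapted f p B ->
  if p \in T then vge p (B - e p * 'C(#|I|, 2)%:Z) (wronskian_det f)
  else vge p B (wronskian_det f).
Proof.
case=> J [h [beta [mu [[hfree hspan hbeta hmu BE] hJ]]]]; rewrite /wronskian_det.
set W := \det _; set r := #|I| in BE W *; pose f' (i : 'I_r) := f (enum_val i).
case: ifPn => [pT|/[dup] pT /hJ J0]; last first.
  rewrite BE J0 subr0 (big1 _ _) ?add0r => [|j _]; last by have := card0_eq J0 j; rewrite !inE.
  by rewrite mulrC; apply: vge_wronskian_regular => // x; apply: regT.
set r0 := #|J| in BE.
have [A hA] : exists A : 'M[k]_(r0, r), forall j, h (enum_val j) = \sum_l iota (A j l) * f' l.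
  have [c hc] := boolp.choice (fun j : 'I_r0 => kspan_ord (hspan (enum_val j))).
  by exists (\matrix_(j, l) c j l) => j; rewrite hc; apply: eq_bigr => l _; rewrite mxE.
have hind := kfree_ord hfree.
have rfA : row_free A.
  suff h0 i : forall j, kermx A i j = 0.
    by rewrite -kermx_eq0; apply/eqP/matrixP => i j; rewrite h0 mxE.
  apply: hind.
  under eq_bigr do rewrite hA mulr_sumr.
  rewrite exchange_big big1 //= => l _.
  under eq_bigr do rewrite mulrA -rmorphM.
  rewrite -mulr_suml -rmorph_sum (_ : \sum_i _ = (kermx A *m A) i l).
    by rewrite mulmx_ker mxE rmorph0 mul0r.
  by rewrite [RHS]mxE.
pose A' := col_mx A (row_base (A^C)%MS).
have full : row_full A'.
  rewrite -sub1mx -addsmxE; apply: submx_trans (_ : (1%:M <= A + A^C)%MS) _.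
    by rewrite sub1mx addsmx_compl_full.
  by rewrite addsmxS // eq_row_base.
have rk : (r0 + \rank (A^C)%MS = r)%N.
  by rewrite mxrank_compl (eqP rfA) subnKC // -(eqP rfA) rank_leq_col.
pose beta' (i : 'I_(r0 + \rank (A^C)%MS)) := match split i with inl j => beta (enum_val j) | inr _ => mu end.
have hb' i : vge p (beta' i) (\sum_l iota (A' i l) * f' l).
  rewrite /beta' /A'; case: split_ordP => j ->.
    by under eq_bigr do rewrite col_mxEu; rewrite -hA; apply: hbeta.
  by apply: vge_sum => l _; apply: vgeM0; [apply: vge_const|apply: hmu].
have sb' : \sum_i beta' i = B.
  rewrite big_split_ord /= BE (sum_ord beta); congr (_ + _).
    by apply: eq_bigr => j _; rewrite /beta'; case: split_ordP => j' /eqP; rewrite eq_shift // => /eqP->.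
  rewrite (eq_bigr (fun=> mu)); last by move=> j _; rewrite /beta'; case: split_ordP => j' /eqP; rewrite eq_shift.
  by rewrite sumr_const card_ord -mulr_natl natz; congr (_ * _); have := rk; lia.
move: {hfree hspan hbeta BE hJ hA hind rfA} A' beta' full hb' sb'; rewrite rk => A' beta' full hb' <-.
have uA : A' \in unitmx by rewrite -row_full_unit.
have dA : iota (\det A') != 0 by rewrite fmorph_eq0 -unitfE -unitmxE.
have := vge_wronskian (fun b x => lossT (b := b) (x := x) pT) hb'.
rewrite (wronskian_lin HD).
have [->|W0] := eqVneq W 0; first by rewrite vge_0.
by rewrite !vgeE ?mulf_neq0 // pvalM // pval_const add0r.
Qed.

(** The Wronskian is nonzero, so its orders sum to 0 and only the derivation losses on [T]
    remain. *)
Lemma wronskian_inequality (I : finType) (f : I -> K) (B : place iota -> int) s :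
  kfree iota f -> (forall p, adapted f p (B p)) ->
  uniq s -> (forall p, B p <> 0 -> p \in s) ->
  \sum_(p <- s) B p <= (\sum_(p <- T) e p) * 'C(#|I|, 2)%:Z.
Proof.
move=> hf hB us hs; set c := 'C(_, 2)%:Z.
pose W := wronskian_det f.
have [z Dz] := Dnz.
have W0 : W != 0.
  apply: (wronskian_neq0 HD _ (kfree_ord hf)) => x.
  exact (der_ker H HD Dz).
have [u uu hu] := fin_places_uniq (fin_support H W).
pose v := undup (s ++ u ++ T).
have uv : uniq v := undup_uniq _.
have sum0 : \sum_(p <- v) pval p W = 0.
  by apply: (product_formula H W0) => // p /hu pu; rewrite mem_undup !mem_cat pu orbT.
have eB : \sum_(p <- s) B p = \sum_(p <- v) B p.
  by apply: sum_support => // p /hs ps; rewrite mem_undup mem_cat ps.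
have eT : (\sum_(p <- T) e p) * c = \sum_(p <- v) (if p \in T then e p * c else 0).
  rewrite mulr_suml big_seq (eq_bigr (fun p => if p \in T then e p * c else 0)); last by move=> p ->.
  rewrite -big_seq; apply: sum_support => // p; case: ifP => // pT _ //.
  by rewrite mem_undup !mem_cat pT !orbT.
rewrite eB eT -subr_ge0 -sumrB.
apply: (@le_trans _ _ (\sum_(p <- v) - pval p W)); first by rewrite sumrN sum0 oppr0.
apply: ler_sum => p _.
have := adapted_wronskian (hB p); rewrite -/W.
by case: ifP => _; rewrite vgeE //; lia.
Qed.

End WronskianInequality.

Lemma ex_minimal (A : Type) (P : A -> Prop) (m : A -> nat) : (exists x, P x) ->
  exists2 x, P x & forall y, P y -> (m x <= m y)%N.
Proof.
case=> x0 Px0; have [n] := ubnP (m x0); elim: n x0 Px0 => // n IH x Px; rewrite ltnS => mx.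
case: (classic (exists2 y, P y & (m y < m x)%N)) => [[y Py yx]|nex].
  by apply: IH Py _; apply: leq_trans mx.
by exists x => // y Py; rewrite leqNgt; apply/negP => h; apply: nex; exists y.
Qed.

Section Heights.
Variables (k : closedFieldType) (K : fieldType) (iota : {rmorphism k -> K}).
Implicit Types (p : place iota).

(** The value picked by [epsilon] is a sum over some support, and all supports give the same sum. *)
Lemma fsumnE (f : place iota -> nat) s : uniq s -> (forall p, f p <> 0%N -> p \in s) ->
  (fsumn f)%:Z = \sum_(p <- s) (f p)%:Z.
Proof.
move=> us hs.
have ex : exists N, exists s : seq (place iota),
    [/\ List.NoDup s, (forall p, f p <> 0%N -> List.In p s) & N = (\sum_(p <- s) f p)%N].
  exists (\sum_(p <- s) f p)%N, s; split=> //; first exact/List_NoDupP.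
  by move=> p /hs/List_InP.
rewrite /fsumn; have [u [/List_NoDupP uu hu ->]] := epsilon_spec (inhabits 0%N) _ ex.
rewrite -natz natr_sum (eq_bigr (fun p => (f p)%:Z)) => [|p _]; last by rewrite natz.
by apply: sum_support => // p h; [apply/List_InP/hu|apply: hs]; lia.
Qed.

Lemma htE x s : uniq s -> (forall p, pval p x <> 0 -> p \in s) ->
  (ht iota x)%:Z = \sum_(p <- s) Num.max 0 (- pval p x).
Proof.
move=> us hs; rewrite (fsumnE us) => [|p h].
  by apply: eq_bigr => p _; lia.
by apply: hs; lia.
Qed.

End Heights.

(** * Linear relations between S-units *)

Section SUnitRelation.
Variables (k : closedFieldType) (K : fieldType) (iota : {rmorphism k -> K}) (g : nat).
Hypothesis H : genus_field iota g.
Variables (D : K -> K) (T : seq (place iota)) (e : place iota -> int).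
Hypothesis HD : is_derivation iota D.
Hypothesis Dnz : exists z, D z != 0.
Hypothesis uT : uniq T.
Hypothesis regT : forall (p : place iota) x, p \notin T -> vge p 0 x -> vge p 0 (D x).
Hypothesis lossT : forall (p : place iota) b x, p \in T -> vge p b x -> vge p (b - e p) (D x).
Implicit Types (p : place iota).

Lemma kfreeS (I : finType) (A : {set I}) (f : I -> K) :
  (forall c : I -> k, (forall i, i \notin A -> c i = 0) ->
     \sum_i iota (c i) * f i = 0 -> forall i, c i = 0) ->
  kfree iota (fun i : {i | i \in A} => f (val i)).
Proof.
move=> h c hc i.
pose c' j := if insub j is Some j' then c j' else 0.
have cE (j : {i | i \in A}) : c' (val j) = c j by rewrite /c' valK.
rewrite -cE; apply: h => [j jA|]; first by rewrite /c' insubF //; apply/negbTE.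
rewrite (bigID (fun j => j \in A)) /= [X in _ + X]big1 ?addr0 => [|j jA]; last first.
  by rewrite /c' insubF ?rmorph0 ?mul0r //; apply/negbTE.
rewrite (reindex_omap (val : {i | i \in A} -> I) insub) /=; last by move=> j jA; rewrite insubT.
rewrite -[RHS]hc; apply: eq_big => [j|j _]; last by rewrite cE.
by rewrite valK eqxx (valP j).
Qed.

Lemma kfree_neq0 (I : finType) (f : I -> K) i : kfree iota f -> f i != 0.
Proof.
move=> hf; apply/eqP => fi; have := hf (fun j => if j == i then 1 else 0) _ i.
rewrite eqxx => h; have /eqP : (1 : k) = 0; last by rewrite oner_eq0.
apply: h; rewrite big1 // => j _; case: eqP => [->|_]; first by rewrite fi mulr0.
by rewrite rmorph0 mul0r.
Qed.

Lemma kspan_mem (I : finType) (f : I -> K) i : kspan iota f (f i).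
Proof.
exists (fun j => if j == i then 1 else 0).
rewrite (bigD1 i) //= eqxx rmorph1 mul1r big1 ?addr0 // => j /negbTE->.
by rewrite rmorph0 mul0r.
Qed.

Lemma kfree_replace (I : finType) (f : I -> K) i0 x (c : I -> k) : kfree iota f ->
  x = \sum_i iota (c i) * f i -> c i0 != 0 -> kfree iota (fun i => if i == i0 then x else f i).
Proof.
move=> hf xE c0 d hd.
have rel : \sum_i iota (d i0 * c i + (if i == i0 then 0 else d i)) * f i = 0.
  rewrite -[RHS]hd [RHS](bigD1 i0) //= eqxx xE mulr_sumr.
  under eq_bigr do rewrite rmorphD mulrDl rmorphM -mulrA.
  rewrite big_split /=; congr (_ + _); rewrite (bigD1 i0) //= eqxx rmorph0 mul0r add0r.
  by apply: eq_bigr => i /negbTE->.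
have d0 : d i0 = 0.
  by have /eqP := hf _ rel i0; rewrite eqxx addr0 mulf_eq0 (negbTE c0) orbF => /eqP.
by move=> i; have [->//|ii] := eqVneq i i0; have := hf _ rel i; rewrite d0 mul0r add0r (negbTE ii).
Qed.

(** Uses an empty set of adapted elements, and therefore holds off [T] as well. *)
Lemma adapted_regular (I : finType) (f : I -> K) p mu : (forall i, vge p mu (f i)) ->
  adapted T f p (#|I|%:Z * mu).
Proof.
move=> h; exists void, (fun _ => 0), (fun _ => 0), mu; split; last by rewrite card_void.
split; [by move=> c _ []|by case|by case|by []|].
by rewrite card_void subr0 big1 ?add0r // => -[].
Qed.

Lemma adapted_full (I : finType) (f h : I -> K) (beta : I -> int) p : p \in T ->
  kfree iota h -> (forall i, kspan iota f (h i)) -> (forall i, f i != 0) ->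
  (forall i, vge p (beta i) (h i)) -> adapted T f p (\sum_i beta i).
Proof.
move=> pT fh hs fnz hb.
(* The uniform bound is multiplied by #|I| - #|I| = 0, so a crude one will do. *)
exists I, h, beta, (- \sum_i `|pval p (f i)|); split; last by rewrite pT.
split=> // [i|]; last by rewrite subrr mul0r addr0.
rewrite vgeE // (bigD1 i) //= -lerN2 opprK; apply: (le_trans (ler_norm _)).
by rewrite normrN lerDl sumr_ge0.
Qed.

Lemma arith_min1 (s m x : int) : 0 <= x -> - m <= s - m - s + x.
Proof. lia. Qed.

Lemma arith_min2 (n N c : nat) (s m : int) : (n < N)%N -> - c%:Z <= m -> s <= n.+1%:Z * c%:Z ->
  - m <= n%:Z * m - s + (2 * N)%N%:Z * c%:Z.
Proof.
move=> nN h1 h3.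
nia.
Qed.

Lemma arith_min3 (a0 a1 b0 b1 m c : int) : m <= a0 + b0 -> m <= a1 + b1 ->
  `|a0| <= c -> `|a1| <= c -> Num.max 0 (- (b0 - b1)) <= a1 + b1 - m + 2 * c.
Proof. lia. Qed.

(* Among the k-relations between the products es_l u_i in which some u_i has a nonzero coefficient,
   take one with the fewest terms: removing a term leaves a k-free family. *)
Lemma unit_relation (S : seq (place iota)) (Q E : finType) (es : Q -> K) (u : E -> K) (ga : E -> K)
    (C : place iota -> nat) sC (M : int) :
  {subset S <= T} -> \sum_(p <- T) e p <= M -> 0 <= M ->
  (forall i, u i != 0) -> (forall i p, p \notin S -> pval p (u i) = 0) ->
  (forall l p, `|pval p (es l)| <= (C p)%:Z) -> uniq sC -> (forall p, C p <> 0%N -> p \in sC) ->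
  (forall i, kspan iota es (ga i)) -> (exists i, ga i != 0) -> \sum_i ga i * u i = 0 ->
  exists i j, i != j /\
    (ht iota (u i / u j))%:Z <= M * 'C(#|{: Q * E}|, 2)%:Z
      + (2 * #|{: Q * E}| + 4)%N%:Z * \sum_(p <- sC) (C p)%:Z.
Proof.
move=> ST eM M0 u0 uS esC usC hsC hga exga rel.
pose F (a : Q * E) := es a.1 * u a.2.
pose gam (c : {ffun Q * E -> k}) i := \sum_l iota (c (l, i)) * es l.
pose P (c : {ffun Q * E -> k}) := \sum_a iota (c a) * F a = 0 /\ exists i, gam c i != 0.
have sumF (c : {ffun Q * E -> k}) : \sum_a iota (c a) * F a = \sum_i gam c i * u i.
  rewrite (eq_bigr (fun a => (fun l i => iota (c (l, i)) * es l * u i) a.1 a.2)) => [|[l i] _]; last first.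
    by rewrite /F /= mulrA.
  by rewrite -(pair_bigA _ (fun l i => iota (c (l, i)) * es l * u i)) exchange_big /=; apply: eq_bigr => i _; rewrite mulr_suml.
pose supp (c : {ffun Q * E -> k}) := [set a | c a != 0].
have [c [cP [i0 gi0]] cmin] : exists2 c, P c & forall d, P d -> (#|supp c| <= #|supp d|)%N.
  apply: ex_minimal; have [c hc] := boolp.choice hga.
  have gE i : gam [ffun a => c a.2 a.1] i = ga i.
    by rewrite hc; apply: eq_bigr => l _; rewrite ffunE.
  exists [ffun a => c a.2 a.1]; split.
    by rewrite sumF -[RHS]rel; apply: eq_bigr => i _; rewrite gE.
  by case: exga => i hi; exists i; rewrite gE.
pose sig := supp c.
have term i : gam c i != 0 -> exists l, c (l, i) != 0 /\ es l != 0.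
  move=> gi; apply: NNPP => nex; move/negP: gi; apply; apply/eqP; apply: big1 => l _.
  have [->|cl] := eqVneq (c (l, i)) 0; first by rewrite rmorph0 mul0r.
  have [->|el] := eqVneq (es l) 0; first by rewrite mulr0.
  by case: nex; exists l.
have [l0 [ca0 el0]] := term _ gi0; pose a0 := (l0, i0).
(* The [u i] are nonzero, so a relation cannot involve just one of them. *)
have [i1 [i10 gi1]] : exists i1, i1 != i0 /\ gam c i1 != 0.
  apply: NNPP => nex; move/eqP: cP; rewrite sumF (bigD1 i0) //= big1 ?addr0 => [|i ii].
    by rewrite mulf_eq0 (negbTE gi0) (negbTE (u0 _)).
  by apply/eqP; rewrite mulf_eq0 (negbTE (u0 _)) orbF; apply/negPn/negP => h; apply: nex; exists i.
have [l1 [ca1 el1]] := term _ gi1; pose a1 := (l1, i1).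
have Fa0 : F a0 != 0 by rewrite mulf_neq0.
(* A relation [d] among the remaining terms contradicts the minimality of [c], either by itself or
   after being subtracted from [c]. *)
have free : kfree iota (fun a : {a | a \in sig :\ a0} => F (val a)).
  apply: kfreeS => d dout drel.
  apply: NNPP => /not_all_ex_not[b /eqP db].
  have bs : b \in sig :\ a0 by apply/negPn/negP => /dout /eqP; rewrite (negbTE db).
  have dsig a : d a != 0 -> a \in sig :\ a0 by move=> da; apply/negPn/negP => /dout /eqP; rewrite (negbTE da).
  have lt (d' : {ffun Q * E -> k}) b' : P d' -> b' \in sig -> d' b' = 0 ->
      (forall a, d' a != 0 -> a \in sig) -> False.
    move=> Pd' bs' db' h; have := cmin _ Pd'; rewrite leqNgt => /negP; apply.
    apply: proper_card; apply/properP; split; first by apply/subsetP => a; rewrite inE => /h.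
    by exists b' => //; rewrite inE db' eqxx.
  case: (classic (exists i, gam (finfun d) i != 0)) => [exi|nexi].
    apply: (lt (finfun d) a0); rewrite ?inE //.
    - by split=> //; rewrite -[RHS]drel; apply: eq_bigr => a _; rewrite ffunE.
    - by rewrite ffunE; apply: dout; rewrite !inE eqxx.
    by move=> a; rewrite ffunE => /dsig; rewrite !inE => /andP[].
  have gd i : gam (finfun d) i = 0 by apply/eqP/negPn/negP => h; apply: nexi; exists i.
  (* Here every coefficient [gam] of [d] vanishes, so the subtraction removes the term [b] without
     changing the coefficients of the [u i]. *)
  pose t := c b / d b; pose d' := [ffun a => c a - t * d a].
  apply: (lt d' b); last 1 first.
  - move=> a; rewrite ffunE inE; apply: contraNneq => ca.
    rewrite ca sub0r oppr_eq0 mulf_eq0; apply/orP; right; apply/negPn/negP => /dsig.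
    by rewrite !inE ca eqxx andbF.
  - split.
      have -> : \sum_a iota (d' a) * F a = \sum_a iota (c a) * F a - iota t * \sum_a iota (d a) * F a.
        by rewrite mulr_sumr -sumrB; apply: eq_bigr => a _; rewrite ffunE rmorphB rmorphM mulrBl mulrA.
      by rewrite cP drel mulr0 subr0.
    exists i0; have -> : gam d' i0 = gam c i0 - iota t * gam (finfun d) i0.
      by rewrite mulr_sumr -sumrB; apply: eq_bigr => l _; rewrite !ffunE rmorphB rmorphM mulrBl mulrA.
    by rewrite gd mulr0 subr0.
  - by move: bs; rewrite !inE => /andP[].
  by rewrite ffunE /t divfK // subrr.
pose I := {a | a \in sig :\ a0}; pose f (a : I) := F (val a).
have fnz (a : I) : f a != 0 by apply: kfree_neq0 a free.
have Fnz a : a \in sig -> F a != 0.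
  move=> asig; have [->//|aa] := eqVneq a a0.
  have ai : a \in sig :\ a0 by rewrite in_setD1 aa.
  exact: (fnz (exist _ a ai)).
have a0s : a0 \in sig by rewrite inE.
have a1s : a1 \in sig by rewrite inE.
pose am p := [arg min_(a < a0 | a \in sig) (pval p (F a))]%O.
pose mp p : int := pval p (F (am p)).
have ams p : am p \in sig by rewrite /am; case: arg_minP.
have mpmin p a : a \in sig -> mp p <= pval p (F a) by rewrite /mp /am; case: arg_minP => // b _ h /h.
pose Sg p := \sum_(a in sig) pval p (F a).
have sumI (G : Q * E -> int) : \sum_(a : I) G (val a) = \sum_(a in sig | a != a0) G a.
  rewrite [RHS](reindex_omap (val : I -> _) insub) /=; last by move=> a /andP[a2 a3]; rewrite insubT // in_setD1 a3.
  by apply: eq_bigl => a; rewrite valK eqxx andbT; have := valP a; rewrite in_setD1 andbC => ->.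
have cI : #|{: I}|.+1 = #|sig|.
  by rewrite card_sig (cardsD1 a0 sig) a0s add1n; congr _.+1; apply: eq_card => a; rewrite !inE.
have SgI p : Sg p = pval p (F a0) + \sum_(a : I) pval p (f a).
  by rewrite /Sg (bigD1 a0) //= (sumI (fun a => pval p (F a))).
have Fspan : F a0 = \sum_(a : I) iota (- (c (val a) / c a0)) * f a.
  have ca0' : iota (c a0) != 0 by rewrite fmorph_eq0.
  apply: (mulfI ca0'); move: cP; rewrite (bigD1 a0) //= => /eqP.
  rewrite addr_eq0 => /eqP->; rewrite mulr_sumr.
  rewrite (bigID (fun a => a \in sig)) /= [X in _ + X]big1 ?addr0 => [|a /andP[_]]; last first.
    by rewrite inE negbK => /eqP->; rewrite rmorph0 mul0r.
  rewrite [in LHS](reindex_omap (val : I -> _) insub) /=; last by move=> a /andP[a2 a3]; rewrite insubT // in_setD1 a2 a3.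
  rewrite -sumrN; apply: eq_big => [a|a _].
    by rewrite valK eqxx andbT; have := valP a; rewrite in_setD1.
  by rewrite /f rmorphN rmorphM fmorphV /=; field.
(* At p in [T] the term of least order is exchanged for [F a0], which the relation puts in the span
   of the others; the orders of the terms kept add up to [Sg p - mp p]. *)
pose B p : int := if p \in T then Sg p - mp p else #|{: I}|%:Z * mp p.
have hB p : adapted T f p (B p).
  rewrite /B; case: ifPn => pT; last first.
    by apply: adapted_regular => a; rewrite vgeE //; apply: mpmin; have := valP a; rewrite in_setD1 => /andP[].
  have [ama|ama] := eqVneq (am p) a0.
    have -> : Sg p - mp p = \sum_(a : I) pval p (f a) by rewrite SgI /mp ama; ring.
    apply: (adapted_full pT free) => // a; first exact: kspan_mem.
    exact: vge_pval.
  have ai : am p \in sig :\ a0 by rewrite in_setD1 ama ams.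
  pose ap : I := exist _ (am p) ai.
  have ca : - (c (val ap) / c a0) != 0.
    by rewrite oppr_eq0 mulf_neq0 ?invr_eq0 //; have := ams p; rewrite inE.
  have -> : Sg p - mp p = \sum_(a : I) pval p (if a == ap then F a0 else f a).
    rewrite SgI /mp (bigD1 ap) //= [in RHS](bigD1 ap) //= eqxx.
    rewrite [in RHS](eq_bigr (fun a => pval p (f a))) => [|a /negbTE->//].
    by rewrite /f /=; ring.
  apply: (adapted_full pT (kfree_replace free Fspan ca)) => // a; last exact: vge_pval.
  case: eqP => _; last exact: kspan_mem.
  by eexists; exact: Fspan.
have [sF hsF] : exists s : seq (place iota), forall a p, pval p (F a) <> 0 -> p \in s.
  have [s hs] := boolp.choice (fun a => fin_support H (F a)).
  exists (flatten [seq s a | a <- enum {: Q * E}]) => a p /hs ps.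
  by apply/flatten_mapP; exists a; rewrite ?mem_enum.
pose s := undup (sF ++ sC ++ T).
have us : uniq s := undup_uniq _.
have sF0 a : a \in sig -> \sum_(p <- s) pval p (F a) = 0.
  move=> asig; apply: (product_formula H (Fnz _ asig) us) => p /hsF.
  by rewrite mem_undup mem_cat => ->.
have hBs p : B p <> 0 -> p \in s.
  have [//|ps] := boolP (p \in s).
  have v0 a : pval p (F a) = 0 by apply/eqP/negPn/negP => /eqP/hsF; move: ps; rewrite mem_undup mem_cat negb_or => /andP[/negbTE->].
  by rewrite /B /mp /Sg v0 big1 ?subr0 ?mulr0 //; case: ifP.
have ineq := wronskian_inequality H HD Dnz uT regT lossT free hB us hBs.
have CsumE : \sum_(p <- sC) (C p)%:Z = \sum_(p <- s) (C p)%:Z.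
  have Cnz p : (C p)%:Z <> 0 -> p \in sC by move=> h; apply: hsC => h'; apply: h; rewrite h'.
  by apply: sum_support => // p /Cnz ps; rewrite mem_undup !mem_cat ps orbT.
set N := #|{: Q * E}|; rewrite CsumE; set Cs := \sum_(p <- s) (C p)%:Z.
have Cs0 : 0 <= Cs by apply: sumr_ge0.
have NI : (#|{: I}| < N)%N by rewrite cI max_card.
(* On [T] this is immediate from the choice of [B]; elsewhere the [u i] are units and all orders are
   bounded by [C p]. *)
have pw p : - mp p <= (B p - Sg p) + (2 * N)%N%:Z * (C p)%:Z.
  rewrite /B; case: ifPn => pT; first exact: arith_min1.
  have pS : p \notin S by apply: contra pT => /ST.
  have vF a : a \in sig -> - (C p)%:Z <= pval p (F a) <= (C p)%:Z.
    move=> asig; have := Fnz _ asig; rewrite /F mulf_eq0 negb_or => /andP[h1 h2].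
    by rewrite pvalM // (uS _ _ pS) addr0; rewrite -ler_norml; apply: esC.
  have : Sg p <= #|sig|%:Z * (C p)%:Z.
    rewrite /Sg; apply: (@le_trans _ _ (\sum_(a in sig) (C p)%:Z)).
      by apply: ler_sum => a /vF /andP[].
    by rewrite sumr_const -mulr_natl natz.
  have /vF/andP[h1 _] := ams p; rewrite -cI => h3.
  exact: arith_min2 NI h1 h3.
have summ : \sum_(p <- s) - mp p <= M * 'C(N, 2)%:Z + (2 * N)%N%:Z * Cs.
  apply: (@le_trans _ _ (\sum_(p <- s) ((B p - Sg p) + (2 * N)%N%:Z * (C p)%:Z))).
    by apply: ler_sum => p _; apply: pw.
  rewrite big_split /= -mulr_sumr lerD2r sumrB.
  have -> : \sum_(p <- s) Sg p = 0 by rewrite exchange_big big1 //= => a; apply: sF0.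
  rewrite subr0; apply: le_trans ineq _.
  apply: (@le_trans _ _ (M * 'C(#|{: I}|, 2)%:Z)); first by apply: ler_wpM2r.
  by apply: ler_wpM2l => //; rewrite lez_nat leq_bin2l // ltnW.
exists i0, i1; split; first by rewrite eq_sym.
rewrite (htE us) => [|p]; last first.
  rewrite pvalM ?invr_eq0 // pvalV => h.
  apply/negPn/negP => ps; apply: h.
  move: ps; rewrite mem_undup !mem_cat !negb_or => /and3P[_ _ pT].
  have pS : p \notin S by apply: contra pT => /ST.
  by rewrite !uS.
(* Up to the orders of the coefficients, a pole of [u i0 / u i1] is bounded by the gap between the
   order of [F a1] and the least order. The orders of [F a1] sum to 0. *)
apply: (@le_trans _ _ (\sum_(p <- s) ((pval p (F a1) - mp p) + 2 * (C p)%:Z))).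
  apply: ler_sum => p _; rewrite pvalM ?invr_eq0 // pvalV.
  have h0 := mpmin p _ a0s; have h1 := mpmin p _ a1s.
  rewrite {1}/F pvalM //=; apply: (arith_min3 _ _ (esC l0 p) (esC l1 p)).
    by move: h0; rewrite /F pvalM.
  by move: h1; rewrite /F pvalM.
rewrite big_split /= -mulr_sumr sumrB sF0 // sub0r -sumrN.
have -> : (2 * N + 4)%N%:Z * Cs = (2 * N)%N%:Z * Cs + 4 * Cs by rewrite PoszD mulrDl.
rewrite addrA; apply: lerD => //; rewrite -/Cs.
by apply: ler_wpM2r.
Qed.

End SUnitRelation.

(** * Greatest common divisors of polynomials *)

Definition divides (A : idomainType) (a b : A) : Prop := exists c, b = c * a.

Definition is_gcd (A : idomainType) (d a b : A) : Prop :=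
  [/\ divides d a, divides d b & forall c, divides c a -> divides c b -> divides c d].

Definition gcd_domain (A : idomainType) : Prop := forall a b : A, exists d, is_gcd d a b.

Lemma divides_refl (A : idomainType) (a : A) : divides a a.
Proof. by exists 1; rewrite mul1r. Qed.

Lemma divides_trans (A : idomainType) (b a c : A) : divides a b -> divides b c -> divides a c.
Proof. by case=> x -> [y ->]; exists (y * x); rewrite mulrA. Qed.

Lemma divides0 (A : idomainType) (a : A) : divides a 0.
Proof. by exists 0; rewrite mul0r. Qed.

Lemma dividesMl (A : idomainType) (c a b : A) : divides a b -> divides a (c * b).
Proof. by case=> x ->; exists (c * x); rewrite mulrA. Qed.

Lemma dividesD (A : idomainType) (a b c : A) : divides a b -> divides a c -> divides a (b + c).
Proof. by case=> x -> [y ->]; exists (x + y); rewrite mulrDl. Qed.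

Lemma dividesM2 (A : idomainType) (a b c d : A) : divides a b -> divides c d -> divides (a * c) (b * d).
Proof. by case=> x -> [y ->]; exists (x * y); ring. Qed.

Lemma dividesMK (A : idomainType) (c a b : A) : c != 0 -> divides (c * a) (c * b) -> divides a b.
Proof. by move=> c0 [x e]; exists x; apply: (mulfI c0); rewrite e; ring. Qed.

Section GcdDomain.
Variable R : idomainType.
Implicit Types (a b c d : R).

Hypothesis GR : gcd_domain R.

Lemma gcd_mul c d a b : is_gcd d a b -> is_gcd (c * d) (c * a) (c * b).
Proof.
have [->|c0] := eqVneq c 0; first by rewrite !mul0r; split=> // *; apply: divides0 || apply: divides_refl.
case=> da db dmax; split; [exact: dividesM2 (divides_refl c) da|exact: dividesM2 (divides_refl c) db|].
have [e [ea eb emax]] := GR (c * a) (c * b).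
have [e' ee] : divides c e by apply: emax; rewrite mulrC; apply: dividesMl; apply: divides_refl.
move=> x xa xb; apply: divides_trans (emax x xa xb) _.
rewrite ee mulrC; apply: dividesM2; first exact: divides_refl.
by apply: dmax; apply: (dividesMK c0); rewrite [c * e']mulrC -ee.
Qed.

(** If 1 is a gcd of [a] and [b], then [c] is a gcd of [c a] and [c b], and [a] divides both. *)
Lemma gcd_euclid a b c : (forall d, divides d a -> divides d b -> divides d 1) ->
  divides a (b * c) -> divides a c.
Proof.
move=> cop h; have /(gcd_mul c)[_ _ mx] : is_gcd 1 a b.
  by split=> //; [exists a|exists b]; rewrite mulr1.
rewrite -[c]mulr1; apply: mx; first by apply: dividesMl; apply: divides_refl.
by rewrite mulrC.
Qed.

Definition primitive (f : {poly R}) : Prop := forall c, divides c%:P f -> divides c 1.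

Lemma dividesC c (f : {poly R}) : divides c%:P f <-> forall i, divides c f`_i.
Proof.
split=> [[q ->] i|h]; first by exists q`_i; rewrite coefMC.
have [q hq] := boolp.choice h; exists (\poly_(i < size f) q i).
apply/polyP => i; rewrite coefMC coef_poly; case: ltnP => [_|si]; first exact: hq.
by rewrite mul0r nth_default.
Qed.

Lemma content_ex (f : {poly R}) : exists c f1, f = c%:P * f1 /\ primitive f1.
Proof.
have [->|f0] := eqVneq f 0.
  by exists 0, 1; rewrite mul0r; split=> // c /dividesC/(_ 0%N); rewrite coefC.
have [d [df dmax]] : exists d, (forall i, divides d f`_i) /\
    forall c, (forall i, divides c f`_i) -> divides c d.
  elim: (polyseq f) => [|a s [d [h1 h2]]].
    by exists 0; split=> [i|c _]; rewrite ?nth_nil; apply: divides0.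
  have [e [ea ed emax]] := GR a d; exists e; split.
    by case=> [|i] //=; apply: divides_trans ed (h1 i).
  by move=> c hc; apply: emax; [exact: (hc 0%N)|apply: h2 => i; exact: (hc i.+1)].
have /dividesC[q fE] := df; exists d, q; split; first by rewrite mulrC.
have d0 : d != 0 by apply: contraNneq f0 => e; rewrite fE e mulr0.
move=> c [r qE]; apply: (dividesMK d0); rewrite mulr1; apply: dmax => i.
by exists r`_i; rewrite fE qE !coefMC; ring.
Qed.

(** After division by a gcd of [d] and [e], the cofactor of [d] divides every coefficient of [h] by
    [gcd_euclid], hence divides 1. *)
Lemma primitive_scale d e (h : {poly R}) : primitive h -> divides d%:P (e%:P * h) -> divides d e.
Proof.
move=> ph /dividesC hd; have [e0|e0] := eqVneq e 0; first by rewrite e0; apply: divides0.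
have [x [[d1 dE] [e1 eE] xmax]] := GR d e.
have x0 : x != 0 by apply: contraNneq e0 => xx; rewrite eE xx mulr0.
have cop c : divides c d1 -> divides c e1 -> divides c 1.
  move=> c1 c2; apply: (dividesMK x0); rewrite mulr1.
  apply: xmax; rewrite ?dE ?eE [_ * x]mulrC; apply: dividesM2 => //; exact: divides_refl.
have /ph d11 : divides d1%:P h.
  apply/dividesC => i; apply: (gcd_euclid cop); apply: (dividesMK x0).
  by have := hd i; rewrite coefCM dE eE; congr divides; ring.
rewrite eE dE; apply: dividesM2 (divides_refl x).
by apply: divides_trans d11 _; exists e1; rewrite mulr1.
Qed.

(** Without prime elements, the argument goes by induction on sizes: a constant dividing [f g] is
    coprime to both leading coefficients, yet divides their product. *)
Lemma gauss (f g : {poly R}) : primitive f -> primitive g -> primitive (f * g).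
Proof.
have [n] := ubnP (size f + size g)%N; elim: n => // n IH in f g *; rewrite ltnS => sz pf pg.
have half (f' g' : {poly R}) c : f' * g' = f * g -> (size f' + size g' <= n)%N -> primitive f' -> primitive g' ->
    divides c%:P (f * g) -> forall d, divides d c -> divides d (lead_coef f') -> divides d 1.
  move=> <- {sz pf pg}sz pf pg hc d dc da; apply: pf.
  have [f0|f0] := eqVneq f' 0; first by rewrite f0; apply: divides0.
  (* A common divisor of the constant and of the leading coefficient divides [f2 * g']; the
     induction applied to the primitive part of [f2] makes it divide [f2], hence [f']. *)
  pose a := lead_coef f'; pose f2 := f' - a%:P * 'X^((size f').-1).
  have sf2 : (size f2 < size f')%N.
    have sf : (0 < size f')%N by rewrite lt0n size_poly_eq0.
    have : (size f2 <= (size f').-1)%N; last by move=> h; rewrite -(ltnS) (prednK sf) in h.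
    apply/leq_sizeP => j; rewrite leq_eqVlt /f2 coefB coefCM coefXn => /orP[/eqP <-|jl].
      by rewrite eqxx mulr1 subrr.
    by rewrite gtn_eqF // mulr0 subr0 nth_default // -(prednK sf).
  have dX : divides d%:P (a%:P * 'X^((size f').-1)).
    rewrite mulrC; apply: dividesMl; case: da => x e; exists x%:P.
    by rewrite /a e polyCM.
  have fE : f' = f2 + a%:P * 'X^((size f').-1) by rewrite subrK.
  rewrite fE; apply: dividesD => //.
  have [e [f3 [f2E pf3]]] := content_ex f2.
  have [e0|e0] := eqVneq e 0; first by rewrite f2E e0 mul0r; apply: divides0.
  have sf3 : size f3 = size f2 by rewrite f2E size_Cmul.
  have /primitive_scale de : primitive (f3 * g').
    by apply: IH => //; rewrite sf3; apply: leq_trans sz; rewrite -addSn leq_add2r.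
  have {}de : divides d e.
    apply: de; rewrite mulrA -f2E.
    have -> : f2 * g' = f' * g' + - ('X^((size f').-1) * g') * a%:P by rewrite /f2; ring.
    apply: dividesD; first by apply: divides_trans hc; case: dc => x ->; exists x%:P; rewrite polyCM.
    by apply: dividesMl; case: da => x ex; exists x%:P; rewrite /a ex polyCM.
  by rewrite f2E mulrC; apply: dividesMl; case: de => x ->; exists x%:P; rewrite polyCM.
move=> c hc.
have cop := half f g c erefl sz pf pg hc.
have cop' := half g f c (mulrC g f) (_ : (size g + size f <= n)%N) pg pf hc.
apply: cop'; rewrite 1?addnC //; first exact: divides_refl.
apply: (gcd_euclid cop); rewrite -lead_coefM.
by have /dividesC/(_ (size (f * g)).-1) := hc.
Qed.

(** The constant multiplying [f] in the pseudo-division divides the content of the quotient, by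
    Gauss, and cancels. *)
Lemma primitive_dvdp (h f : {poly R}) : primitive h -> h %| f -> divides h f.
Proof.
move=> ph /Pdiv.Idomain.dvdpP[[c q] /= c0 e].
have [a [q1 [qE pq]]] := content_ex q.
have [a' aE] : divides c a.
  apply: (primitive_scale (gauss pq ph)); rewrite mulrA -qE -e -mul_polyC mulrC.
  by exists f.
exists (a'%:P * q1); apply: (mulfI (_ : c%:P != 0)); first by rewrite polyC_eq0.
by rewrite [LHS]mul_polyC e qE aE polyCM; ring.
Qed.

Lemma divides_dvdp (h f : {poly R}) : divides h f -> h %| f.
Proof. by case=> q ->; apply: Pdiv.Idomain.dvdp_mulIr. Qed.

(** The gcd is a gcd of the contents times the primitive part of [gcdp], the gcd up to constants. *)
Lemma gcd_domain_poly : gcd_domain {poly R}.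
Proof.
move=> f g.
have [->|f0] := eqVneq f 0; first by exists g; split=> //; [apply: divides0|apply: divides_refl].
have [->|g0] := eqVneq g 0; first by exists f; split=> //; [apply: divides_refl|apply: divides0].
have [c [f1 [fE pf]]] := content_ex f; have [c' [g1 [gE pg]]] := content_ex g.
have c0 : c != 0 by apply: contraNneq f0 => e; rewrite fE e mul0r.
have c0' : c' != 0 by apply: contraNneq g0 => e; rewrite gE e mul0r.
have f10 : f1 != 0 by apply: contraNneq f0 => e; rewrite fE e mulr0.
have [e [h [hE ph]]] := content_ex (gcdp f1 g1).
have gn0 : gcdp f1 g1 != 0 by rewrite gcdp_eq0 negb_and f10.
have e0 : e != 0 by apply: contraNneq gn0 => ee; rewrite hE ee mul0r.
have hh : h %| gcdp f1 g1 by rewrite hE; apply: Pdiv.Idomain.dvdp_mulIr.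
have [d0 [dc dc' dmax]] := GR c c'.
have C2 (a b : R) : divides a b -> divides a%:P b%:P by case=> x ->; exists x%:P; rewrite polyCM.
exists (d0%:P * h); split.
- rewrite fE; apply: dividesM2; first exact: C2.
  by apply: primitive_dvdp => //; apply: Pdiv.Idomain.dvdp_trans hh (Pdiv.Idomain.dvdp_gcdl _ _).
- rewrite gE; apply: dividesM2; first exact: C2.
  by apply: primitive_dvdp => //; apply: Pdiv.Idomain.dvdp_trans hh (Pdiv.Idomain.dvdp_gcdr _ _).
move=> E Ef Eg; have [ep [E1 [EE pE]]] := content_ex E.
have E1E : divides E1 E by rewrite EE; apply: dividesMl; apply: divides_refl.
have epE : divides ep%:P E by rewrite EE mulrC; apply: dividesMl; apply: divides_refl.
rewrite EE; apply: dividesM2.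
  apply/C2/dmax; [apply: (primitive_scale pf)|apply: (primitive_scale pg)]; rewrite -?fE -?gE; exact: divides_trans epE _.
apply: primitive_dvdp => //.
have : E1 %| gcdp f1 g1.
  rewrite Pdiv.Idomain.dvdp_gcd; apply/andP; split.
    by have := divides_dvdp (divides_trans E1E Ef); rewrite fE mul_polyC Pdiv.Idomain.dvdpZr.
  by have := divides_dvdp (divides_trans E1E Eg); rewrite gE mul_polyC Pdiv.Idomain.dvdpZr.
by rewrite hE mul_polyC Pdiv.Idomain.dvdpZr.
Qed.

End GcdDomain.

Section MpolyGcd.
Variable F : fieldType.

Lemma mpoly_uni_cancel n (p : {mpoly F[n.+1]}) :
  (map_poly (@mwiden n F) (muni p)).['X_ord_max] = p.
Proof.
rewrite {2}[p]mpolyE muniE rmorph_sum horner_sum /=; apply: eq_bigr => m _.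
rewrite -mul_polyC rmorphM /= map_polyC /= map_polyXn hornerCM hornerXn.
rewrite mwidenZ mwidenX -scalerAl; congr (_ *: _).
rewrite mpolyXn -mpolyXD; congr 'X_[_].
apply/mnmP => i; rewrite mnmDE mulmnE mnm1E.
have [->|im] := eqVneq i ord_max; first by rewrite mnmwiden_ordmax mul1n.
rewrite mul0n addn0.
have ir : (i < n)%N by rewrite ltn_neqAle -ltnS ltn_ord andbT.
have -> : i = widen_ord (leqnSn n) (Ordinal ir) by apply: val_inj.
by rewrite mnmwiden_widen mnmE.
Qed.

Lemma mpoly_unit n (p : {mpoly F[n]}) : p != 0 -> (msize p <= 1)%N -> divides p 1.
Proof.
move=> p0 /msize1_polyC pE; exists (p@_0)^-1%:MP.
rewrite {2}pE -mpolyCM mulVf //; by apply: contraNneq p0 => e; rewrite pE e.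
Qed.

(** Induction on the number of variables, reading the last variable as an indeterminate over the
    ring in the others. *)
Lemma gcd_domain_mpoly n : gcd_domain {mpoly F[n]}.
Proof.
elim: n => [|n IH] a b.
  have sz (p : {mpoly F[0]}) : (msize p <= 1)%N.
    by rewrite msizeE; apply/bigmax_leqP_seq => m _ _; rewrite mdegE big_ord0.
  have [->|a0] := eqVneq a 0; first by exists b; split=> //; [apply: divides0|apply: divides_refl].
  have u p (q : {mpoly F[0]}) : p != 0 -> divides p q.
    by move=> p0; apply: divides_trans (mpoly_unit p0 (sz p)) _; exists q; rewrite mulr1.
  by exists a; split=> //; [apply: divides_refl|apply: u].
pose psi (P : {poly {mpoly F[n]}}) := (map_poly (@mwiden n F) P).['X_ord_max].
have psiM P Q : psi (P * Q) = psi P * psi Q by rewrite /psi rmorphM hornerM.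
have [d [da db dmax]] := gcd_domain_poly IH (muni a) (muni b).
have back x y : divides x (muni y) -> divides (psi x) y.
  by case=> c e; exists (psi c); rewrite -psiM -e; exact: esym (mpoly_uni_cancel y).
exists (psi d); split; [exact: (back _ _ da)|exact: (back _ _ db)|].
have forth (x y : {mpoly F[n.+1]}) : divides x y -> divides (muni x) (muni y).
  by case=> c e; exists (muni c); rewrite e; exact: muniM.
move=> c ca cb; have [q e] := dmax _ (forth _ _ ca) (forth _ _ cb).
exists (psi q); rewrite e psiM; congr (_ * _); exact: mpoly_uni_cancel.
Qed.

(** [Q] divides [A P] and is coprime to [P]: all syzygies are multiples of the Koszul one. *)
Lemma coprime_syzygy n (P Q A B : {mpoly F[n]}) : coprime_mpoly P Q -> P != 0 -> Q != 0 ->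
  A * P + B * Q = 0 -> exists C, A = C * Q /\ B = - (C * P).
Proof.
move=> cop P0 Q0 e.
have cop' d : divides d Q -> divides d P -> divides d 1.
  move=> dQ dP; apply: mpoly_unit.
    by apply: contraNneq Q0 => d0; case: dQ => x ->; rewrite d0 mulr0.
  by apply: cop; [case: dP|case: dQ] => x ->; exists x; rewrite mulrC.
have [C AE] : divides Q A.
  apply: (gcd_euclid (@gcd_domain_mpoly n) cop').
  by exists (- B); move/eqP: e; rewrite addr_eq0 mulrC => /eqP->; rewrite mulNr.
exists C; split=> //; apply: (mulIf Q0); move/eqP: e.
by rewrite addrC addr_eq0 => /eqP->; rewrite AE; ring.
Qed.

End MpolyGcd.

(** * Ideals and partial degrees *)

Section PartialDegree.
Variables (F : fieldType) (n : nat).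
Implicit Types (p q : {mpoly F[n]}) (i : 'I_n).

(* Marks the variable x_i with a new indeterminate, which turns the degree in x_i into
   the degree of a univariate polynomial. *)
Definition markvar i : {mpoly F[n]} -> {poly {mpoly F[n]}} :=
  mmap (polyC \o @mpolyC n F) (fun j => ('X_j)%:P * 'X^(j == i)).
HB.instance Definition _ i := GRing.RMorphism.on (markvar i).

Lemma markvarE i p : markvar i p = \sum_(m <- msupp p) (p@_m *: 'X_[m])%:P * 'X^(m i).
Proof.
apply: eq_bigr => m _; rewrite /= /mmap1.
rewrite (eq_bigr (fun j => ('X_j ^+ m j)%:P * 'X^((j == i) * m j))); last first.
  by move=> j _; rewrite exprMn -exprM -polyC_exp.
rewrite big_split /= -rmorph_prod -mpolyXE_id -mul_mpolyC polyCM -mulrA; congr (_ * (_ * _)).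
rewrite (bigD1 i) //= eqxx mul1n big1 ?mulr1 // => j /negbTE->.
by rewrite mul0n expr0.
Qed.

(* Unfolding [markvar] makes unification diverge. *)
Local Opaque markvar.

Lemma coef_markvar i p e m : (markvar i p)`_e @_m = p@_m *+ (m i == e).
Proof.
rewrite markvarE coef_sum raddf_sum /= [in RHS](mpolyE p) raddf_sum /= -sumrMnl.
apply: eq_bigr => m' _; rewrite coefCM coefXn !mcoeffZ mcoeffX.
have [->|mm] := eqVneq m' m; last first.
  by rewrite mulr0 mul0rn mulr_natr mcoeffMn mcoeffZ mcoeffX (negbTE mm) mulr0 mul0rn.
by rewrite mulr_natr mcoeffMn mcoeffZ mcoeffX eqxx eq_sym.
Qed.

Lemma size_markvarP i p c :
  reflect (forall m, m \in msupp p -> (m i < c)%N) (size (markvar i p) <= c)%N.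
Proof.
apply: (iffP idP) => [sz m mp|h].
  rewrite ltnNge; apply/negP => cm; have := coef_markvar i p (m i) m.
  rewrite nth_default ?(leq_trans sz) // mcoeff0 eqxx mulr1n => /esym/eqP.
  by rewrite mcoeff_eq0 mp.
apply/leq_sizeP => e ce; apply/mpolyP => m; rewrite coef_markvar mcoeff0.
have [me|] := eqVneq (m i) e; last by rewrite mulr0n.
rewrite mulr1n; apply/eqP; rewrite mcoeff_eq0; apply/negP => /h.
by rewrite me ltnNge ce.
Qed.

Lemma markvar_neq0 i p : p != 0 -> markvar i p != 0.
Proof.
move=> p0; apply: contraNneq p0 => e; apply/eqP/mpolyP => m.
by have := coef_markvar i p (m i) m; rewrite e coef0 mcoeff0 eqxx mulr1n.
Qed.

Definition pdeg i p : nat := (size (markvar i p)).-1.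

Lemma size_pdeg i p : p != 0 -> size (markvar i p) = (pdeg i p).+1.
Proof. by move=> p0; rewrite prednK // lt0n size_poly_eq0 markvar_neq0. Qed.

Lemma size_markvarM i p q : p != 0 -> q != 0 ->
  size (markvar i (p * q)) = (pdeg i p + pdeg i q).+1.
Proof.
move=> p0 q0.
have -> : markvar i (p * q) = markvar i p * markvar i q by apply: rmorphM.
rewrite size_mul; [|exact: markvar_neq0|exact: markvar_neq0].
have h (a b c d : nat) : a = c.+1 -> b = d.+1 -> (a + b).-1 = (c + d).+1 by lia.
exact: h (size_pdeg i p0) (size_pdeg i q0).
Qed.

End PartialDegree.

Local Opaque markvar.

Section Boxes.
Variables (F : fieldType) (n m : nat).
Implicit Types (p q : {mpoly F[n]}).

(** A finite type, so that families and matrices can be indexed by monomials of partial degrees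
    below m. *)
Definition expo := {ffun 'I_n -> 'I_m}.
Definition mon (e : expo) : 'X_{1..n} := [multinom (e i : nat) | i < n].

Lemma mon_inj : injective mon.
Proof.
move=> e e' /mnmP h; apply/ffunP => i; apply: val_inj.
by have := h i; rewrite !mnmE.
Qed.

Definition inbox (c : 'I_n -> nat) p : Prop := forall i, (size (markvar i p) <= c i)%N.

Definition box (c : 'I_n -> nat) : {set expo} := [set e : expo | [forall i, (e i < c i)%N]].

Lemma mon_box c (x : 'X_{1..n}) : (forall i, (c i <= m)%N) -> (forall i, (x i < c i)%N) ->
  exists2 e, e \in box c & mon e = x.
Proof.
move=> cm xc; have xm i : (x i < m)%N by apply: leq_trans (cm i).
exists [ffun i => Ordinal (xm i)]; last by apply/mnmP => i; rewrite mnmE ffunE.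
by rewrite inE; apply/forallP => i; rewrite ffunE; apply: xc.
Qed.

Lemma inbox_sum c p : (forall i, (c i <= m)%N) -> inbox c p ->
  p = \sum_(e in box c) p@_(mon e) *: 'X_[mon e].
Proof.
move=> cm pc; apply/mpolyP => x; rewrite raddf_sum /=.
have cE e : (p@_(mon e) *: 'X_[mon e])@_x = p@_(mon e) * (mon e == x)%:R by rewrite mcoeffZ mcoeffX.
under eq_bigr do rewrite cE.
have [xp|xp] := boolP (x \in msupp p); last first.
  rewrite (eqP (_ : p@_x == 0)) ?mcoeff_eq0 // big1 // => e _.
  by case: eqP => [->|_]; rewrite ?mulr0 // (eqP (_ : p@_x == 0)) ?mul0r // mcoeff_eq0.
have xc i : (x i < c i)%N by have /size_markvarP := pc i; apply.
have [e ec ex] := mon_box cm xc.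
rewrite (bigD1 e) //= ex eqxx mulr1 big1 ?addr0 // => e' /andP[_ ee].
by rewrite -ex (inj_eq mon_inj) (negbTE ee) mulr0.
Qed.

Lemma inbox_lin c (x : expo -> F) : inbox c (\sum_(e in box c) x e *: 'X_[mon e]).
Proof.
move=> i; apply/size_markvarP => y; rewrite mcoeff_msupp raddf_sum /= => h.
apply: NNPP => yc; move/negP: h; apply; rewrite big1 // => e.
rewrite inE => /forallP/(_ i) ec; rewrite mcoeffZ mcoeffX; case: eqP => [ey|]; last by rewrite mulr0.
by case: yc; rewrite -ey mnmE.
Qed.

Lemma coef_lin c (x : expo -> F) e : e \in box c -> (\sum_(e in box c) x e *: 'X_[mon e])@_(mon e) = x e.
Proof.
move=> ec; rewrite raddf_sum /= (bigD1 e) //= mcoeffZ mcoeffX eqxx mulr1 big1 ?addr0 // => e' /andP[_ ee].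
by rewrite mcoeffZ mcoeffX (inj_eq mon_inj) (negbTE ee) mulr0.
Qed.

Lemma card_box c : (forall i, (c i <= m)%N) -> #|box c| = (\prod_i c i)%N.
Proof.
move=> cm; have -> : #|box c| = #|family (fun i => [pred j : 'I_m | (j < c i)%N])|.
  by apply: eq_card => e; rewrite inE; apply/forallP/familyP.
rewrite card_family foldrE big_map big_enum /=; apply: eq_bigr => i _.
have -> : #|[pred j : 'I_m | (j < c i)%N]| = #|[set widen_ord (cm i) l | l : 'I_(c i)]|.
  apply: eq_card => j; rewrite inE; apply/idP/imsetP => [jc|[l _ ->]]; last exact: (ltn_ord l).
  by exists (Ordinal jc) => //; apply: val_inj.
by rewrite card_imset ?card_ord // => l l' /(congr1 val) /= /val_inj.
Qed.

End Boxes.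

Lemma box_shift (dC dP dQ a c m : nat) : (a + dP = m)%N -> (c + dP + dQ = m)%N ->
  (dC + dQ < a)%N -> (dC < c)%N.
Proof. lia. Qed.

Lemma eq_leq_trans (a b c : nat) : a = b -> (b <= c)%N -> (a <= c)%N.
Proof. by move=> ->. Qed.

Section IdealRank.
Variables (F : fieldType) (n m : nat) (P Q : {mpoly F[n]}).
Hypotheses (P0 : P != 0) (Q0 : Q != 0) (cop : coprime_mpoly P Q).
Variables (cA cB cC : 'I_n -> nat).
Hypothesis hA : forall i, (cA i + pdeg i P = m)%N.
Hypothesis hB : forall i, (cB i + pdeg i Q = m)%N.
Hypothesis hC : forall i, (cC i + pdeg i P + pdeg i Q = m)%N.

Let cm (i : 'I_n) := m.
Let cAm i : (cA i <= m)%N. Proof. by rewrite -(hA i) leq_addr. Qed.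
Let cBm i : (cB i <= m)%N. Proof. by rewrite -(hB i) leq_addr. Qed.
Let cCm i : (cC i <= m)%N. Proof. by rewrite -(hC i) -addnA leq_addr. Qed.

(* The relations between the products x^a P and x^b Q are the syzygies C (Q, - P), hence there are
   no more of them than monomials in C. *)
Lemma ideal_rank : exists (r : nat) (Phi : 'M[F]_(r, #|expo n m|)) (A B : 'I_r -> {mpoly F[n]}),
  [/\ row_free Phi,
      forall j, A j * P + B j * Q = \sum_l Phi j l *: 'X_[mon (enum_val l)]
    & (\prod_i cA i + \prod_i cB i <= r + \prod_i cC i)%N].
Proof.
pose N := #|expo n m|.
pose vec (p : {mpoly F[n]}) : 'rV[F]_N := \row_l p@_(mon (enum_val l)).
have box_all : box m cm = [set: expo n m].
  by apply/setP => e; rewrite !inE; apply/forallP => i.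
have vecE p : inbox cm p -> p = \sum_l vec p 0 l *: 'X_[mon (enum_val l)].
  move=> pm; rewrite {1}(@inbox_sum F n m cm p (fun i => leqnn m) pm) box_all.
  rewrite (eq_bigl predT) => [|e]; last by rewrite inE.
  by rewrite (sum_ord (fun e => p@_(mon e) *: 'X_[mon e])); apply: eq_bigr => l _; rewrite mxE.
have vec0 p : inbox cm p -> vec p = 0 -> p = 0.
  by move=> h v0; rewrite (vecE _ h) v0 big1 // => l _; rewrite mxE scale0r.
pose PsA : 'M[F]_(#|box m cA|, N) := \matrix_a vec ('X_[mon (enum_val a)] * P).
pose PsB : 'M[F]_(#|box m cB|, N) := \matrix_b vec ('X_[mon (enum_val b)] * Q).
(* The rows of [Om] are the coordinates of the syzygies (x^c Q, - x^c P), those of [Psi] the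
   products x^a P and x^b Q. *)
pose OmA : 'M[F]_(#|box m cC|, #|box m cA|) :=
  \matrix_(c, a) ('X_[mon (enum_val c)] * Q)@_(mon (enum_val a)).
pose OmB : 'M[F]_(#|box m cC|, #|box m cB|) :=
  \matrix_(c, b) (- ('X_[mon (enum_val c)] * P))@_(mon (enum_val b)).
pose Psi := col_mx PsA PsB; pose Om := row_mx OmA OmB.
pose pol (c : 'I_n -> nat) (x : 'rV[F]_#|box m c|) : {mpoly F[n]} :=
  \sum_l x 0 l *: 'X_[mon (enum_val l)].
have polE c x : exists y : expo n m -> F, (pol c x = \sum_(e in box m c) y e *: 'X_[mon e])
    /\ forall l, x 0 l = y (enum_val l).
  exists (fun e => if [pick l | enum_val l == e] is Some l then x 0 l else 0).
  have h l : x 0 l = (if [pick l' | enum_val l' == enum_val l :> expo n m] is Some l then x 0 l else 0).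
    by case: pickP => [l' /eqP/enum_val_inj->|/(_ l)]; rewrite ?eqxx.
  split=> //; rewrite big_enum_val /=; apply: eq_bigr => l _.
  by rewrite h.
have pol_inbox c x : inbox c (pol c x).
  by have [y [-> _]] := polE c x; apply: inbox_lin.
have pol_coef c x l : (pol c x)@_(mon (enum_val l)) = x 0 l.
  by have [y [-> ->]] := polE c x; rewrite coef_lin // enum_valP.
have mulA x : vec (pol cA x * P) = x *m PsA.
  rewrite mulmx_sum_row /pol mulr_suml.
  rewrite (eq_bigr (fun l => x 0 l *: ('X_[mon (enum_val l)] * P))) => [|l _]; last by rewrite scalerAl.
  apply/rowP => l; rewrite mxE raddf_sum summxE; apply: eq_bigr => a _.
  by rewrite rowK !mxE /= mcoeffZ.
have mulB x : vec (pol cB x * Q) = x *m PsB.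
  rewrite mulmx_sum_row /pol mulr_suml.
  rewrite (eq_bigr (fun l => x 0 l *: ('X_[mon (enum_val l)] * Q))) => [|l _]; last by rewrite scalerAl.
  apply/rowP => l; rewrite mxE raddf_sum summxE; apply: eq_bigr => a _.
  by rewrite rowK !mxE /= mcoeffZ.
have inbM c (R p : {mpoly F[n]}) : R != 0 -> inbox c p -> (forall i, (c i + pdeg i R <= m)%N) -> inbox cm (p * R).
  move=> R0 pc h i; have [->|p0] := eqVneq p 0; first by rewrite mul0r rmorph0 size_poly0.
  by rewrite size_markvarM // /cm; have := pc i; rewrite size_pdeg //; have := h i; lia.
have inbA p : inbox cA p -> inbox cm (p * P).
  by move=> h; apply: (inbM cA P p P0 h) => i; rewrite hA.
have inbB p : inbox cB p -> inbox cm (p * Q).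
  by move=> h; apply: (inbM cB Q p Q0 h) => i; rewrite hB.
have inbD p q : inbox cm p -> inbox cm q -> inbox cm (p + q).
  move=> hp hq i; have -> : markvar i (p + q) = markvar i p + markvar i q by apply: rmorphD.
  apply: leq_trans (size_polyD _ _) _; rewrite geq_max; apply/andP; split; first exact: (hp i).
  exact: (hq i).
have ker_sub (x : 'rV[F]_#|box m cA|) (y : 'rV[F]_#|box m cB|) :
    x *m PsA + y *m PsB = 0 -> (row_mx x y <= Om)%MS.
  rewrite -(mulA x) -(mulB y) => h.
  have e0 : pol cA x * P + pol cB y * Q = 0.
    apply: vec0; first by apply: inbD; [apply: inbA|apply: inbB]; apply: pol_inbox.
    by rewrite -[RHS]h; apply/rowP => l; rewrite !mxE mcoeffD.
  have [C [AE BE]] := coprime_syzygy cop P0 Q0 e0.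
  have Cin : inbox cC C.
    move=> i; have [->|C0] := eqVneq C 0; first by rewrite rmorph0 size_poly0.
    have h1 := pol_inbox cA x i; rewrite AE in h1.
    have h2 : ((pdeg i C + pdeg i Q).+1 <= cA i)%N by rewrite -(size_markvarM i C0 Q0).
    exact: eq_leq_trans (size_pdeg i C0) (box_shift (hA i) (hC i) h2).
  have CE := inbox_sum cCm Cin.
  pose z : 'rV[F]_#|box m cC| := \row_l C@_(mon (enum_val l)).
  have zE : C = pol cC z by rewrite {1}CE big_enum_val /=; apply: eq_bigr => l _; rewrite mxE.
  have zM (R : {mpoly F[n]}) : C * R = \sum_l z 0 l *: ('X_[mon (enum_val l)] * R).
    by rewrite {1}zE mulr_suml; apply: eq_bigr => l _; rewrite scalerAl.
  apply/submxP; exists z; rewrite mul_mx_row; congr row_mx.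
    apply/rowP => a; rewrite -pol_coef AE zM mxE raddf_sum; apply: eq_bigr => l _.
    by rewrite !mxE /= mcoeffZ.
  apply/rowP => a; rewrite -pol_coef BE zM mxE -sumrN raddf_sum; apply: eq_bigr => l _.
  by rewrite !mxE /= -scalerN mcoeffZ.
have rker : (\rank (kermx Psi) <= #|box m cC|)%N.
  apply: leq_trans (rank_leq_row Om); apply: mxrankS; apply/row_subP => i.
  rewrite -[row i _]hsubmxK; apply: ker_sub.
  rewrite -(mul_row_col _ _ PsA PsB) hsubmxK -[col_mx _ _]/Psi.
  by rewrite -row_mul mulmx_ker row0.
exists (\rank Psi), (row_base Psi).
have [D DE] : exists D, row_base Psi = D *m Psi by apply/submxP; rewrite eq_row_base.
exists (fun j => pol cA (lsubmx (row j D))), (fun j => pol cB (rsubmx (row j D))).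
split; first exact: row_base_free.
  move=> j; rewrite [LHS]vecE; last by apply: inbD; [apply: inbA|apply: inbB]; apply: pol_inbox.
  apply: eq_bigr => l _; congr (_ *: _).
  have -> : vec (pol cA (lsubmx (row j D)) * P + pol cB (rsubmx (row j D)) * Q) = row j (row_base Psi).
    rewrite DE row_mul -[in RHS](hsubmxK (row j D)) /Psi mul_row_col -(mulA (lsubmx _)) -(mulB (rsubmx _)).
    by apply/rowP => l'; rewrite !mxE mcoeffD.
  by rewrite mxE.
have : (#|box m cA| + #|box m cB| <= \rank Psi + #|box m cC|)%N.
  by rewrite -leq_subLR -mxrank_ker.
by rewrite -(card_box cAm) -(card_box cBm) -(card_box cCm).
Qed.

End IdealRank.

(** * Asymptotic size of the ideal in a box *)

Section Asymptotics.
Variable R : realType.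

Lemma prod_ge1B n (x : 'I_n -> R) : (forall i, 0 <= x i <= 1) ->
  0 <= \prod_i (1 - x i) <= 1 /\ 1 - \sum_i x i <= \prod_i (1 - x i).
Proof.
elim: n x => [|n IH] x hx; first by rewrite !big_ord0 subr0 ler01 lexx.
rewrite !big_ord_recl; have /andP[h0 h1] := hx ord0.
have [/andP[p0 p1] s] := IH (fun i => x (lift ord0 i)) (fun i => hx _).
move: (\prod_(i < n) _) (\sum_(i < n) _) p0 p1 s => a b p0 p1 s.
by split; nra.
Qed.

(** With x, y the partial degrees of the two polynomials divided by m, the left side bounds the
    proportion of monomials missed by the ideal. The last product is at most the product of the
    other two, which leaves (1 - a)(1 - b), of order 1/m^2. *)
Lemma prod_second_difference n (x y : 'I_n -> R) :
  (forall i, 0 <= x i) -> (forall i, 0 <= y i) -> (forall i, x i + y i <= 1) ->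
  1 - \prod_i (1 - x i) - \prod_i (1 - y i) + \prod_i (1 - x i - y i) <= (\sum_i x i) * (\sum_i y i).
Proof.
move=> x0 y0 xy.
have x1 i : 0 <= x i <= 1 by have := y0 i; have := xy i; rewrite x0 /=; lra.
have y1 i : 0 <= y i <= 1 by have := x0 i; have := xy i; rewrite y0 /=; lra.
have [/andP[a0 a1] sx] := prod_ge1B x1; have [/andP[b0 b1] sy] := prod_ge1B y1.
have le : \prod_i (1 - x i - y i) <= \prod_i (1 - x i) * \prod_i (1 - y i).
  rewrite -big_split /=; apply: ler_prod => i _.
  by have := x0 i; have := y0 i; have := xy i => *; apply/andP; split; nra.
move: (\prod_i (1 - x i)) (\prod_i (1 - y i)) (\prod_i _) (\sum_i x i) (\sum_i y i) a0 a1 b0 b1 sx sy le.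
by move=> a b c s t *; nra.
Qed.

(** A missing proportion of order 1/m^2 still tends to 0 after multiplication by the cost [m * n] of
    one missing monomial. *)
Lemma box_asymptotics n (f g : 'I_n -> nat) (eps : R) : 0 < eps ->
  exists m : nat, [/\ (0 < m)%N, forall i, (f i + g i <= m)%N &
    forall r : nat, (\prod_(i < n) (m - f i) + \prod_(i < n) (m - g i) <= r + \prod_(i < n) (m - f i - g i))%N ->
      (r <= m ^ n)%N -> (0 < r)%N /\ ((m ^ n - r) * (m * n))%N%:R <= eps * r%:R].
Proof.
move=> eps0; pose a := (\sum_i f i)%N; pose b := (\sum_i g i)%N.
pose c : R := 2 * (a * b * n)%N%:R / eps.
have c0 : 0 <= c by rewrite divr_ge0 ?mulr_ge0 ?ler0n // ltW.
(* [c < m] makes the cost at most eps / 2 times m^n, [2 a b <= m] makes r at least half of m^n, and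
   [a + b <= m] keeps the boxes meaningful. *)
pose m := (Num.bound c + 2 * (a * b) + a + b).+1.
have mc : c < m%:R.
  by apply: lt_le_trans (archi_boundP c0) _; rewrite ler_nat /m; lia.
have fa i : (f i <= a)%N by rewrite /a (bigD1 i) //= leq_addr.
have gb i : (g i <= b)%N by rewrite /b (bigD1 i) //= leq_addr.
have m0 : 0 < m%:R :> R by rewrite ltr0n.
exists m; split=> // [i|r hr rm]; first by have := fa i; have := gb i; rewrite /m; lia.
pose x i : R := (f i)%:R / m%:R; pose y i : R := (g i)%:R / m%:R.
have prodE (h : 'I_n -> nat) : (forall i, (h i <= m)%N) ->
    (\prod_(i < n) (m - h i))%N%:R = m%:R ^+ n * \prod_i (1 - (h i)%:R / m%:R) :> R.
  move=> hm; rewrite natr_prod -[n in m%:R ^+ n]card_ord -prodr_const -big_split /=.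
  apply: eq_bigr => i _; rewrite natrB //; field.
  by rewrite gt_eqF.
have fgm i : (f i + g i <= m)%N by have := fa i; have := gb i; rewrite /m; lia.
have pA := prodE f (fun i => leq_trans (leq_addr _ _) (fgm i)).
have pB := prodE g (fun i => leq_trans (leq_addl _ _) (fgm i)).
have pC : (\prod_(i < n) (m - f i - g i))%N%:R = m%:R ^+ n * \prod_i (1 - x i - y i) :> R.
  rewrite (eq_bigr (fun i => m - (f i + g i))%N) => [|i _]; last by rewrite subnDA.
  rewrite (prodE _ fgm); congr (_ * _); apply: eq_bigr => i _.
  by rewrite /x /y natrD; field; rewrite gt_eqF.
have sx : \sum_i x i = a%:R / m%:R by rewrite -mulr_suml -natr_sum.
have sy : \sum_i y i = b%:R / m%:R by rewrite -mulr_suml -natr_sum.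
have x0 i : 0 <= x i by rewrite divr_ge0 ?ler0n.
have y0 i : 0 <= y i by rewrite divr_ge0 ?ler0n.
have xy i : x i + y i <= 1 by rewrite -mulrDl ler_pdivrMr // mul1r -natrD ler_nat.
have := prod_second_difference x0 y0 xy; rewrite sx sy => hd.
have hr' : (m ^ n)%N%:R - r%:R <= m%:R ^+ n * (a%:R / m%:R * (b%:R / m%:R)) :> R.
  apply: le_trans (ler_wpM2l _ hd); last by rewrite exprn_ge0.
  have : (\prod_(i < n) (m - f i) + \prod_(i < n) (m - g i))%N%:R <= (r + \prod_(i < n) (m - f i - g i))%N%:R :> R.
    by rewrite ler_nat.
  by rewrite !natrD pA pB pC -/x -/y natrX !mulrDr !mulrN mulr1; lra.
set M : R := m%:R ^+ n in hr' *; have M0 : 0 < M by rewrite exprn_gt0.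
set dl := a%:R / m%:R * (b%:R / m%:R) in hr'.
have dlm : dl * m%:R = (a * b)%N%:R / m%:R :> R by rewrite /dl natrM; field; rewrite gt_eqF.
have ab0 : 0 <= (a * b)%N%:R :> R by rewrite ler0n.
have m1 : 1 <= m%:R :> R by rewrite ler1n.
have dl12 : dl <= 1 / 2.
  have : dl * m%:R <= 1 / 2.
    rewrite dlm ler_pdivrMr //; have : (2 * (a * b))%N%:R <= m%:R :> R by rewrite ler_nat /m; lia.
    by rewrite natrM; lra.
  have : 0 <= dl by rewrite /dl !mulr_ge0 ?invr_ge0 ?ler0n.
  by nra.
have dln : dl * m%:R * n%:R <= eps / 2.
  rewrite dlm mulrAC ler_pdivrMr // -natrM.
  have := mc; rewrite /c ltr_pdivrMr // => h; nra.
have mnE : (m ^ n)%N%:R = M :> R by rewrite natrX.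
rewrite mnE in hr'.
have r12 : M / 2 <= r%:R by nra.
split; first by rewrite -(ltr0n R); lra.
rewrite natrM natrB // mnE natrM.
have n0 : 0 <= n%:R :> R by rewrite ler0n.
apply: le_trans (_ : (M * dl) * (m%:R * n%:R) <= _); first by apply: ler_wpM2r => //; rewrite mulr_ge0 // ltW.
have -> : M * dl * (m%:R * n%:R) = M * (dl * m%:R * n%:R) by ring.
apply: le_trans (_ : M * (eps / 2) <= _); first by rewrite ler_wpM2l // ltW.
nra.
Qed.

End Asymptotics.

(** * Coefficients *)

Section CoefficientSpaces.
Variables (k : closedFieldType) (K : fieldType) (iota : {rmorphism k -> K}) (g : nat).
Hypothesis H : genus_field iota g.
Variable p0 : place iota.
Implicit Types (p : place iota).

Let FF : function_field iota. Proof. by case: H. Qed.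

Definition is_const (x : K) : Prop := exists c, x = iota c.

Lemma const1 : is_const 1. Proof. by exists 1; rewrite rmorph1. Qed.
Lemma constM x y : is_const x -> is_const y -> is_const (x * y).
Proof. by case=> a -> [b ->]; exists (a * b); rewrite rmorphM. Qed.

Lemma k_indep1 : k_indep iota (fun _ : 'I_1 => 1 : K).
Proof.
move=> c; rewrite big_ord1 mulr1 => /eqP; rewrite fmorph_eq0 => /eqP c0 i.
by rewrite ord1.
Qed.

Lemma kspan1 x : is_const x -> kspan iota (fun _ : 'I_1 => 1 : K) x.
Proof. by case=> c ->; exists (fun=> c); rewrite big_ord1 mulr1. Qed.

Lemma dim_le_size (D : place iota -> int) d d' (b : 'I_d' -> K) :
  dim_le D d -> (forall i, in_LD D (b i)) -> k_indep iota b -> (d' <= d)%N.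
Proof.
move=> hd hb ib; rewrite leqNgt; apply/negP => dd.
exact: (hd (fun i => b (widen_ord dd i)) (fun i => hb _) (k_indep_lt ib)).
Qed.

Lemma RR_basis (s : seq (place iota)) : exists (w : nat) (b : 'I_w -> K),
  [/\ k_indep iota b, forall i, in_LD (fun p => (mult s p)%:Z) (b i),
      forall x, in_LD (fun p => (mult s p)%:Z) x -> kspan iota b x
    & dim_le (fun p => (mult s p)%:Z) w /\ (size s <= w + g)%N].
Proof.
have [u hu] := dim_le_eff H; have h1 := hu s.
have [d dd [[b [hb ib]] nb]] := ell_ex h1.
have hd : dim_le (fun p => (mult s p)%:Z) d by move=> b' hb' ib'; apply: nb; exists b'.
exists d, b; split=> //; first by move=> x hx; apply: basis_span hd hb ib hx.
split=> //; have [d' [_ hd'] [b' [hb' ib']]] := riemann_ineq H hd (deg_eff s).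
have := dim_le_size hd hb' ib'; move: hd'; lia.
Qed.

(** Constant functions are treated apart, with basis 1, so that constant data bring no error.
    Otherwise the function 1 is adjoined to force [0 < w]. *)
Lemma coef_space (I : finType) (x : I -> K) : exists (w : nat) (b : 'I_w -> K),
  [/\ k_indep iota b, forall i, kspan iota b (x i), (0 < w)%N
    & (forall i, is_const (x i)) -> forall s, is_const (b s)].
Proof.
case: (classic (forall i, is_const (x i))) => [hc|nc].
  exists 1%N, (fun=> 1); split=> //; [exact: k_indep1|by move=> i; apply: kspan1|].
  by move=> _ _; apply: const1.
have [s hs] := pole_divisor H (fun o : option I => if o is Some i then x i else 1).
have [w [b [ib hb hsp _]]] := RR_basis s.
have hx o : kspan iota b (if o is Some i then x i else 1).
  by apply: hsp; apply/in_LDE => p; apply: hs.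
exists w, b; split=> //; first by move=> i; apply: (hx (Some i)).
by case: w b ib hb hsp hx => // b _ _ _ /(_ None)[c]; rewrite big_ord0 => /eqP; rewrite oner_eq0.
Qed.

(* L(l p0) and L(l p0 + s) have dimensions whose ratio tends to 1. *)
Lemma coef_space_pair (R : realType) (I : finType) (x : I -> K) (N : nat) (eps : R) : 0 < eps ->
  exists (w0 w : nat) (a : 'I_w0 -> K) (b : 'I_w -> K),
  [/\ k_indep iota a /\ k_indep iota b, forall s i, kspan iota b (a s * x i),
      (w0 <= w)%N /\ (0 < w)%N, ((w - w0) * N)%N%:R <= eps * w%:R
    & (forall i, is_const (x i)) -> (forall s, is_const (a s)) /\ forall s, is_const (b s)].
Proof.
move=> eps0; case: (classic (forall i, is_const (x i))) => [hc|nc].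
  exists 1%N, 1%N, (fun=> 1), (fun=> 1); split=> //.
  - by split; apply: k_indep1.
  - by move=> s i; rewrite mul1r; apply: kspan1.
  - by rewrite subnn mul0n mulr1 ltW.
  by move=> _; split=> _; apply: const1.
have [s hs] := pole_divisor H x.
pose c : R := (size s * N)%N%:R / eps.
have c0 : 0 <= c by rewrite divr_ge0 ?ler0n // ltW.
(* The gap [w - w0] is at most [size s] whatever l is, while [w >= l - g] exceeds [c]. *)
pose l := (Num.bound c + g).+1.
have [w0 [a [ia ha hspa [dima _]]]] := RR_basis (nseq l p0).
have [w [b [ib hb hspb [dimb wl]]]] := RR_basis (nseq l p0 ++ s).
have lw : (l <= w + g)%N by apply: leq_trans wl; rewrite size_cat size_nseq leq_addr.
exists w0, w, a, b; split=> //.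
- move=> t i; apply: hspb; apply/in_LDE => p; have /in_LDE/(_ p) := ha t => h1.
  by apply: vgeW (vgeM h1 (hs i p)); rewrite mult_cat; lia.
- split; last by move: lw; rewrite /l; lia.
  apply: dim_le_size dimb _ ia => i; apply/in_LDE => p; have /in_LDE/(_ p) := ha i.
  by apply: vgeW; rewrite mult_cat; lia.
have ww : (w <= w0 + size s)%N.
  apply: dim_le_size ib; last exact: hb.
  by apply: dim_leS (dim_le_add FF (s := s) dima) => p; rewrite /addD mult_cat PoszD.
apply: (@le_trans _ _ (size s * N)%N%:R).
  by rewrite ler_nat leq_mul2r leq_subLR ww orbT.
have : c <= w%:R.
  apply: ltW; apply: lt_le_trans (archi_boundP c0) _; rewrite ler_nat.
  by move: lw; rewrite /l; lia.
by rewrite /c ler_pdivrMr // mulrC.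
Qed.

End CoefficientSpaces.

(** * Reduction to pivots of least weight *)

Section Pivots.
Variables (F : fieldType) (r N : nat) (Phi : 'M[F]_(r, N)).

(* Among the invertible r x r minors, one of least total weight reduces [Phi] to a matrix
   whose rows have their pivot at an entry of least weight. *)
Lemma pivots_ex (wt : 'I_N -> int) : row_free Phi -> exists P : {ffun 'I_r -> 'I_N},
  colsub P Phi \in unitmx /\
  forall j l, (invmx (colsub P Phi) *m Phi) j l != 0 -> wt (P j) <= wt l.
Proof.
move=> rf.
have [P0 uP0] : exists P : {ffun 'I_r -> 'I_N}, colsub P Phi \in unitmx.
  have fullT : row_full Phi^T by rewrite /row_full mxrank_tr.
  exists (fullrankfun fullT); rewrite -unitmx_tr -row_free_unit.
  rewrite (_ : _^T = rowsub (fullrankfun fullT) Phi^T); first exact: fullrowsub_free.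
  by apply/matrixP => i j; rewrite !mxE.
pose tot (P : {ffun 'I_r -> 'I_N}) := \sum_j wt (P j).
case: (arg_minP (P := fun P : {ffun 'I_r -> 'I_N} => colsub P Phi \in unitmx) tot uP0) => P uP Pmin.
exists P; split=> // j l; set B := invmx _; set v := (B *m Phi) => vjl.
pose P' := [ffun i => if i == j then l else P i].
(* Exchanging the pivot of row j for column l multiplies the minor by [E], invertible because
   [v j l] is nonzero; minimality of the total weight concludes. *)
pose E : 'M[F]_r := \matrix_(a, b) if b == j then v a l else (a == b)%:R.
have EE : colsub P' Phi = colsub P Phi *m E.
  apply/matrixP => a b; rewrite !mxE ffunE; have [->|bj] := eqVneq b j.
    transitivity ((colsub P Phi *m v) a l); first by rewrite /v /B mulKVmx.
    by rewrite mxE; apply: eq_bigr => c _; rewrite !mxE eqxx.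
  rewrite (bigD1 b) //= !mxE (negbTE bj) eqxx mulr1 big1 ?addr0 // => c cb.
  by rewrite !mxE (negbTE bj) (negbTE cb) mulr0.
have uE : E \in unitmx.
  rewrite unitmxE unitfE; apply/negP => /det0P[u u0 uE].
  have ub b : b != j -> u 0 b = 0.
    move=> bj; have /rowP/(_ b) := uE; rewrite !mxE (bigD1 b) //= mxE (negbTE bj) eqxx mulr1.
    by rewrite big1 ?addr0 // => c cb; rewrite mxE (negbTE bj) (negbTE cb) mulr0.
  have uj : u 0 j = 0.
    have /rowP/(_ j) := uE; rewrite !mxE (bigD1 j) //= mxE eqxx big1 ?addr0 => [|c cj].
      by move/eqP; rewrite mulf_eq0 (negbTE vjl) orbF => /eqP.
    by rewrite ub ?mul0r.
  move/eqP: u0; apply; apply/rowP => b; rewrite [RHS]mxE.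
  by have [->//|] := eqVneq b j; apply: ub.
have := Pmin P'; rewrite EE unitmx_mul uP uE => /(_ isT).
rewrite /tot (bigD1 j) //= [X in _ <= X](bigD1 j) //= ffunE eqxx.
rewrite [X in _ <= _ + X](eq_bigr (fun i => wt (P i))) ?lerD2r // => i ij.
by rewrite ffunE (negbTE ij).
Qed.

End Pivots.

(** * Auxiliary polynomials in the ideal (F, G) *)

Section IdealData.
Variables (R : realType) (k : closedFieldType) (K : fieldType) (iota : {rmorphism k -> K}) (g : nat).
Hypothesis H : genus_field iota g.
Variable p0 : place iota.

Lemma ideal_basis (F : fieldType) n (P Q : {mpoly F[n]}) (eps : R) :
  0 < eps -> P != 0 -> Q != 0 -> coprime_mpoly P Q ->
  exists (m r : nat) (Phi : 'M[F]_(r, #|expo n m|)) (A B : 'I_r -> {mpoly F[n]}),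
  [/\ (0 < m)%N /\ (0 < r)%N, row_free Phi,
      forall j, A j * P + B j * Q = \sum_l Phi j l *: 'X_[mon (enum_val l)]
    & ((#|expo n m| - r) * (m * n))%N%:R <= eps * r%:R].
Proof.
move=> eps0 P0 Q0 cop.
have [m [m0 dm hm]] := box_asymptotics (fun i => pdeg i P) (fun i => pdeg i Q) eps0.
pose cA i := (m - pdeg i P)%N; pose cB i := (m - pdeg i Q)%N; pose cC i := (m - pdeg i P - pdeg i Q)%N.
have hA i : (cA i + pdeg i P = m)%N by rewrite /cA subnK // (leq_trans _ (dm i)) // leq_addr.
have hB i : (cB i + pdeg i Q = m)%N by rewrite /cB subnK // (leq_trans _ (dm i)) // leq_addl.
have hC i : (cC i + pdeg i P + pdeg i Q = m)%N.
  by have := dm i; rewrite /cC; move: (pdeg i P) (pdeg i Q) => *; lia.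
have [r [Phi [A [B [rf eq le]]]]] := ideal_rank P0 Q0 cop hA hB hC.
have cE : #|expo n m| = (m ^ n)%N by rewrite card_ffun !card_ord.
have rm : (r <= m ^ n)%N by rewrite -cE -(eqP rf) rank_leq_col.
have [r0 ineq] := hm r le rm.
by exists m, r, Phi, A, B; split=> //; rewrite cE.
Qed.

Lemma const_mpoly n (P : {mpoly K[n]}) : (forall x, is_const iota P@_x) ->
  exists P0 : {mpoly k[n]}, P = map_mpoly iota P0.
Proof.
move=> /boolp.choice[c hc]; exists (\sum_(x <- msupp P) c x *: 'X_[x]).
apply/mpolyP => y; rewrite mcoeff_map_mpoly !raddf_sum /= [in LHS](mpolyE P) raddf_sum /=.
apply: eq_bigr => x _; rewrite !mcoeffZ !mcoeffX rmorphM -hc; congr (_ * _).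
by rewrite rmorph_nat.
Qed.

Lemma coprime_map_mpoly n (P Q : {mpoly k[n]}) :
  coprime_mpoly (map_mpoly iota P) (map_mpoly iota Q) -> coprime_mpoly P Q.
Proof.
move=> cop D [U eU] [V eV]; have /cop : mdvd (map_mpoly iota D) (map_mpoly iota P).
  by exists (map_mpoly iota U); rewrite eU rmorphM.
have h2 : mdvd (map_mpoly iota D) (map_mpoly iota Q) by exists (map_mpoly iota V); rewrite eV rmorphM.
move=> /(_ h2); rewrite !msizeE (perm_big _ (msupp_map_mpoly _ (fmorph_inj iota))) //.
Qed.

(* The last clause keeps the error terms proportional to the heights of F and G. *)
Lemma ideal_data n (F G : {mpoly K[n]}) (eps : R) : 0 < eps -> F != 0 -> G != 0 -> coprime_mpoly F G ->
  exists (m r w0 w : nat) (Phi : 'M[K]_(r, #|expo n m|)) (A B : 'I_r -> {mpoly K[n]})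
     (a : 'I_w0 -> K) (b : 'I_w -> K),
  [/\ [/\ (0 < m)%N /\ (0 < r)%N, row_free Phi,
          forall j, A j * F + B j * G = \sum_l Phi j l *: 'X_[mon (enum_val l)]
        & ((#|expo n m| - r) * (m * n))%N%:R <= eps * r%:R],
      [/\ k_indep iota a /\ k_indep iota b,
          forall (P : {ffun 'I_r -> 'I_#|expo n m|}) i j s, kspan iota b (a s * invmx (colsub P Phi) i j),
          (w0 <= w)%N /\ (0 < w)%N & ((w - w0) * (m * n))%N%:R <= eps * w%:R]
    & (forall x, is_const iota F@_x) -> (forall x, is_const iota G@_x) ->
      [/\ forall s, is_const iota (a s), forall s, is_const iota (b s), forall i j, is_const iota (Phi i j),
          forall (P : {ffun 'I_r -> 'I_#|expo n m|}) i j, is_const iota ((invmx (colsub P Phi) *m Phi) i j)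
        & forall j x, is_const iota (A j)@_x /\ is_const iota (B j)@_x]].
Proof.
move=> eps0 F0 G0 cop.
have [m [r [Phi [A [B [[m0 r0] rf eq ineq cst]]]]]] : exists (m r : nat) (Phi : 'M[K]_(r, #|expo n m|)) (A B : 'I_r -> {mpoly K[n]}),
  [/\ (0 < m)%N /\ (0 < r)%N, row_free Phi,
      forall j, A j * F + B j * G = \sum_l Phi j l *: 'X_[mon (enum_val l)],
      ((#|expo n m| - r) * (m * n))%N%:R <= eps * r%:R
    & (forall x, is_const iota F@_x) -> (forall x, is_const iota G@_x) ->
      (exists Phi0, Phi = map_mx iota Phi0) /\ forall j x, is_const iota (A j)@_x /\ is_const iota (B j)@_x].
  (* If F and G have constant coefficients, the linear algebra is carried out over k, so that its
     results are constant too. *)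
  case: (classic ((forall x, is_const iota F@_x) /\ (forall x, is_const iota G@_x))) => [[hF hG]|nc].
    have [P PE] := const_mpoly hF; have [Q QE] := const_mpoly hG.
    have P0 : P != 0 by apply: contraNneq F0 => e; rewrite PE e rmorph0.
    have Q0 : Q != 0 by apply: contraNneq G0 => e; rewrite QE e rmorph0.
    have cop0 : coprime_mpoly P Q by apply: coprime_map_mpoly; rewrite -PE -QE.
    have [m [r [Phi [A [B [mr rf eq ineq]]]]]] := ideal_basis eps0 P0 Q0 cop0.
    exists m, r, (map_mx iota Phi), (fun j => map_mpoly iota (A j)), (fun j => map_mpoly iota (B j)).
    split=> //; first by rewrite row_free_map.
      move=> j; rewrite PE QE -!rmorphM -rmorphD eq rmorph_sum; apply: eq_bigr => l _ /=.
      by rewrite map_mpolyZ map_mpolyX mxE.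
    move=> _ _; split; first by exists Phi.
    by move=> j x; rewrite !mcoeff_map_mpoly; split; eexists.
  have [m [r [Phi [A [B [mr rf eq ineq]]]]]] := ideal_basis eps0 F0 G0 cop.
  by exists m, r, Phi, A, B; split=> // h1 h2; case: nc.
(* All choices of pivots are included: they will vary with the place and the tuple, whereas [a] and
   [b] must be fixed beforehand. *)
pose x (i : {ffun 'I_r -> 'I_#|expo n m|} * ('I_r * 'I_r)) := invmx (colsub i.1 Phi) i.2.1 i.2.2.
have [w0 [w [a [b [ab hsp ww ineq2 cst2]]]]] := coef_space_pair H p0 x (m * n) eps0.
exists m, r, w0, w, Phi, A, B, a, b; split=> //.
  by split=> // P i j s; apply: (hsp s (P, (i, j))).
move=> hF hG; have [[Phi0 PhiE] hAB] := cst hF hG.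
have mapE (P : {ffun 'I_r -> 'I_#|expo n m|}) : invmx (colsub P Phi) = map_mx iota (invmx (colsub P Phi0)).
  by rewrite PhiE map_invmx; congr invmx; apply/matrixP => i j; rewrite !mxE.
have [ha hb] : (forall s, is_const iota (a s)) /\ forall s, is_const iota (b s).
  by apply: cst2 => -[P [i j]]; rewrite /x mapE mxE; eexists.
split=> //; first by move=> i j; rewrite PhiE mxE; eexists.
by move=> P i j; rewrite mapE PhiE -map_mxM mxE; eexists.
Qed.

End IdealData.

Lemma sum_pair (V : nmodType) (I J : finType) (F : I * J -> V) :
  \sum_ij F ij = \sum_i \sum_j F (i, j).
Proof. by rewrite pair_bigA; apply: eq_bigr => -[]. Qed.

(** * Estimates outside and inside S *)

Section UnitMonomials.
Variables (k : closedFieldType) (K : fieldType) (iota : {rmorphism k -> K}) (g : nat).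
Hypothesis H : genus_field iota g.
Variables (S : seq (place iota)) (n : nat) (u : 'I_n -> K).
Hypothesis uS : forall i, u i != 0 /\ forall p : place iota, p \notin S -> pval p (u i) = 0.
Implicit Types (p : place iota).

Definition unit_mon m (x : expo n m) : K := \prod_i u i ^+ x i.

Definition negpart p : int := \sum_i Num.max 0 (- pval p (u i)).
Definition pospart p : int := \sum_i Num.max 0 (pval p (u i)).

Lemma unit_mon_neq0 m (x : expo n m) : unit_mon x != 0.
Proof. by apply/prodf_neq0 => i _; rewrite expf_neq0 //; case: (uS i). Qed.

Lemma pval_unit_mon m (x : expo n m) p : pval p (unit_mon x) = \sum_i pval p (u i) * (x i : nat)%:Z.
Proof.
rewrite /unit_mon pval_prod => [|i]; last by rewrite expf_neq0 //; case: (uS i).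
by apply: eq_bigr => i _; rewrite pvalX -mulr_natr natz.
Qed.

Lemma pval_unit_mon_out m (x : expo n m) p : p \notin S -> pval p (unit_mon x) = 0.
Proof. by move=> pS; rewrite pval_unit_mon big1 // => i _; have [_ ->] := uS i; rewrite ?mul0r. Qed.

Lemma pval_unit_mon_ge m (x : expo n m) p : - (m%:Z * negpart p) <= pval p (unit_mon x).
Proof.
rewrite pval_unit_mon /negpart mulr_sumr -sumrN; apply: ler_sum => i _.
by have := ltn_ord (x i); move: (nat_of_ord (x i)) (pval p (u i)) => a b ab; nia.
Qed.

Lemma pval_unit_mon_le m (x : expo n m) p : pval p (unit_mon x) <= m%:Z * pospart p.
Proof.
rewrite pval_unit_mon /pospart mulr_sumr; apply: ler_sum => i _.
by have := ltn_ord (x i); move: (nat_of_ord (x i)) (pval p (u i)) => a b ab; nia.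
Qed.

Lemma negpart_out p : p \notin S -> negpart p = 0.
Proof. by move=> pS; rewrite /negpart big1 // => i _; have [_ ->] := uS i. Qed.

Lemma pospart_out p : p \notin S -> pospart p = 0.
Proof. by move=> pS; rewrite /pospart big1 // => i _; have [_ ->] := uS i. Qed.

Variable s : seq (place iota).
Hypotheses (us : uniq s) (Ss : {subset S <= s}).

Lemma unit_support i p : pval p (u i) <> 0 -> p \in s.
Proof. by move=> h; apply/Ss/negPn/negP => /(proj2 (uS i)). Qed.

Lemma sum_unit_mon m (x : expo n m) : \sum_(p <- s) pval p (unit_mon x) = 0.
Proof.
apply: (product_formula H (unit_mon_neq0 x) us) => p h.
by apply/Ss/negPn/negP => /(pval_unit_mon_out x).
Qed.

Lemma sum_negpart : \sum_(p <- s) negpart p = (\sum_i ht iota (u i))%N%:Z.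
Proof.
rewrite exchange_big /= -natz natr_sum; apply: eq_bigr => i _.
by rewrite natz (htE us (@unit_support i)).
Qed.

Lemma sum_pospart : \sum_(p <- s) pospart p = (\sum_i ht iota (u i))%N%:Z.
Proof.
rewrite -sum_negpart; apply/eqP; rewrite -subr_eq0 -sumrB; apply/eqP.
rewrite (eq_bigr (fun p => \sum_i pval p (u i))) => [|p _].
  rewrite exchange_big big1 //= => i _.
  by apply: (product_formula H _ us) => [|p]; [case: (uS i)|apply: unit_support].
by rewrite -sumrB; apply: eq_bigr => i _; lia.
Qed.

Lemma meval_vge (P : {mpoly K[n]}) (C : nat) p y : p \notin S ->
  (forall x, vge p (- C%:Z) (y * P@_x)) -> vge p (- C%:Z) (y * P.@[u]).
Proof.
move=> pS hP; rewrite mevalE mulr_sumr; apply: vge_sum => x _.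
rewrite mulrA; apply: vgeMr0 => //.
suff : vge p (\sum_(i < n) 0) (\prod_i u i ^+ x i) by rewrite big1.
apply: vge_prod => i _; rewrite vgeE; last by rewrite expf_neq0 //; case: (uS i).
by rewrite pvalX (proj2 (uS i)) // mul0rn.
Qed.

End UnitMonomials.

(** * The gcd outside S *)

Section GcdOutside.
Variables (k : closedFieldType) (K : fieldType) (iota : {rmorphism k -> K}) (g : nat).
Hypothesis H : genus_field iota g.
Variables (D : K -> K) (T : seq (place iota)) (e : place iota -> int) (M : int).
Hypothesis HD : is_derivation iota D.
Hypothesis Dnz : exists z, D z != 0.
Hypothesis uT : uniq T.
Hypothesis regT : forall (p : place iota) x, p \notin T -> vge p 0 x -> vge p 0 (D x).
Hypothesis lossT : forall (p : place iota) b x, p \in T -> vge p b x -> vge p (b - e p) (D x).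
Hypotheses (eM : \sum_(p <- T) e p <= M) (M0 : 0 <= M).
Variables (S : seq (place iota)) (n : nat) (u : 'I_n -> K).
Hypotheses (uniqS : uniq S) (ST : {subset S <= T}).
Hypothesis uS : forall i, u i != 0 /\ forall p : place iota, p \notin S -> pval p (u i) = 0.
Implicit Types (p : place iota).

Variables (m r w0 w : nat) (Phi : 'M[K]_(r, #|expo n m|)) (A B : 'I_r -> {mpoly K[n]})
  (a : 'I_w0 -> K) (b : 'I_w -> K) (F G : {mpoly K[n]}).
Hypothesis rfPhi : row_free Phi.
Hypothesis ABE : forall j, A j * F + B j * G = \sum_l Phi j l *: 'X_[mon (enum_val l)].
Hypotheses (ia : k_indep iota a) (ib : k_indep iota b) (w0w : (w0 <= w)%N) (w_gt0 : (0 < w)%N) (r_gt0 : (0 < r)%N).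
Hypothesis hspan : forall (P : {ffun 'I_r -> 'I_#|expo n m|}) i j s,
  kspan iota b (a s * invmx (colsub P Phi) i j).
Variables (C : place iota -> nat) (sC : seq (place iota)).
Hypotheses (usC : uniq sC) (hsC : forall p, C p <> 0%N -> p \in sC).
Hypothesis CPhi : forall p t i l, `|pval p (b t * Phi i l)| <= (C p)%:Z.
Hypothesis CA : forall p t j x, vge p (- (C p)%:Z) (b t * (A j)@_x).
Hypothesis CB : forall p t j x, vge p (- (C p)%:Z) (b t * (B j)@_x).
Hypothesis CF : forall p x, vge p (- (C p)%:Z) F@_x.
Hypothesis CG : forall p x, vge p (- (C p)%:Z) G@_x.
Hypothesis CL : forall p (P : {ffun 'I_r -> 'I_#|expo n m|}) t j l,
  vge p (- (C p)%:Z) (a t * (invmx (colsub P Phi) *m Phi) j l).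

Let N := #|expo n m|.
Let U (l : 'I_N) : K := unit_mon u (enum_val l).
Let phi i : K := \sum_l Phi i l * U l.
Let fam (i : 'I_w * 'I_r) : K := b i.1 * phi i.2.

Let phiE i : phi i = (A i).@[u] * F.@[u] + (B i).@[u] * G.@[u].
Proof.
rewrite -!mevalM -mevalD ABE raddf_sum /=; apply: eq_bigr => l _.
by rewrite mevalZ mevalX; congr (_ * _); apply: eq_bigr => j _; rewrite mnmE.
Qed.

Definition gcd_out p : nat := if not_in S p then loc_gcd p F.@[u] G.@[u] else 0%N.

Lemma not_inE p : not_in S p = (p \notin S).
Proof.
by rewrite /not_in; case: excluded_middle_informative => [/List_InP->|h] //; apply/esym/negP => /List_InP.
Qed.

Let vge_gcd p x y : vge p (- (C p)%:Z) x -> vge p (- (C p)%:Z) y ->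
  vge p ((loc_gcd p x y)%:Z - (C p)%:Z) x /\ vge p ((loc_gcd p x y)%:Z - (C p)%:Z) y.
Proof.
rewrite /loc_gcd; have [->|x0] := eqVneq x 0; have [->|y0] := eqVneq y 0; rewrite ?vge_0 //.
- by rewrite !vgeE // /v0 => _ h; split=> //; lia.
- by rewrite !vgeE // /v0 => h _; split=> //; lia.
by rewrite !vgeE // /v0 => h1 h2; split; lia.
Qed.

(** A dependence is a linear relation between unit monomials, with coefficients in the k-span of the
    fixed functions b_t Phi_il. They are not all zero, because [Phi] is row free and [b] is
    independent over k. *)
Lemma dependent_case : ~ kfree iota fam ->
  exists x y : expo n m, x != y /\
    (ht iota (unit_mon u x / unit_mon u y))%:Z <=
      M * 'C(#|{: ('I_w * 'I_r * 'I_N) * 'I_N}|, 2)%:Z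
      + (2 * #|{: ('I_w * 'I_r * 'I_N) * 'I_N}| + 4)%N%:Z * \sum_(p <- sC) (C p)%:Z.
Proof.
move=> nf.
have [c [c0 ec]] : exists c : 'I_w * 'I_r -> k, (exists i, c i != 0) /\ \sum_i iota (c i) * fam i = 0.
  apply: NNPP => nex; apply: nf => c ec i; apply: NNPP => /eqP ci; apply: nex.
  by exists c; split=> //; exists i.
pose es (q : 'I_w * 'I_r * 'I_N) := b q.1.1 * Phi q.1.2 q.2.
pose y j := \sum_t iota (c (t, j)) * b t.
pose ga l := \sum_j y j * Phi j l.
have rel : \sum_l ga l * U l = 0.
  rewrite -[RHS]ec sum_pair [RHS]exchange_big /=.
  under eq_bigr do rewrite mulr_suml.
  rewrite exchange_big; apply: eq_bigr => j _ /=.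
  rewrite /fam /= /phi; under [RHS]eq_bigr do rewrite mulrA.
  by rewrite -mulr_suml mulr_sumr; apply: eq_bigr => l _; rewrite mulrA.
have ga0 : exists l, ga l != 0.
  apply: NNPP => nex; have gz l : ga l = 0 by apply/eqP/negPn/negP => h; apply: nex; exists l.
  have : (\row_j y j) *m Phi = 0.
    by apply/rowP => l; rewrite !mxE -[RHS](gz l); apply: eq_bigr => j _; rewrite mxE.
  rewrite -[RHS](mul0mx _ Phi) => /(row_free_inj rfPhi) yz.
  case: c0 => -[t j] /eqP; apply; apply: (ib (c := fun t => c (t, j))).
  by have /rowP/(_ j) := yz; rewrite !mxE.
have gspan l : kspan iota es (ga l).
  exists (fun q => if q.2 == l then c q.1 else 0).
  rewrite sum_pair /= [RHS](eq_bigr (fun q => iota (c q) * es (q, l))) => [|q _]; last first.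
    by rewrite (bigD1 l) //= eqxx big1 ?addr0 // => l' /negbTE->; rewrite rmorph0 mul0r.
  rewrite sum_pair /= exchange_big.
  by apply: eq_bigr => j _; rewrite mulr_suml; apply: eq_bigr => t _; rewrite mulrA.
have U0 l : U l != 0 by exact: (unit_mon_neq0 uS).
have Uout l p : p \notin S -> pval p (U l) = 0 by exact: (pval_unit_mon_out uS).
have Ces q p : `|pval p (es q)| <= (C p)%:Z by apply: CPhi.
have [l [l' [ll hh]]] := unit_relation H HD Dnz uT regT lossT ST eM M0 U0 Uout Ces usC hsC gspan ga0 rel.
by exists (enum_val l), (enum_val l'); split=> //; rewrite (inj_eq enum_val_inj).
Qed.

(** Distinct pivots account for r of the N monomials; each of the others has order at most m times
    [pospart]. *)
Lemma pivot_sum p (P : {ffun 'I_r -> 'I_N}) : colsub P Phi \in unitmx ->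
  \sum_l pval p (U l) - ((N - r)%N%:Z * (m%:Z * pospart u p)) <= \sum_j pval p (U (P j)).
Proof.
move=> uP.
have Pinj : injective P.
  move=> i j Pij; apply/eqP/negPn/negP => ij; move: uP; rewrite -unitmx_tr unitmxE unitfE.
  rewrite (determinant_alternate ij) ?eqxx // => l; rewrite !mxE Pij //.
have cP : #|[set P j | j : 'I_r]| = r by rewrite card_imset // card_ord.
rewrite (bigID (fun l => l \in [set P j | j : 'I_r])) /=.
rewrite (big_imset _ (in2W Pinj)) /= (eq_bigl predT) //.
rewrite -addrA gerDl subr_le0.
apply: (@le_trans _ _ (\sum_(l | l \notin [set P j | j : 'I_r]) (m%:Z * pospart u p))).
  by apply: ler_sum => l _; exact: (pval_unit_mon_le uS).
rewrite sumr_const -mulr_natl natz.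
have h (c1 c2 c3 : nat) : (c1 + c2 = c3)%N -> c1 = r -> c3 = N -> c2 = (N - r)%N by lia.
by rewrite (h _ _ _ (cardC (mem [set P j | j : 'I_r])) cP (card_ord N)).
Qed.

(** The adapted elements are [a t] times the rows reduced to pivots of least order, so that their
    order is that of the pivot up to [C p]. The (w - w0) r missing basis elements get the crude
    bound. *)
Lemma adapted_free p : kfree iota fam -> p \in S ->
  exists P : {ffun 'I_r -> 'I_N}, colsub P Phi \in unitmx /\
  adapted T fam p (\sum_(tj : 'I_w0 * 'I_r) (pval p (U (P tj.2)) - (C p)%:Z)
     + (#|{: 'I_w * 'I_r}|%:Z - #|{: 'I_w0 * 'I_r}|%:Z) * - (m%:Z * negpart u p + (C p)%:Z)).
Proof.
move=> hfree pS; have [P [uP hP]] := pivots_ex (fun l => pval p (U l)) rfPhi.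
exists P; split=> //; set Bm := invmx (colsub P Phi) in hP *.
have [kap0 hkap0] := boolp.choice (fun tji : 'I_w0 * ('I_r * 'I_r) => hspan P tji.2.1 tji.2.2 tji.1).
pose kap t j i s := kap0 (t, (j, i)) s.
have hkap t j i : a t * Bm j i = \sum_s iota (kap t j i s) * b s := hkap0 (t, (j, i)).
pose h (tj : 'I_w0 * 'I_r) : K := a tj.1 * \sum_i Bm tj.2 i * phi i.
have hE tj : h tj = \sum_l a tj.1 * (Bm *m Phi) tj.2 l * U l.
  rewrite /h mulr_sumr (eq_bigr (fun i => \sum_l a tj.1 * (Bm tj.2 i * Phi i l) * U l)) => [|i _]; last first.
    by rewrite /phi mulr_sumr mulr_sumr; apply: eq_bigr => l _; rewrite !mulrA.
  rewrite exchange_big /=; apply: eq_bigr => l _.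
  by rewrite mxE mulr_sumr mulr_suml.
have hcomb tj : h tj = \sum_(si : 'I_w * 'I_r) iota (kap tj.1 tj.2 si.2 si.1) * fam si.
  rewrite sum_pair exchange_big /= /h mulr_sumr; apply: eq_bigr => i _.
  by rewrite mulrA hkap mulr_suml; apply: eq_bigr => s _; rewrite mulrA.
exists ('I_w0 * 'I_r)%type, h, (fun tj => pval p (U (P tj.2)) - (C p)%:Z), (- (m%:Z * negpart u p + (C p)%:Z)).
split; last by rewrite (ST pS).
split=> //.
- move=> d hd.
  (* Freeness of [fam] turns a relation into one between the products [a t * Bm j i]; then
     invertibility of [Bm] and independence of [a] apply. *)
  have ez si : \sum_tj d tj * kap tj.1 tj.2 si.2 si.1 = 0.
    apply: (hfree (fun si => \sum_tj d tj * kap tj.1 tj.2 si.2 si.1)).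
    rewrite -[RHS]hd; under [RHS]eq_bigr do rewrite hcomb mulr_sumr.
    rewrite exchange_big /=; apply: eq_bigr => si' _.
    by rewrite rmorph_sum mulr_suml; apply: eq_bigr => tj _; rewrite rmorphM mulrA.
  pose y j := \sum_t iota (d (t, j)) * a t.
  have yB : (\row_j y j) *m Bm = 0.
    apply/rowP => i; rewrite !mxE.
    transitivity (\sum_(tj : 'I_w0 * 'I_r) iota (d tj) * (a tj.1 * Bm tj.2 i)).
      rewrite sum_pair exchange_big /=; apply: eq_bigr => j _.
      by rewrite mxE mulr_suml; apply: eq_bigr => t _; rewrite mulrA.
    transitivity (\sum_s \sum_(tj : 'I_w0 * 'I_r) iota (d tj * kap tj.1 tj.2 i s) * b s).
      rewrite exchange_big /=; apply: eq_bigr => tj _; rewrite hkap mulr_sumr.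
      by apply: eq_bigr => s _; rewrite rmorphM mulrA.
    by apply: big1 => s _; rewrite -mulr_suml -rmorph_sum (ez (s, i)) rmorph0 mul0r.
  have y0 : \row_j y j = 0 by rewrite -[LHS](mulmxK (_ : Bm \in unitmx)) ?yB ?mul0mx // unitmx_inv.
  move=> [t j]; apply: (ia (c := fun t => d (t, j))).
  by have /rowP/(_ j) := y0; rewrite !mxE.
- by move=> tj; exists (fun si => kap tj.1 tj.2 si.2 si.1).
- move=> tj; rewrite hE; apply: vge_sum => l _.
  have [->|nz] := eqVneq ((Bm *m Phi) tj.2 l) 0; first by rewrite mulr0 mul0r vge_0.
  by rewrite addrC; apply: vgeM; [apply: CL|apply: vgeW (vge_pval _ _); apply: hP].
move=> [t i]; rewrite /fam /= /phi mulr_sumr; apply: vge_sum => l _.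
rewrite mulrA opprD addrC; apply: vgeM; last by apply: vgeW (vge_pval _ _); exact: (pval_unit_mon_ge uS).
by apply: vgeW (vge_pval _ _); have := CPhi p t i l; lia.
Qed.

(** Each phi_i is A_i F + B_i G; one [C p] pays for the poles of b A_i and b B_i, the other for
    those of F and G. *)
Lemma fam_gcd p i : p \notin S -> vge p ((loc_gcd p F.@[u] G.@[u])%:Z - 2 * (C p)%:Z) (fam i).
Proof.
move=> pS.
have hF : vge p (- (C p)%:Z) F.@[u].
  by rewrite -[F.@[u]]mul1r; apply: (meval_vge uS) => // x; rewrite mul1r; apply: CF.
have hG : vge p (- (C p)%:Z) G.@[u].
  by rewrite -[G.@[u]]mul1r; apply: (meval_vge uS) => // x; rewrite mul1r; apply: CG.
have [h1 h2] := vge_gcd hF hG.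
rewrite /fam phiE mulrDr !mulrA.
have -> : (loc_gcd p F.@[u] G.@[u])%:Z - 2 * (C p)%:Z = - (C p)%:Z + ((loc_gcd p F.@[u] G.@[u])%:Z - (C p)%:Z) by ring.
by apply: vgeD; apply: vgeM => //; apply: (meval_vge uS).
Qed.

Lemma arith_adapted (x C' c1 y : int) (w' w0' r' : nat) : (w0' <= w')%N -> 0 <= C' ->
  y <= x -> w0'%:Z * y - 2 * (w' * r')%N%:Z * C' - ((w' - w0') * r')%N%:Z * c1 <=
   w0'%:Z * x - (w0' * r')%N%:Z * C' + ((w' * r')%N%:Z - (w0' * r')%N%:Z) * - (c1 + C').
Proof.
move=> ww C0 yx; have h : 0 <= w0'%:Z * (x - y) by apply: mulr_ge0 => //; lia.
have h2 : 0 <= (w' * r')%N%:Z * C' by apply: mulr_ge0.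
have -> : ((w' - w0') * r')%N%:Z = (w' * r')%N%:Z - (w0' * r')%N%:Z by rewrite mulnBl -subzn // leq_mul2r ww orbT.
move: h h2; move: (w0'%:Z) ((w' * r')%N%:Z) ((w0' * r')%N%:Z) => V W Z h h2.
rewrite -subr_ge0 (_ : _ - _ = V * (x - y) + W * C'); last by ring.
exact: addr_ge0.
Qed.

(** Summing local bounds, the orders of all N monomials cancel by the product formula, so that only
    the deficits N - r and w - w0 remain. If F and G both vanished at [u], the family would be
    zero. *)
Lemma free_case : kfree iota fam -> (F.@[u] != 0 \/ G.@[u] != 0) /\
  (w * r)%N%:Z * (fsumn gcd_out)%:Z <= M * 'C(w * r, 2)%:Z + 2 * (w * r)%N%:Z * \sum_(p <- sC) (C p)%:Z
     + ((w0 * (N - r) + (w - w0) * r) * m)%N%:Z * (\sum_i ht iota (u i))%N%:Z.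
Proof.
move=> hfree; split.
  apply: NNPP => /not_or_and[/negP/negPn/eqP F0 /negP/negPn/eqP G0].
  have := kfree_neq0 (Ordinal w_gt0, Ordinal r_gt0) hfree.
  by rewrite /fam phiE F0 G0 !mulr0 addr0 mulr0 eqxx.
have cwr : #|{: 'I_w * 'I_r}| = (w * r)%N by rewrite card_prod !card_ord.
have cw0r : #|{: 'I_w0 * 'I_r}| = (w0 * r)%N by rewrite card_prod !card_ord.
(* One formula for all places, ready for summation: the gcd term is 0 on S, the monomial terms are 0
   outside S. *)
pose LB p : int := (w * r)%N%:Z * (gcd_out p)%:Z - 2 * (w * r)%N%:Z * (C p)%:Z
  + (w0%:Z * (\sum_l pval p (U l) - (N - r)%N%:Z * (m%:Z * pospart u p)) - ((w - w0) * r)%N%:Z * (m%:Z * negpart u p)).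
have exB p : exists Bp, [/\ adapted T fam p Bp, LB p <= Bp &
     (p \notin S -> Bp = (w * r)%N%:Z * ((loc_gcd p F.@[u] G.@[u])%:Z - 2 * (C p)%:Z))].
  have [pS|pS] := boolP (p \in S).
    have [P [uP ad]] := adapted_free hfree pS; eexists; split; [exact: ad| |by []].
    have sE : \sum_(tj : 'I_w0 * 'I_r) (pval p (U (P tj.2)) - (C p)%:Z) =
        w0%:Z * \sum_j pval p (U (P j)) - (w0 * r)%N%:Z * (C p)%:Z.
      rewrite sumrB sum_pair /= sumr_const card_ord -mulr_natl natz; congr (_ - _).
      by rewrite sumr_const cw0r -mulr_natl natz.
    rewrite cwr cw0r sE /LB /gcd_out not_inE pS mulr0 sub0r.
    rewrite addrCA addrA.
    have Cp0 : 0 <= (C p)%:Z by [].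
    exact (arith_adapted (m%:Z * negpart u p) r w0w Cp0 (pivot_sum p uP)).
  exists ((w * r)%N%:Z * ((loc_gcd p F.@[u] G.@[u])%:Z - 2 * (C p)%:Z)); split=> //.
    by rewrite -cwr; apply: adapted_regular => i; apply: fam_gcd.
  rewrite /LB /gcd_out not_inE pS (pospart_out uS pS) (negpart_out uS pS) !mulr0 !subr0.
  rewrite big1 ?mulr0 ?addr0 => [|l _]; last exact: (pval_unit_mon_out uS).
  by rewrite mulrBr mulrCA mulrA.
have [B0 hB0] := boolp.choice exB.
have [sF hsF] := fin_support H F.@[u]; have [sG hsG] := fin_support H G.@[u].
pose s := undup (sC ++ S ++ sF ++ sG).
have us : uniq s := undup_uniq _.
have Ss : {subset S <= s} by move=> p pS; rewrite mem_undup !mem_cat pS orbT.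
have gsupp p : loc_gcd p F.@[u] G.@[u] <> 0%N -> p \in s.
  rewrite mem_undup !mem_cat => h; have [/hsF->|/hsG->] : pval p F.@[u] <> 0 \/ pval p G.@[u] <> 0; rewrite ?orbT //.
  move: h; rewrite /loc_gcd /v0; case: eqP => _; last case: eqP => _; lia.
have B0s p : B0 p <> 0 -> p \in s.
  have [pS|pS] := boolP (p \in S); first by move=> _; apply: Ss.
  have [_ _ ->] := hB0 p => //; have [cp|cp] := eqVneq (C p) 0%N; last first.
    by move=> _; rewrite mem_undup mem_cat hsC //; apply/eqP.
  have [gp|gp _] := eqVneq (loc_gcd p F.@[u] G.@[u]) 0%N; first by rewrite cp gp !mulr0.
  by apply: gsupp; apply/eqP.
have hA p : adapted T fam p (B0 p) by case: (hB0 p).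
have := wronskian_inequality H HD Dnz uT regT lossT hfree hA us B0s; rewrite cwr => ineq.
have gcdE : (fsumn gcd_out)%:Z = \sum_(p <- s) (gcd_out p)%:Z.
  by apply: fsumnE => // p; rewrite /gcd_out; case: ifP => // _; apply: gsupp.
have CE : \sum_(p <- sC) (C p)%:Z = \sum_(p <- s) (C p)%:Z.
  have Cnz p : (C p)%:Z <> 0 -> p \in sC by move=> h; apply: hsC => h'; apply: h; rewrite h'.
  by apply: sum_support => // p /Cnz ps; rewrite mem_undup mem_cat ps.
have sumLB : \sum_(p <- s) LB p <= M * 'C(w * r, 2)%:Z.
  apply: le_trans (_ : \sum_(p <- s) B0 p <= _); first by apply: ler_sum => p _; case: (hB0 p).
  by apply: le_trans ineq _; apply: ler_wpM2r.
have sU : \sum_(p <- s) \sum_l pval p (U l) = 0.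
  by rewrite exchange_big big1 //= => l _; apply: (sum_unit_mon H uS us Ss).
move: sumLB; rewrite /LB big_split /= sumrB sumrB -!mulr_sumr sumrB sU -!mulr_sumr.
rewrite -gcdE -CE (sum_pospart H uS us Ss) (sum_negpart uS us Ss).
move: (fsumn gcd_out)%:Z (\sum_(p <- sC) _) (\sum_i ht iota (u i))%N%:Z (M * _) => x1 x2 x3 x4.
have e1 : ((w0 * (N - r) + (w - w0) * r) * m)%N%:Z * x3 =
   w0%:Z * ((N - r)%N%:Z * (m%:Z * x3)) + ((w - w0) * r)%N%:Z * (m%:Z * x3) by rewrite !PoszM PoszD PoszM; ring.
rewrite e1 sub0r mulrN.
move: (w0%:Z * _) (_ * (m%:Z * x3)) ((w * r)%N%:Z * x1) (2 * _ * x2) => y1 y2 y3 y4.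
by lia.
Qed.

End GcdOutside.

(** * Zeros of F(g) inside S *)

Section ProximityInside.
Variables (k : closedFieldType) (K : fieldType) (iota : {rmorphism k -> K}) (g : nat).
Hypothesis H : genus_field iota g.
Variables (D : K -> K) (T : seq (place iota)) (e : place iota -> int) (M : int).
Hypothesis HD : is_derivation iota D.
Hypothesis Dnz : exists z, D z != 0.
Hypothesis uT : uniq T.
Hypothesis regT : forall (p : place iota) x, p \notin T -> vge p 0 x -> vge p 0 (D x).
Hypothesis lossT : forall (p : place iota) b x, p \in T -> vge p b x -> vge p (b - e p) (D x).
Hypotheses (eM : \sum_(p <- T) e p <= M) (M0 : 0 <= M).
Variables (S : seq (place iota)) (n : nat) (u : 'I_n -> K).
Hypotheses (uniqS : uniq S) (ST : {subset S <= T}).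
Hypothesis uS : forall i, u i != 0 /\ forall p : place iota, p \notin S -> pval p (u i) = 0.
Implicit Types (p : place iota).

Variables (m w : nat) (b : 'I_w -> K) (F : {mpoly K[n]}).
Hypotheses (m_gt0 : (0 < m)%N) (ib : k_indep iota b).
Hypothesis boxF : inbox (fun=> m) F.
Hypothesis F0 : F@_0 != 0.
Hypothesis spanF : forall x, kspan iota b F@_x.
Variables (C : place iota -> nat) (sC : seq (place iota)).
Hypotheses (usC : uniq sC) (hsC : forall p, C p <> 0%N -> p \in sC).
Hypothesis Cb : forall p t, `|pval p (b t)| <= (C p)%:Z.

Let N := #|expo n m|.
Let U (l : 'I_N) : K := unit_mon u (enum_val l).
Let fam (i : 'I_w * 'I_N) : K := b i.1 * U i.2.

(** The previous dependent case with [Phi] the identity matrix. *)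
Lemma monomials_dependent : ~ kfree iota fam ->
  exists x y : expo n m, x != y /\
    (ht iota (unit_mon u x / unit_mon u y))%:Z <=
      M * 'C(#|{: ('I_w * 'I_N * 'I_N) * 'I_N}|, 2)%:Z
      + (2 * #|{: ('I_w * 'I_N * 'I_N) * 'I_N}| + 4)%N%:Z * \sum_(p <- sC) (C p)%:Z.
Proof.
move=> nf; have C1 p t i l : `|pval p (b t * (1%:M : 'M[K]_N) i l)| <= (C p)%:Z.
  by rewrite mxE; case: eqP => _; rewrite ?mulr1 // mulr0 pval0 normr0.
have rf1 : row_free (1%:M : 'M[K]_N) by rewrite row_free_unit unitmx1.
apply: (dependent_case H HD Dnz uT regT lossT eM M0 ST uS rf1 ib usC hsC C1) => hf; apply: nf => c hc.
apply: hf; rewrite -[RHS]hc; apply: eq_bigr => i _; congr (_ * (_ * _)).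
rewrite (bigD1 i.2) //= mxE eqxx mul1r big1 ?addr0 // => l; rewrite mxE eq_sym => /negbTE->.
by rewrite mul0r.
Qed.

Lemma evalF_expand : F.@[u] = \sum_l F@_(mon (enum_val l)) * U l.
Proof.
have box_all : box m (fun=> m) = [set: expo n m].
  by apply/setP => x; rewrite !inE; apply/forallP => i.
rewrite {1}(inbox_sum (fun i => leqnn m) boxF) raddf_sum box_all /=.
rewrite (eq_bigl predT) => [|x]; last by rewrite inE.
rewrite sum_ord; apply: eq_bigr => l _; rewrite mevalZ mevalX; congr (_ * _).
by apply: eq_bigr => j _; rewrite mnmE.
Qed.

(* Replacing the term of the constant monomial by F(u) at p in S improves the bound by v_p(F(u)). *)
Lemma proximity_inside : kfree iota fam -> F.@[u] != 0 /\
  \sum_(p <- S) (v0 p F.@[u])%:Z <= M * 'C(w * N, 2)%:Z + (w * N)%N%:Z * \sum_(p <- sC) (C p)%:Z.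
Proof.
move=> hfree.
have [al hal] := boolp.choice (fun l : 'I_N => spanF (mon (enum_val l))).
have FE : F.@[u] = \sum_(i : 'I_w * 'I_N) iota (al i.2 i.1) * fam i.
  rewrite evalF_expand sum_pair exchange_big /=; apply: eq_bigr => l _.
  by rewrite hal mulr_suml; apply: eq_bigr => t _; rewrite mulrA.
pose x0 : expo n m := [ffun=> Ordinal m_gt0]; pose l0 := enum_rank x0.
have mon0 : mon (enum_val l0) = 0%MM by apply/mnmP => j; rewrite mnmE mnm0E enum_rankK ffunE.
have Ul0 : U l0 = 1 by rewrite /U enum_rankK /unit_mon big1 // => j _; rewrite ffunE expr0.
(* The constant monomial has value 1 and F a nonzero constant term, so F(u) can replace the element
   [(t0, l0)] of the family. *)
have [t0 at0] : exists t0, al l0 t0 != 0.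
  apply: NNPP => nex; move/eqP: F0; apply; rewrite -mon0 hal big1 // => t _.
  have [->|h] := eqVneq (al l0 t) 0; first by rewrite rmorph0 mul0r.
  by case: nex; exists t.
pose i0 := (t0, l0).
have famnz i : fam i != 0 by apply: kfree_neq0 hfree.
have free' := kfree_replace hfree FE (i0 := i0) at0.
have Fu0 : F.@[u] != 0 by have := kfree_neq0 i0 free'; rewrite eqxx.
split=> //.
have cwN : #|{: 'I_w * 'I_N}| = (w * N)%N by rewrite card_prod !card_ord.
pose beta p (i : 'I_w * 'I_N) : int := pval p (U i.2) - (C p)%:Z.
have hbeta p i : vge p (beta p i) (fam i).
  rewrite /beta addrC; apply: vgeM; last exact: vge_pval.
  by apply: vgeW (vge_pval _ _); have := Cb p i.1; lia.
pose B p : int := if p \in S then \sum_i beta p i + (v0 p F.@[u])%:Z else #|{: 'I_w * 'I_N}|%:Z * - (C p)%:Z.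
have hB p : adapted T fam p (B p).
  rewrite /B; have [pS|pS] := boolP (p \in S); last first.
    apply: adapted_regular => i; have := hbeta p i.
    by rewrite /beta (pval_unit_mon_out uS) // sub0r.
  have -> : \sum_i beta p i + (v0 p F.@[u])%:Z =
      \sum_i (if i == i0 then beta p i + (v0 p F.@[u])%:Z else beta p i).
    rewrite (bigD1 i0) //= [RHS](bigD1 i0) //= eqxx addrAC; congr (_ + _).
    by apply: eq_bigr => i /negbTE->.
  have [pos|npos] := boolP (0 < pval p F.@[u]).
    apply: (adapted_full (ST pS) free') => // i; case: eqP => [ei|_] //.
    - by exists (fun i => al i.2 i.1).
    - exact: kspan_mem.
    rewrite ei; apply: vgeW (vge_pval _ _); rewrite /beta /= Ul0 pval1 /v0; lia.
  apply: (adapted_full (ST pS) hfree) => // i; first exact: kspan_mem.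
  have v00 : v0 p F.@[u] = 0%N by rewrite /v0; lia.
  by case: eqP => _ //; rewrite v00 addr0.
have [sF hsF] := fin_support H F.@[u].
pose s := undup (sC ++ S ++ sF).
have us : uniq s := undup_uniq _.
have Ss : {subset S <= s} by move=> p pS; rewrite mem_undup !mem_cat pS orbT.
have Bs p : B p <> 0 -> p \in s.
  rewrite /B; have [pS _|pS h] := boolP (p \in S); first exact: Ss.
  rewrite mem_undup mem_cat hsC // => Cp; apply: h; rewrite Cp oppr0 mulr0 //.
have := wronskian_inequality H HD Dnz uT regT lossT hfree hB us Bs; rewrite cwN => ineq.
have CE : \sum_(p <- sC) (C p)%:Z = \sum_(p <- s) (C p)%:Z.
  have Cnz p : (C p)%:Z <> 0 -> p \in sC by move=> h; apply: hsC => h'; apply: h; rewrite h'.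
  by apply: sum_support => // p /Cnz ps; rewrite mem_undup mem_cat ps.
pose vS p : int := if p \in S then (v0 p F.@[u])%:Z else 0.
have vSE : \sum_(p <- S) (v0 p F.@[u])%:Z = \sum_(p <- s) vS p.
  rewrite big_seq (eq_bigr vS) => [|p pS]; last by rewrite /vS pS.
  rewrite -big_seq; apply: sum_support => // p; rewrite /vS; case: ifP => // pS _.
  exact: Ss.
have LB p : vS p + \sum_(i : 'I_w * 'I_N) pval p (U i.2) - (w * N)%N%:Z * (C p)%:Z <= B p.
  rewrite /vS /B; have [pS|pS] := boolP (p \in S).
    rewrite /beta sumrB sumr_const -[_ *+ _]mulr_natl natz cwN.
    by rewrite -addrA [X in X <= _]addrC.
  rewrite big1 ?addr0 ?sub0r ?cwN ?mulrN // => i _; exact: (pval_unit_mon_out uS).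
have sU : \sum_(p <- s) \sum_(i : 'I_w * 'I_N) pval p (U i.2) = 0.
  by rewrite exchange_big big1 //= => i _; apply: (sum_unit_mon H uS us Ss).
have : \sum_(p <- s) (vS p + \sum_(i : 'I_w * 'I_N) pval p (U i.2) - (w * N)%N%:Z * (C p)%:Z) <= M * 'C(w * N, 2)%:Z.
  apply: le_trans (_ : \sum_(p <- s) B p <= _); first by apply: ler_sum => p _.
  by apply: le_trans ineq _; apply: ler_wpM2r.
rewrite sumrB big_split /= sU addr0 -mulr_sumr -CE -vSE.
by rewrite lerBlDr.
Qed.

End ProximityInside.

(** * Bounds attached to finitely many functions *)

Section DataBounds.
Variables (k : closedFieldType) (K : fieldType) (iota : {rmorphism k -> K}) (g : nat).
Hypothesis H : genus_field iota g.
Implicit Types (p : place iota).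

Definition abs_pvals (X : seq K) p : nat := (\sum_(x <- X) absz (pval p x))%N.

Lemma abs_pvals_mem (X : seq K) p x : x \in X -> `|pval p x| <= (abs_pvals X p)%:Z.
Proof.
rewrite /abs_pvals; elim: X => // y X IH; rewrite inE big_cons => /orP[/eqP<-|/IH]; lia.
Qed.

Lemma vge_abs_pvals (X : seq K) p x : x \in X -> vge p (- (abs_pvals X p)%:Z) x.
Proof. by move=> /(abs_pvals_mem p) h; apply: vgeW (vge_pval _ _); lia. Qed.

Lemma abs_pvals_fin (X : seq K) : exists2 s : seq (place iota), uniq s &
  forall p, abs_pvals X p <> 0%N -> p \in s.
Proof.
apply: fin_places_uniq; elim: X => [|x X IH]; first by exists [::] => p; rewrite /abs_pvals big_nil.
apply: fin_placesS (fin_placesU (fin_support H x) IH) => p; rewrite /abs_pvals big_cons.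
by have [->|] := eqVneq (pval p x) 0; [right|move=> /eqP; left].
Qed.

Lemma abs_pvals_const (X : seq K) p : (forall x, x \in X -> is_const iota x) -> abs_pvals X p = 0%N.
Proof.
move=> h; rewrite /abs_pvals big_seq big1 // => x /h[c ->].
by rewrite pval_const.
Qed.

Lemma foldr_min_le (s : seq int) (z0 z : int) : z \in s -> foldr Num.min z0 s <= z.
Proof.
by elim: s => //= y s IH; rewrite inE ge_min => /orP[/eqP->|/IH->]; rewrite ?lexx ?orbT.
Qed.

Lemma foldr_min0 (s : seq int) : (forall z, z \in s -> z = 0) -> foldr Num.min (head 0 s) s = 0.
Proof.
move=> h; have -> : head 0 s = 0 by case: s h => //= y s; apply; rewrite mem_head.
elim: s h => //= y s IH h; rewrite IH; last by move=> z zs; apply: h; rewrite inE zs orbT.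
by rewrite (h y) ?mem_head.
Qed.

(** Height 0 leaves the coefficients without poles, and functions regular everywhere are
    constant. *)
Lemma htilde_const n (p0 : place iota) (F : {mpoly K[n]}) : htilde iota F = 0%N ->
  forall x, is_const iota F@_x.
Proof.
move=> hF x; pose X := [seq F@_y | y <- msupp F].
have [s us hs] := abs_pvals_fin X.
have v0 p : abs_pvals X p = 0%N -> vpoly p F = 0.
  move=> h; apply: foldr_min0 => z /mapP[y yF ->].
  by have := @abs_pvals_mem X p F@_y (map_f _ yF); rewrite h; lia.
have supp p : absz (Num.max 0 (- vpoly p F)) <> 0%N -> p \in s.
  by move=> h; apply: hs => /v0 h0; apply: h; rewrite h0.
have ge0 p : 0 <= vpoly p F.
  have [ps|ps] := boolP (p \in s); last first.
    have : ~ absz (Num.max 0 (- vpoly p F)) <> 0%N by move/supp; apply/negP.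
    by lia.
  have := fsumnE us supp; rewrite -/(htilde iota F) hF => /esym/eqP.
  rewrite psumr_eq0 // => /allP/(_ p ps); lia.
have [xF|xF] := boolP (x \in msupp F); last by exists 0; rewrite rmorph0; apply/eqP; rewrite mcoeff_eq0.
apply: (regular_const H p0) => p; apply: vgeW (vge_pval _ _).
by apply: le_trans (ge0 p) _; apply: foldr_min_le; apply/mapP; exists x.
Qed.

End DataBounds.

(** * Uniformity in S and in the tuple *)

Section Uniform.
Variables (R : realType) (k : closedFieldType) (K : fieldType) (iota : {rmorphism k -> K}) (g : nat).
Hypothesis H : genus_field iota g.
Variable p0 : place iota.
Implicit Types (S : seq (place iota)).

(** Minus the Euler characteristic of the curve punctured at S, truncated at 0. *)
Definition chi S : int := Num.max 0 (2 * g%:Z - 2 + (size S)%:Z).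

Lemma chi_ge0 S : 0 <= chi S. Proof. by rewrite le_max lexx. Qed.

Lemma sunit_pval S n (u : 'I_n -> K) : (forall i, S_unit S (u i)) ->
  forall i, u i != 0 /\ forall p : place iota, p \notin S -> pval p (u i) = 0.
Proof.
move=> hu i; have [h1 h2] := hu i; split=> // p /negP pS; apply: h2.
by move=> /List_InP.
Qed.

Lemma sum_ht_le n (u : 'I_n -> K) : (\sum_i ht iota (u i) <= n * hmax iota u)%N.
Proof.
apply: (@leq_trans (\sum_(i < n) hmax iota u)); last by rewrite sum_nat_const card_ord.
by apply: leq_sum => i _; apply: (leq_bigmax (F := fun i => ht iota (u i))).
Qed.

(** Division by the size w r of the family: the deficits [Nr] of monomials and [d] of dimension
    contribute eps / 2 each. *)
Lemma average_bound (w w0 d r Nr mn hm Ng cs B eps : R) : 0 <= w0 <= w -> 0 <= r -> 1 <= w * r ->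
  0 <= hm -> 0 <= B -> Nr * mn <= eps / 2 * r -> d * mn <= eps / 2 * w ->
  w * r * Ng <= B + 2 * (w * r) * cs + (w0 * Nr + d * r) * mn * hm -> 0 <= Nr * mn ->
  Ng <= B + 2 * cs + eps * hm.
Proof.
move=> /andP[w0p w0w] r0 wr hm0 B0 h1 h2 hN hNr.
have wr0 : 0 < w * r by apply: lt_le_trans wr.
rewrite -(ler_pM2l wr0); apply: le_trans hN _.
have e1 : w0 * (Nr * mn) <= w * (eps / 2 * r) by apply: ler_pM.
have e2 : d * mn * r <= eps / 2 * w * r by apply: ler_wpM2r.
have e3 : (w0 * Nr + d * r) * mn * hm <= eps * (w * r) * hm by apply: ler_wpM2r => //; lra.
have e4 : B <= w * r * B by rewrite ler_peMl.
by move: e3 e4; lra.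
Qed.

(* [h] stands for the heights of the polynomials involved: it matters only through the fact
   that all coefficients are constant when it vanishes. *)
Lemma uniform_outside n (F G : {mpoly K[n]}) (eps : R) (h : nat) : 0 < eps ->
  F != 0 -> G != 0 -> coprime_mpoly F G ->
  (h = 0%N -> forall x, is_const iota F@_x /\ is_const iota G@_x) ->
  exists m c : nat, forall S (u : 'I_n -> K), uniq S -> S != [::] -> (forall i, S_unit S (u i)) ->
    (exists x y : expo n m, x != y /\
       (ht iota (unit_mon u x / unit_mon u y))%:Z <= c%:Z * (chi S + h%:Z)) \/
    ((F.@[u] != 0 \/ G.@[u] != 0) /\
       (fsumn (gcd_out S u F G))%:R <= c%:R * (chi S + h%:Z)%:~R + eps * (hmax iota u)%:R).
Proof.
move=> eps0 F0 G0 cop hconst; have eps2 : 0 < eps / 2 by rewrite divr_gt0.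
have [m [r [w0 [w [Phi [A [B [a [b [[[m0 r0] rf ABE ineq1] [[ia ib] hsp [w0w wgt] ineq2] cst]]]]]]]]]] :=
  ideal_data H p0 eps2 F0 G0 cop.
have [C0 hder] := derivation_ex H.
(* The functions of K whose orders enter the estimates; the list is fixed before S and [u]. *)
pose X := [seq b x.1.1 * Phi x.1.2 x.2 | x <- enum {: 'I_w * 'I_r * 'I_#|expo n m|}]
  ++ flatten [seq [seq b tj.1 * (A tj.2)@_x | x <- msupp (A tj.2)] | tj <- enum {: 'I_w * 'I_r}]
  ++ flatten [seq [seq b tj.1 * (B tj.2)@_x | x <- msupp (B tj.2)] | tj <- enum {: 'I_w * 'I_r}]
  ++ [seq F@_x | x <- msupp F] ++ [seq G@_x | x <- msupp G]
  ++ [seq a y.1.2 * (invmx (colsub (fun_of_fin y.1.1) Phi) *m Phi) y.2.1 y.2.2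
      | y : {ffun 'I_r -> 'I_#|expo n m|} * 'I_w0 * ('I_r * 'I_#|expo n m|) <- enum {: {ffun 'I_r -> 'I_#|expo n m|} * 'I_w0 * ('I_r * 'I_#|expo n m|)}].
pose C := abs_pvals (iota := iota) X; have [sC usC hsC] := abs_pvals_fin H X.
have C0const : h = 0%N -> forall p, C p = 0%N.
  move=> /hconst hc p; apply: abs_pvals_const => x.
  have [ha hb hPhi hinv hAB] := cst (fun x => proj1 (hc x)) (fun x => proj2 (hc x)).
  rewrite !mem_cat => /or4P[/mapP[y _ ->]|/flatten_mapP[tj _ /mapP[y _ ->]]|/flatten_mapP[tj _ /mapP[y _ ->]]|].
  - exact: constM.
  - by apply: constM => //; case: (hAB tj.2 y).
  - by apply: constM => //; case: (hAB tj.2 y).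
  case/or3P => /mapP[y _ ->]; [by case: (hc y)|by case: (hc y)|exact: constM].
pose cs := (\sum_(p <- sC) C p)%N.
have csE : \sum_(p <- sC) (C p)%:Z = cs%:Z.
  by rewrite /cs -[RHS]natz natr_sum; apply: eq_bigr => p _; rewrite natz.
(* Either h >= 1, or all these functions are constant and [cs = 0]. *)
have csh : (cs <= cs * h)%N.
  have [h0|hp] := posnP h; last by rewrite leq_pmulr.
  by rewrite h0 muln0 leqn0 /cs big1 // => p _; apply: C0const.
have CPhi p t i l : `|pval p (b t * Phi i l)| <= (C p)%:Z.
  by apply: abs_pvals_mem; rewrite mem_cat; apply/orP; left; apply/mapP; exists ((t, i), l); rewrite ?mem_enum.
have vgeX p x : x \in X -> vge p (- (C p)%:Z) x := @vge_abs_pvals _ _ _ X p x.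
have CA p t j x : vge p (- (C p)%:Z) (b t * (A j)@_x).
  have [xA|xA] := boolP (x \in msupp (A j)); last first.
    by rewrite (eqP (_ : (A j)@_x == 0)) ?mcoeff_eq0 // mulr0 vge_0.
  apply: vgeX; rewrite !mem_cat; apply/or4P; apply: Or42; apply/flatten_mapP.
  by exists (t, j); rewrite ?mem_enum //; apply/mapP; exists x.
have CB p t j x : vge p (- (C p)%:Z) (b t * (B j)@_x).
  have [xA|xA] := boolP (x \in msupp (B j)); last first.
    by rewrite (eqP (_ : (B j)@_x == 0)) ?mcoeff_eq0 // mulr0 vge_0.
  apply: vgeX; rewrite !mem_cat; apply/or4P; apply: Or43; apply/flatten_mapP.
  by exists (t, j); rewrite ?mem_enum //; apply/mapP; exists x.
have CF p x : vge p (- (C p)%:Z) F@_x.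
  have [xA|xA] := boolP (x \in msupp F); last by rewrite (eqP (_ : F@_x == 0)) ?mcoeff_eq0 // vge_0.
  apply: vgeX; rewrite !mem_cat; apply/or4P; apply: Or44; apply/or3P; apply: Or31.
  by apply/mapP; exists x.
have CG p x : vge p (- (C p)%:Z) G@_x.
  have [xA|xA] := boolP (x \in msupp G); last by rewrite (eqP (_ : G@_x == 0)) ?mcoeff_eq0 // vge_0.
  apply: vgeX; rewrite !mem_cat; apply/or4P; apply: Or44; apply/or3P; apply: Or32.
  by apply/mapP; exists x.
have CL p (P : {ffun 'I_r -> 'I_#|expo n m|}) t j l :
    vge p (- (C p)%:Z) (a t * (invmx (colsub P Phi) *m Phi) j l).
  apply: vgeX; rewrite !mem_cat; apply/or4P; apply: Or44; apply/or3P; apply: Or33.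
  by apply/mapP; exists ((P, t), (j, l)); rewrite ?mem_enum.
set N1 := #|{: ('I_w * 'I_r * 'I_#|expo n m|) * 'I_#|expo n m|}|.
pose c1 := (C0 * 'C(N1, 2) + (2 * N1 + 4) * cs)%N.
pose c2 := (C0 * 'C(w * r, 2) + 2 * cs)%N.
exists m, (c1 + c2)%N => S u uS S0 hu.
have [T [D [e [[uT ST HD Dnz] [regT lossT eM]]]]] := hder S uS S0.
rewrite -/(chi S) in eM.
have hu' := sunit_pval hu.
have M0 : 0 <= C0%:Z * chi S by rewrite mulr_ge0 ?chi_ge0.
have chi0 := chi_ge0 S.
case: (classic (kfree iota (fun i : 'I_w * 'I_r =>
   b i.1 * \sum_l Phi i.2 l * unit_mon u (enum_val l)))) => [hf|nf]; last first.
  left; have [x [y [xy hxy]]] := dependent_case H HD Dnz uT regT lossT eM M0 ST hu' rf ib usC hsC CPhi nf.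
  exists x, y; split=> //; apply: le_trans hxy _; rewrite csE -/N1.
  have le1 : C0%:Z * chi S * 'C(N1, 2)%:Z <= (c1 + c2)%N%:Z * chi S.
    by rewrite mulrAC -PoszM; apply: ler_wpM2r => //; rewrite lez_nat /c1 -!addnA leq_addr.
  have le2 : (2 * N1 + 4)%N%:Z * cs%:Z <= (c1 + c2)%N%:Z * h%:Z.
    rewrite -!PoszM lez_nat; apply: (@leq_trans ((2 * N1 + 4) * (cs * h))); first by rewrite leq_mul2l csh orbT.
    by rewrite mulnA leq_mul2r /c1 -addnA addnCA leq_addr orbT.
  by rewrite mulrDr; apply: lerD.
right; have [nz hineq] := free_case H HD Dnz uT regT lossT eM M0 uS ST hu' rf ABE ia w0w wgt r0 hsp usC hsC CPhi CA CB CF CG CL hf.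
split=> //; move: hineq; rewrite csE => hineq.
set Ng := fsumn _ in hineq *; set N := #|expo n m| in hineq ineq1 *.
pose hm := hmax iota u.
have hineqR : (w * r)%N%:R * Ng%:R <= (C0%:Z * chi S * 'C(w * r, 2)%:Z)%:~R + 2 * (w * r)%N%:R * cs%:R
     + ((w0 * (N - r) + (w - w0) * r) * m)%N%:R * (n * hm)%N%:R :> R.
  have : (w * r)%N%:Z * Ng%:Z <= C0%:Z * chi S * 'C(w * r, 2)%:Z + 2 * (w * r)%N%:Z * cs%:Z
       + ((w0 * (N - r) + (w - w0) * r) * m)%N%:Z * (n * hm)%N%:Z.
    by apply: le_trans hineq _; rewrite lerD2l ler_wpM2l // lez_nat sum_ht_le.
  by rewrite -(ler_int R) !rmorphD !rmorphM /= => h1; apply: le_trans h1 _.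
have Bc : (C0%:Z * chi S * 'C(w * r, 2)%:Z)%:~R + 2 * cs%:R <= (c1 + c2)%N%:R * (chi S + h%:Z)%:~R :> R.
  have le3 : C0%:Z * chi S * 'C(w * r, 2)%:Z <= (c1 + c2)%N%:Z * chi S.
    by rewrite mulrAC -PoszM; apply: ler_wpM2r => //; rewrite lez_nat /c2 addnCA leq_addr.
  have le4 : 2 * cs%:Z <= (c1 + c2)%N%:Z * h%:Z.
    rewrite -!PoszM lez_nat; apply: (@leq_trans (2 * (cs * h))); first by rewrite leq_mul2l csh orbT.
    by rewrite mulnA leq_mul2r /c2 addnA leq_addl orbT.
  have : C0%:Z * chi S * 'C(w * r, 2)%:Z + 2 * cs%:Z <= (c1 + c2)%N%:Z * (chi S + h%:Z).
    by rewrite mulrDr; apply: lerD.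
  move: (C0%:Z * _ * _) (c1 + c2)%N (chi S + _) => B1 c3 y.
  by rewrite -(ler_int R) intrD !intrM.
apply: le_trans (lerD Bc (lexx _)).
have [w_0 r_0] : 0 <= w%:R :> R /\ 0 <= r%:R :> R by rewrite !ler0n.
apply: (@average_bound w%:R w0%:R (w - w0)%N%:R r%:R (N - r)%N%:R (m * n)%N%:R).
- by rewrite ler0n ler_nat.
- by [].
- by rewrite -natrM ler1n muln_gt0 wgt.
- exact: ler0n.
- by rewrite ler0z; apply: mulr_ge0.
- by rewrite -natrM.
- by rewrite -natrM.
- apply: le_trans (le_trans _ hineqR) _; first by rewrite natrM.
  by rewrite !natrM !natrD !natrM -!mulrA.
by rewrite -natrM ler0n.
Qed.

Lemma uniform_inside n (F : {mpoly K[n]}) (h : nat) : F@_0 != 0 ->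
  (h = 0%N -> forall x, is_const iota F@_x) ->
  exists m c : nat, forall S (u : 'I_n -> K), uniq S -> S != [::] -> (forall i, S_unit S (u i)) ->
    (exists x y : expo n m, x != y /\
       (ht iota (unit_mon u x / unit_mon u y))%:Z <= c%:Z * (chi S + h%:Z)) \/
    (F.@[u] != 0 /\ \sum_(p <- S) (v0 p F.@[u])%:Z <= c%:Z * (chi S + h%:Z)).
Proof.
move=> F0 hconst.
(* A box large enough for F, and nonempty so that it contains the constant monomial. *)
pose m := (\max_(i < n) size (markvar i F)).+1.
have boxF : inbox (fun=> m) F.
  by move=> i; apply: leqW; apply: (leq_bigmax (F := fun i => size (markvar i F))).
have [w [b [ib hb _ cb]]] := coef_space H (fun l : 'I_(size (msupp F)) => F@_(tnth (in_tuple (msupp F)) l)).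
have spanF x : kspan iota b F@_x.
  have [xF|xF] := boolP (x \in msupp F).
    by have /tnthP[l ->] : x \in in_tuple (msupp F) by []; apply: hb.
  by rewrite (eqP (_ : F@_x == 0)) ?mcoeff_eq0 //; exists (fun=> 0); rewrite big1 // => t _; rewrite rmorph0 mul0r.
have [C0 hder] := derivation_ex H.
pose X := [seq b t | t <- enum 'I_w].
pose C := abs_pvals (iota := iota) X; have [sC usC hsC] := abs_pvals_fin H X.
have C0const : h = 0%N -> forall p, C p = 0%N.
  by move=> /hconst hc p; apply: abs_pvals_const => x /mapP[t _ ->]; apply: cb.
pose cs := (\sum_(p <- sC) C p)%N.
have csE : \sum_(p <- sC) (C p)%:Z = cs%:Z.
  by rewrite /cs -[RHS]natz natr_sum; apply: eq_bigr => p _; rewrite natz.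
have csh : (cs <= cs * h)%N.
  have [h0|hp] := posnP h; last by rewrite leq_pmulr.
  by rewrite h0 muln0 leqn0 /cs big1 // => p _; apply: C0const.
have Cb p t : `|pval p (b t)| <= (C p)%:Z.
  by apply: abs_pvals_mem; apply/mapP; exists t; rewrite ?mem_enum.
set N1 := #|{: ('I_w * 'I_#|expo n m| * 'I_#|expo n m|) * 'I_#|expo n m|}|.
have bound (M : int) a1 a2 c : 0 <= M -> (C0 * a1 <= c)%N -> (a2 * cs <= c)%N ->
    C0%:Z * M * a1%:Z + a2%:Z * cs%:Z <= c%:Z * (M + h%:Z).
  move=> M0 h1 h2; rewrite mulrDr; apply: lerD; first by rewrite mulrAC -PoszM; apply: ler_wpM2r.
  rewrite -!PoszM lez_nat; apply: (@leq_trans (a2 * (cs * h))); first by rewrite leq_mul2l csh orbT.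
  by rewrite mulnA leq_mul2r h2 orbT.
pose c1 := (C0 * 'C(N1, 2) + (2 * N1 + 4) * cs)%N.
pose c2 := (C0 * 'C(w * #|expo n m|, 2) + (w * #|expo n m|) * cs)%N.
exists m, (c1 + c2)%N => S u uS S0 hu.
have [T [D [e [[uT ST HD Dnz] [regT lossT eM]]]]] := hder S uS S0.
rewrite -/(chi S) in eM.
have hu' := sunit_pval hu.
have M0 : 0 <= C0%:Z * chi S by rewrite mulr_ge0 ?chi_ge0.
have chi0 := chi_ge0 S.
case: (classic (kfree iota (fun i : 'I_w * 'I_#|expo n m| => b i.1 * unit_mon u (enum_val i.2)))) => [hf|nf].
  right; have [nz hineq] := proximity_inside H HD Dnz uT regT lossT eM M0 uS ST hu' (ltn0Sn _) boxF F0 spanF usC hsC Cb hf.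
  split=> //; apply: le_trans hineq _; rewrite csE; apply: bound => //.
    by rewrite /c2 addnCA leq_addr.
  by rewrite /c2 addnA leq_addl.
left; have [x [y [xy hxy]]] := monomials_dependent H HD Dnz uT regT lossT eM M0 ST hu' ib usC hsC Cb nf.
exists x, y; split=> //; apply: le_trans hxy _; rewrite csE -/N1; apply: bound => //.
  by rewrite /c1 -!addnA leq_addr.
by rewrite /c1 -addnA addnCA leq_addr.
Qed.

End Uniform.

(** * Combination of the two estimates *)

Section Assembly.
Variables (R : realType) (k : closedFieldType) (K : fieldType) (iota : {rmorphism k -> K}) (g : nat).
Hypothesis H : genus_field iota g.
Implicit Types (S : seq (place iota)) (p : place iota).

Lemma unit_mon_ratio n m (u : 'I_n -> K) (x y : expo n m) : (forall i, u i != 0) -> x != y ->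
  exists mm : 'I_n -> int, [/\ exists i, mm i != 0, (\sum_(i < n) `|mm i| <= n * m)%N &
    \prod_(i < n) u i ^ mm i = unit_mon u x / unit_mon u y].
Proof.
move=> u0 xy; exists (fun i => (x i : nat)%:Z - (y i : nat)%:Z); split.
- apply: NNPP => nex; move/eqP: xy; apply; apply/ffunP => i; apply/val_inj/eqP.
  by rewrite -eqz_nat -subr_eq0; apply/negPn/negP => h; apply: nex; exists i.
- apply: (@leq_trans (\sum_(i < n) m)%N); last by rewrite sum_nat_const card_ord.
  by apply: leq_sum => i _; have := ltn_ord (x i); have := ltn_ord (y i); lia.
rewrite /unit_mon -prodf_div; apply: eq_bigr => i _.
by rewrite expfzDr // exprnN.
Qed.

Lemma meval_at0 n (F : {mpoly K[n]}) : F.@[fun _ => 0] = F@_0.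
Proof.
have h (x : 'X_{1..n}) : x != 0%MM -> \prod_(i < n) (0 : K) ^+ x i = 0.
  move=> x0; have /existsP[i xi] : [exists i, x i != 0%N].
    apply: contraNT x0; rewrite negb_exists => /forallP h; apply/eqP/mnmP => i.
    by rewrite mnmE; apply/eqP; have := h i; rewrite negbK.
  by apply/eqP/prodf_eq0; exists i; rewrite // expf_eq0 eqxx lt0n xi.
rewrite mevalE; have [F0|F0] := boolP (0%MM \in msupp F).
  rewrite (bigD1_seq 0%MM) ?msupp_uniq //= [X in _ + X]big1 => [|x x0]; last by rewrite h ?mulr0.
  by rewrite addr0 big1 ?mulr1 // => i _; rewrite mnmE expr0.
rewrite big_seq big1 => [|x xF]; first by apply/esym/eqP; rewrite mcoeff_eq0.
by rewrite h ?mulr0 //; apply: contraNneq F0 => <-.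
Qed.

Lemma nonconstant_neq0 n (F : {mpoly K[n]}) : nonconstant F -> F != 0.
Proof. by apply: contraTneq => ->; rewrite /nonconstant msize0. Qed.

Lemma nonconstant_dim n (F : {mpoly K[n]}) : nonconstant F -> (0 < n)%N.
Proof.
case: n F => // F; rewrite /nonconstant msizeE ltnNge => /negP[].
by apply/bigmax_leqP_seq => x _ _; rewrite mdegE big_ord0.
Qed.

Lemma loc_gcd_le_l p x y : x != 0 -> (loc_gcd p x y <= v0 p x)%N.
Proof. by move=> x0; rewrite /loc_gcd (negbTE x0); case: ifP => // _; apply: geq_minl. Qed.

Lemma loc_gcd_le_r p x y : y != 0 -> (loc_gcd p x y <= v0 p y)%N.
Proof. by move=> y0; rewrite /loc_gcd (negbTE y0); case: ifP => // _; apply: geq_minr. Qed.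

Lemma loc_gcd_support x y : exists2 s : seq (place iota), uniq s &
  forall p, loc_gcd p x y <> 0%N -> p \in s.
Proof.
apply: fin_places_uniq; apply: fin_placesS (fin_placesU (fin_support H x) (fin_support H y)) => p.
rewrite /loc_gcd /v0; have [->|] := eqVneq (pval p x) 0; last by move=> /eqP; left.
by have [->|] := eqVneq (pval p y) 0; [case: ifP => //; case: ifP|move=> /eqP; right].
Qed.

Lemma gcd_split n S (u : 'I_n -> K) (F G : {mpoly K[n]}) : uniq S ->
  (fsumn (fun p => loc_gcd p F.@[u] G.@[u]))%:Z =
  (fsumn (gcd_out S u F G))%:Z + \sum_(p <- S) (loc_gcd p F.@[u] G.@[u])%:Z.
Proof.
move=> uS; have [s0 us0 hs0] := loc_gcd_support F.@[u] G.@[u].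
pose s := undup (S ++ s0).
have hs p : loc_gcd p F.@[u] G.@[u] <> 0%N -> p \in s.
  by move=> /hs0 ps; rewrite mem_undup mem_cat ps orbT.
have us : uniq s := undup_uniq _.
rewrite (fsumnE us hs) (@fsumnE _ _ _ (gcd_out S u F G) s) // => [|p]; last first.
  by rewrite /gcd_out; case: ifP => // _; apply: hs.
rewrite (bigID (fun p => p \notin S)) /=; congr (_ + _).
  by rewrite big_mkcond; apply: eq_bigr => p _; rewrite /gcd_out not_inE; case: ifP.
rewrite -big_filter; apply: perm_big; apply: uniq_perm; rewrite ?filter_uniq //.
by move=> p; rewrite mem_filter negbK mem_undup mem_cat; case: (p \in S).
Qed.

Definition small_relation n S (u : 'I_n -> K) (h m c : nat) : Prop :=
  exists mm : 'I_n -> int, [/\ exists i, mm i != 0, (\sum_(i < n) `|mm i| <= m)%N &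
    (ht iota (\prod_(i < n) u i ^ mm i))%:Z <= c%:Z * (chi g S + h%:Z)].

Lemma small_relation_ratio n S (u : 'I_n -> K) (h m c m' c' : nat) (x y : expo n m) :
  (forall i, u i != 0) -> x != y -> (n * m <= m')%N -> (c <= c')%N ->
  (ht iota (unit_mon u x / unit_mon u y))%:Z <= c%:Z * (chi g S + h%:Z) ->
  small_relation S u h m' c'.
Proof.
move=> u0 xy mm' cc' hh; have [mm [nz le e]] := unit_mon_ratio u0 xy.
exists mm; split=> //; first exact: leq_trans le mm'.
rewrite e; apply: le_trans hh _; apply: ler_wpM2r; last by rewrite lez_nat.
by rewrite addr_ge0 ?chi_ge0.
Qed.

(** The full gcd is its part outside S plus a part on S, the latter bounded by the zeros of
    whichever of F(u), G(u) comes from a polynomial with nonzero constant term. *)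
Lemma uniform_bounds (p0 : place iota) n (F G : {mpoly K[n]}) (eps : R) (h : nat) : 0 < eps ->
  F != 0 -> G != 0 -> coprime_mpoly F G ->
  (h = 0%N -> forall x, is_const iota F@_x /\ is_const iota G@_x) ->
  exists m c : nat, forall S (u : 'I_n -> K), uniq S -> S != [::] -> (forall i, S_unit S (u i)) ->
    small_relation S u h m c \/
    [/\ F.@[u] != 0 \/ G.@[u] != 0,
       (fsumn (gcd_out S u F G))%:R <= c%:R * (chi g S + h%:Z)%:~R + eps * (hmax iota u)%:R &
       F@_0 != 0 \/ G@_0 != 0 -> (fsumn (fun p => loc_gcd p F.@[u] G.@[u]))%:R
         <= c%:R * (chi g S + h%:Z)%:~R + eps * (hmax iota u)%:R].
Proof.
move=> eps0 F0 G0 cop hc.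
have [m1 [c1 out]] := uniform_outside H p0 eps0 F0 G0 cop hc.
have inside (P : {mpoly K[n]}) : (h = 0%N -> forall x, is_const iota P@_x) ->
    exists m c : nat, forall S (u : 'I_n -> K), uniq S -> S != [::] -> (forall i, S_unit S (u i)) ->
    P@_0 != 0 -> (exists x y : expo n m, x != y /\
       (ht iota (unit_mon u x / unit_mon u y))%:Z <= c%:Z * (chi g S + h%:Z)) \/
    (P.@[u] != 0 /\ \sum_(p <- S) (v0 p P.@[u])%:Z <= c%:Z * (chi g S + h%:Z)).
  move=> hP; have [P0|P0] := eqVneq P@_0 0; first by exists 0%N, 0%N.
  by have [m [c hm]] := uniform_inside H P0 hP; exists m, c => S u uS S0 hu _; apply: hm.
have [m2 [c2 inF]] := inside F (fun e x => proj1 (hc e x)).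
have [m3 [c3 inG]] := inside G (fun e x => proj2 (hc e x)).
exists (n * (m1 + m2 + m3))%N, (c1 + c2 + c3)%N => S u uS S0 hu.
have u0 i : u i != 0 by case: (hu i).
case: (classic (small_relation S u h (n * (m1 + m2 + m3)) (c1 + c2 + c3))) => [|nrel]; [by left|right].
have norel m c (x y : expo n m) : x != y -> (m <= m1 + m2 + m3)%N -> (c <= c1 + c2 + c3)%N ->
    ~ (ht iota (unit_mon u x / unit_mon u y))%:Z <= c%:Z * (chi g S + h%:Z).
  move=> xy hm hcc hh; apply: nrel; apply: (small_relation_ratio u0 xy _ hcc hh).
  by rewrite leq_mul2l hm orbT.
have X0 : 0 <= chi g S + h%:Z by rewrite addr_ge0 ?chi_ge0.
have [[x [y [xy hh]]]|[nz hout]] := out S u uS S0 hu.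
  by case: (norel _ _ _ _ xy _ _ hh); rewrite -addnA leq_addr.
have XR : 0 <= (chi g S + h%:Z)%:~R :> R by rewrite ler0z.
have total c : (c <= c2 + c3)%N -> \sum_(p <- S) (loc_gcd p F.@[u] G.@[u])%:Z <= c%:Z * (chi g S + h%:Z) ->
    (fsumn (fun p => loc_gcd p F.@[u] G.@[u]))%:R
         <= (c1 + c2 + c3)%N%:R * (chi g S + h%:Z)%:~R + eps * (hmax iota u)%:R :> R.
  move=> cc hs; have := gcd_split u F G uS; set Z1 := fsumn _; set Z2 := fsumn _ in hout *.
  move=> e; have : Z1%:Z <= Z2%:Z + c%:Z * (chi g S + h%:Z) by rewrite e lerD2l.
  rewrite -(ler_int R) intrD intrM => h1; apply: le_trans h1 _.
  have h2 : c%:R * (chi g S + h%:Z)%:~R <= (c2 + c3)%N%:R * (chi g S + h%:Z)%:~R :> R.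
    by apply: ler_wpM2r; rewrite ?ler_nat.
  apply: le_trans (lerD hout h2) _.
  by rewrite -addnA [X in _ <= X * _ + _]natrD mulrDl addrAC.
split=> //.
  apply: le_trans hout _; rewrite lerD2r; apply: ler_wpM2r => //.
  by rewrite ler_nat -addnA leq_addr.
case=> P0.
  have [[x [y [xy hh]]]|[nzF hF]] := inF S u uS S0 hu P0.
    by case: (norel _ _ _ _ xy _ _ hh); rewrite addnAC leq_addl.
  apply: (total c2); first exact: leq_addr.
  by apply: le_trans hF; apply: ler_sum => p _; rewrite lez_nat; apply: loc_gcd_le_l.
have [[x [y [xy hh]]]|[nzG hG]] := inG S u uS S0 hu P0.
  by case: (norel _ _ _ _ xy _ _ hh); rewrite leq_addl.
apply: (total c3); first exact: leq_addl.
by apply: le_trans hG; apply: ler_sum => p _; rewrite lez_nat; apply: loc_gcd_le_r.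
Qed.

(** For empty S the units have neither zeros nor poles, and a single [u i] has height 0. *)
Lemma small_relation_nil n (u : 'I_n -> K) (h : nat) : (0 < n)%N ->
  (forall i, S_unit ([::] : seq (place iota)) (u i)) -> small_relation ([::] : seq (place iota)) u h 1 0.
Proof.
move=> n0 hu; move: (Ordinal n0) => i0; exists (fun i => (i == i0)%:Z); split.
- by exists i0; rewrite eqxx.
- by rewrite (bigD1 i0) //= eqxx big1 // => i /negbTE->.
rewrite (bigD1 i0) //= eqxx big1 => [|i /negbTE->]; last by rewrite expr0z.
by rewrite mulr1 expr1z mul0r (@htE _ _ _ _ [::]) ?big_nil // => p; have [_ ->] := hu i0.
Qed.

End Assembly.

Unset Implicit Arguments.

Theorem theorem1p4 (R : realType) (k : closedFieldType) (K : fieldType)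
    (iota : {rmorphism k -> K}) (genus : nat) (n : nat) (F G : {mpoly K[n]}) :
  [pchar k] =i pred0 ->
  function_field iota ->
  is_genus iota genus ->
  coprime_mpoly F G -> nonconstant F -> nonconstant G ->
  forall eps : R, 0 < eps ->
  exists (m : nat) (c1 c2 c3 c4 : R),
    [/\ 0 < c1, 0 < c2, 0 < c3, 0 < c4 &
    forall S : seq (place iota), List.NoDup S ->
    forall g : 'I_n -> K, (forall i, S_unit S (g i)) ->
      let HS := Num.max 0 (2 * genus%:R - 2 + (size S)%:R) in
      let HFG := ((htilde iota F + htilde iota G)%N)%:R in
      c1 * HFG + c2 * HS <= (hmax iota g)%:R ->
      (exists mm : 'I_n -> int,
         [/\ exists i, mm i != 0,
             (\sum_(i < n) `|mm i| <= 2 * m)%N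
           & (ht iota (\prod_(i < n) g i ^ mm i))%:R <= c3 * HFG + c4 * HS])
      \/
      (NSgcd_le S (F.@[g]) (G.@[g]) (eps * (hmax iota g)%:R) /\
       (F.@[fun _ => 0] != 0 \/ G.@[fun _ => 0] != 0 ->
          hgcd_le iota (F.@[g]) (G.@[g]) (eps * (hmax iota g)%:R)))].
Proof.
move=> ck ff gen cop ncF ncG eps eps0.
have H : genus_field iota genus by split.
have [F0 G0] := (nonconstant_neq0 ncF, nonconstant_neq0 ncG).
pose h := (htilde iota F + htilde iota G)%N.
have eps2 : 0 < eps / 2 by rewrite divr_gt0.
have [m [c hmc]] : exists m c : nat, forall (S : seq (place iota)) (u : 'I_n -> K), uniq S -> S != [::] -> (forall i, S_unit S (u i)) ->
    small_relation genus S u h m c \/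
    [/\ F.@[u] != 0 \/ G.@[u] != 0,
       (fsumn (gcd_out S u F G))%:R <= c%:R * (chi genus S + h%:Z)%:~R + eps / 2 * (hmax iota u)%:R :> R &
       F@_0 != 0 \/ G@_0 != 0 -> (fsumn (fun p : place iota => loc_gcd p F.@[u] G.@[u]))%:R
         <= c%:R * (chi genus S + h%:Z)%:~R + eps / 2 * (hmax iota u)%:R :> R].
  case: (classic (exists p0 : place iota, True)) => [[p0 _]|np]; last first.
    by exists 0%N, 0%N => -[|p S] // u _ _ _; case: np; exists p.
  apply: (uniform_bounds H p0 eps2 F0 G0 cop) => h0 x.
  by move/eqP: h0; rewrite addn_eq0 => /andP[/eqP hF /eqP hG]; split; apply: (htilde_const H p0).
(* Chosen so that max h(g_i) >= c0 t yields c t <= (eps / 2) max h(g_i), for t the sum of the two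
   error terms. *)
pose c0 : R := 2 * c%:R / eps + 1.
have c00 : 0 < c0 by apply: ltr_wpDl => //; apply: divr_ge0; [apply: mulr_ge0|apply: ltW].
(* [c + 1] is positive even when c = 0, and [m + 1] leaves room for the relation of length one used
   for empty S. *)
exists m.+1, c0, c0, (c%:R + 1), (c%:R + 1); split=> //; try by rewrite ltr_wpDl.
move=> S /List_NoDupP uS u hu HS HFG hmax_ge.
have HSE : HS = (chi genus S)%:~R.
  rewrite /HS /chi -[in RHS]natz -[in RHS](natz (size S)).
  have -> : 2 * genus%:R - 2 + (size S)%:R = (2 * genus%:R - 2 + (size S)%:R : int)%:~R :> R.
    by rewrite !rmorphD rmorphN rmorphM /= !rmorph_nat.
  by rewrite !maxEle ler0z; case: ifP.
have HFGE : HFG = h%:~R by [].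
have sumE : (chi genus S + h%:Z)%:~R = HFG + HS by rewrite intrD HSE HFGE addrC.
have HS0 : 0 <= HS by rewrite le_max lexx.
have rel_case : small_relation genus S u h m.+1 c -> exists mm : 'I_n -> int,
         [/\ exists i, mm i != 0, (\sum_(i < n) `|mm i| <= 2 * m.+1)%N
           & (ht iota (\prod_(i < n) u i ^ mm i))%:R <= (c%:R + 1) * HFG + (c%:R + 1) * HS].
  move=> [mm [nz le hh]]; exists mm; split=> //; first by apply: leq_trans le _; rewrite leq_pmull.
  move: hh; rewrite -(ler_int R) intrM sumE => hh; apply: le_trans hh _.
  by rewrite -mulrDr; apply: ler_wpM2r; rewrite ?addr_ge0 // lerDl.
have [S0|S0] := eqVneq S [::].
  left; apply: rel_case; subst S; have [mm [nz le hh]] := small_relation_nil genus h (nonconstant_dim ncF) hu.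
  exists mm; split=> //; first exact: leq_trans le _.
  by apply: le_trans hh _; rewrite mul0r mulr_ge0 // addr_ge0 ?chi_ge0.
have [[mm [nz le hh]]|[nz hN hG]] := hmc S u uS S0 hu.
  by left; apply: rel_case; exists mm; split=> //; apply: leqW.
have err : c%:R * (chi genus S + h%:Z)%:~R + eps / 2 * (hmax iota u)%:R <= eps * (hmax iota u)%:R.
  rewrite sumE; move: hmax_ge; rewrite -mulrDr; set t := HFG + HS; move: (hmax iota u)%:R => y hy.
  have t0 : 0 <= t by rewrite addr_ge0.
  have : eps / 2 * (c0 * t) <= eps / 2 * y by rewrite ler_wpM2l // ltW.
  have -> : eps / 2 * (c0 * t) = c%:R * t + eps / 2 * t by rewrite /c0; field; rewrite gt_eqF.
  have : 0 <= eps / 2 * t by rewrite mulr_ge0 // ltW.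
  by lra.
right; split; first by split=> //; apply: le_trans hN err.
by rewrite !meval_at0 => FG0; split=> //; apply: le_trans (hG FG0) err.
Qed.
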